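(* Let $\alpha,\beta:S^1\to\mathbb{C}$ both be continuous. Then $$\sigma(S_{\alpha,\beta})=\operatorname{range}\alpha\cup\operatorname{range}\beta\cup\{a\in\mathbb{C}: a\notin(\operatorname{range}\alpha\cup\operatorname{range}\beta)\text{ and }\operatorname{ind}_a\alpha\neq\operatorname{ind}_a\beta\}.$$
   Context: $S^1=\{z\in\mathbb{C}:|z|=1\}$ carries normalized Lebesgue measure; $L^2=L^2(S^1)$, $L^\infty=L^\infty(S^1)$ (complex-valued functions). $H^2$ is the Hardy space of all $f\in L^2$ whose negative Fourier coefficients vanish, and $H^{2\bot}$ is its orthogonal complement in $L^2$. $P$ and $Q=I-P$ are the orthogonal projections of $L^2$ onto $H^2$ and $H^{2\bot}$. For $\alpha,\beta\in L^\infty$, the operator $S_{\alpha,\beta}$ on $L^2$ is $S_{\alpha,\beta}f=\alpha Pf+\beta Qf$, and $\sigma(S_{\alpha,\beta})$ is its spectrum. For a continuous $\phi:S^1\to\mathbb{C}$, regarded as the closed curve $\theta\mapsto\phi(e^{i\theta})$, $0\le\theta\le2\pi$, and $a\notin\operatorname{range}\phi$, the index $\operatorname{ind}_a\phi=\frac1{2\pi i}\int_\phi\frac{1}{z-a}\,dz$ is the winding number of $\phi$ around $a$. *)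

(* Defs.v *)
From HB Require Import structures.
From mathcomp Require Import all_boot all_order all_algebra.
From mathcomp Require Import complex.
From mathcomp Require Import all_classical all_reals all_analysis measurable_realfun.

Set Implicit Arguments.
Unset Strict Implicit.
Unset Printing Implicit Defensive.

Import Order.TTheory GRing.Theory Num.Theory ComplexField.
Import numFieldNormedType.Exports.

Local Open Scope classical_set_scope.
Local Open Scope complex_scope.
Local Open Scope ring_scope.

Local Notation Re := (@complex.Re _).
Local Notation Im := (@complex.Im _).
Local Notation normc := (@Normc.normc _).

(* The library puts the metric structure of a numFieldType on its regular      *)
(* algebra only; R[i] needs its own instance.                                  *)
HB.instance Definition _ (R : rcfType) := NormedModule.copy R[i] R[i]^o.

Section complex_L2.
Context d (T : measurableType d) (R : realType).
Variable mu : {measure set T -> \bar R}.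
Local Open Scope quotient_scope.

Definition cmeasurable (f : T -> R[i]) :=
  measurable_fun [set: T] (Re \o f) /\ measurable_fun [set: T] (Im \o f).

Lemma cmeasurableD f g : cmeasurable f -> cmeasurable g -> cmeasurable (f + g).
Proof.
move=> [f1 f2] [g1 g2]; split.
- rewrite (_ : _ \o _ = (Re \o f) \+ (Re \o g)); first exact: measurable_funD.
  by apply/funext => x /=; rewrite fctE; case: (f x) (g x) => [? ?] [].
- rewrite (_ : _ \o _ = (Im \o f) \+ (Im \o g)); first exact: measurable_funD.
  by apply/funext => x /=; rewrite fctE; case: (f x) (g x) => [? ?] [].
Qed.

Lemma cmeasurableM f g : cmeasurable f -> cmeasurable g -> cmeasurable (f \* g).
Proof.
move=> [f1 f2] [g1 g2]; split.
- rewrite (_ : _ \o _ = ((Re \o f) \* (Re \o g)) \- ((Im \o f) \* (Im \o g))).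
    by apply: measurable_funB; apply: measurable_funM.
  by apply/funext => x /=; case: (f x) (g x) => [? ?] [].
- rewrite (_ : _ \o _ = ((Re \o f) \* (Im \o g)) \+ ((Im \o f) \* (Re \o g))).
    by apply: measurable_funD; apply: measurable_funM.
  by apply/funext => x /=; case: (f x) (g x) => [? ?] [].
Qed.

Lemma cmeasurable_cst c : cmeasurable (cst c).
Proof. by split; exact: measurable_cst. Qed.

Lemma measurable_normc f : cmeasurable f -> measurable_fun [set: T] (normc \o f).
Proof.
move=> [f1 f2].
rewrite (_ : _ \o _ =
  @Num.sqrt R \o (fun x => (Re (f x)) ^+ 2 + (Im (f x)) ^+ 2)); last first.
  by apply/funext => x /=; case: (f x).
apply: measurableT_comp.
  apply: continuous_measurable_fun; exact: sqrt_continuous.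
by apply: measurable_funD; apply: measurable_funX.
Qed.

Definition sqint : {pred T -> R[i]} :=
  mem [set f | cmeasurable f /\ (normc \o f) \in Lfun mu 2%:E].

Lemma sqintP f :
  (f \in sqint) <-> cmeasurable f /\ (normc \o f) \in Lfun mu 2%:E.
Proof. by rewrite /sqint inE. Qed.

Lemma normcZ (a b : R[i]) : normc (a * b) = normc a * normc b.
Proof. exact: Normc.normcM. Qed.

Lemma normc_ge0 (a : R[i]) : 0 <= normc a.
Proof. by case: a => *; exact: sqrtr_ge0. Qed.

Lemma measurable_normpow2 (f : T -> R) : measurable_fun [set: T] f ->
  measurable_fun [set: T] (fun x => (`|(EFin \o f) x| `^ 2)%E).
Proof.
move=> mf; apply: (measurableT_comp (measurable_poweR _)) => //.
by apply: measurableT_comp => //; exact/measurable_EFinP.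
Qed.

Lemma le_Lnorm2 (f g : T -> R) :
  measurable_fun [set: T] f -> measurable_fun [set: T] g ->
  (forall x, `|f x| <= g x) ->
  (Lnorm mu 2%:E (EFin \o f) <= Lnorm mu 2%:E (EFin \o g))%E.
Proof.
move=> mf mg fg; rewrite unlock /Lnorm; apply: gt0_ler_poweR => //.
- by rewrite in_itv /= leey integral_ge0 // => x _; exact: poweR_ge0.
- by rewrite in_itv /= leey integral_ge0 // => x _; exact: poweR_ge0.
apply: ge0_le_integral => //.
- by move=> x _; exact: poweR_ge0.
- exact: measurable_normpow2.
- exact: measurable_normpow2.
- move=> x _ /=; rewrite lee_fin ge0_ler_powR ?nnegrE//.
  by rewrite (le_trans (fg x))// ler_norm.
Qed.

Lemma ae_eq_Lnorm2 (f g : T -> R) :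
  measurable_fun [set: T] f -> measurable_fun [set: T] g ->
  f = g %[ae mu] -> Lnorm mu 2%:E (EFin \o f) = Lnorm mu 2%:E (EFin \o g).
Proof.
move=> mf mg fg; rewrite unlock /Lnorm; congr (_ `^ _)%E.
apply: ae_eq_integral => //; try exact: measurable_normpow2.
by apply: filterS fg => x /= /(_ I) ->.
Qed.

Lemma sqint_le (f : T -> R[i]) (g : T -> R) : cmeasurable f ->
  g \in Lfun mu 2%:E -> (forall x, normc (f x) <= g x) -> f \in sqint.
Proof.
move=> mf lg fg; apply/sqintP; split=> //.
move: lg; rewrite !inE => /andP[/[!inE]/= mg lg].
have mnf := measurable_normc mf.
apply/andP; split; rewrite inE //=.
apply: le_lt_trans lg; apply: le_Lnorm2 => // x /=.
by rewrite ger0_norm ?normc_ge0.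
Qed.

Lemma sqint_submod_closed : submod_closed sqint.
Proof.
split.
  apply: (@sqint_le _ (cst 0)); first exact: cmeasurable_cst.
    exact: (@Lfun_submod_closed _ T R mu 2%:E (lee1n 2)).1.
  by move=> x; rewrite /cst [X in X <= _]Normc.normc0.
move=> a f g /sqintP[mf lf] /sqintP[mg lg].
apply: (@sqint_le _ (normc a *: (normc \o f) + (normc \o g))).
- apply: cmeasurableD => //; apply: (@cmeasurableM (cst a) f) => //.
  exact: cmeasurable_cst.
- exact: (@Lfun_submod_closed _ T R mu 2%:E (lee1n 2)).2.
- by move=> x; apply: le_trans (le_normcD _ _) _; rewrite normcZ.
Qed.

HB.instance Definition _ :=
  GRing.isSubmodClosed.Build _ _ sqint sqint_submod_closed.

Definition sqfun : Type := {f : T -> R[i] | f \in sqint}.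
HB.instance Definition _ := Choice.on sqfun.
HB.instance Definition _ := SubType.on sqfun.
HB.instance Definition _ := [SubChoice_isSubLmodule of sqfun by <:].

Definition sqfun_fun (f : sqfun) : T -> R[i] := val f.
Coercion sqfun_fun : sqfun >-> Funclass.

Lemma sqfunD (f g : sqfun) t : (f + g : sqfun) t = f t + g t. Proof. by []. Qed.
Lemma sqfunN (f : sqfun) t : (- f : sqfun) t = - f t. Proof. by []. Qed.
Lemma sqfunZ a (f : sqfun) t : (a *: f : sqfun) t = a * f t. Proof. by []. Qed.
Lemma sqfun0 t : (0 : sqfun) t = 0. Proof. by []. Qed.

Definition sqfunE := (sqfunD, sqfunN, sqfunZ, sqfun0).

Definition ae_eq_sqfun (f g : sqfun) := `[< (f : T -> R[i]) = g %[ae mu] >].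

Lemma ae_eq_sqfun_refl : reflexive ae_eq_sqfun.
Proof. by move=> f; apply/asboolP; apply: nearW. Qed.

Lemma ae_eq_sqfun_sym : symmetric ae_eq_sqfun.
Proof.
by move=> f g; apply/idP/idP => /asboolP h; apply/asboolP; exact: ae_eq_sym.
Qed.

Lemma ae_eq_sqfun_trans : transitive ae_eq_sqfun.
Proof.
by move=> f g h /asboolP gf /asboolP fh; apply/asboolP/(ae_eq_trans gf fh).
Qed.

Canonical ae_eq_sqfun_equiv :=
  EquivRel ae_eq_sqfun ae_eq_sqfun_refl ae_eq_sqfun_sym ae_eq_sqfun_trans.

Definition cL2 : Type := {eq_quot ae_eq_sqfun}.
HB.instance Definition _ := Choice.on cL2.
HB.instance Definition _ := EqQuotient.on cL2.


Definition cL2_pi (f : sqfun) : cL2 := \pi_cL2 f.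

Lemma cL2_piP (f g : sqfun) :
  cL2_pi f = cL2_pi g <-> (f : T -> R[i]) = g %[ae mu].
Proof.
split=> [/eqquotP/asboolP //|fg].
by apply/eqquotP/asboolP.
Qed.

Definition cL2_fun (x : cL2) : T -> R[i] := repr x.
Coercion cL2_fun : cL2 >-> Funclass.

Lemma cL2_reprE (x : cL2) t : repr x t = x t. Proof. by []. Qed.

Lemma cL2_piE (f : sqfun) : (cL2_pi f : T -> R[i]) = f %[ae mu].
Proof. by apply/cL2_piP; rewrite /cL2_pi reprK. Qed.

Lemma cL2P (x y : cL2) : x = y <-> (x : T -> R[i]) = y %[ae mu].
Proof. by rewrite -{1}[x]reprK -{1}[y]reprK; exact: cL2_piP. Qed.

Definition cL2_zero : cL2 := cL2_pi 0.
Definition cL2_opp (x : cL2) : cL2 := cL2_pi (- repr x).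
Definition cL2_add (x y : cL2) : cL2 := cL2_pi (repr x + repr y).
Definition cL2_scale (a : R[i]) (x : cL2) : cL2 := cL2_pi (a *: repr x).

Lemma cL2_zeroE : (cL2_zero : T -> R[i]) = (fun=> 0) %[ae mu].
Proof. exact: cL2_piE. Qed.

Lemma cL2_oppE x : (cL2_opp x : T -> R[i]) = (fun t => - x t) %[ae mu].
Proof. exact: cL2_piE. Qed.

Lemma cL2_addE x y :
  (cL2_add x y : T -> R[i]) = (fun t => x t + y t) %[ae mu].
Proof. exact: cL2_piE. Qed.

Lemma cL2_scaleE a x :
  (cL2_scale a x : T -> R[i]) = (fun t => a * x t) %[ae mu].
Proof. exact: cL2_piE. Qed.

Lemma cL2_addA : associative cL2_add.
Proof.
move=> x y z; apply/cL2_piP.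
apply: filterS2 (cL2_addE y z) (cL2_addE x y) => t /(_ I) h1 /(_ I) h2 _.
by rewrite !(sqfunD, cL2_reprE) h1 h2 addrA.
Qed.

Lemma cL2_addC : commutative cL2_add.
Proof. by move=> x y; rewrite /cL2_add addrC. Qed.

Lemma cL2_add0 : left_id cL2_zero cL2_add.
Proof.
move=> x; apply/cL2P.
apply: filterS2 (cL2_addE cL2_zero x) cL2_zeroE => t /(_ I) h1 /(_ I) h2 _.
by rewrite h1 h2 add0r.
Qed.

Lemma cL2_addN : left_inverse cL2_zero cL2_opp cL2_add.
Proof.
move=> x; apply/cL2_piP.
apply: filterS (cL2_oppE x) => t /(_ I) h _.
by rewrite !(sqfunE, cL2_reprE) h addNr.
Qed.

HB.instance Definition _ :=
  GRing.isZmodule.Build cL2 cL2_addA cL2_addC cL2_add0 cL2_addN.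

Lemma cL2_scaleA a b x :
  cL2_scale a (cL2_scale b x) = cL2_scale (a * b) x.
Proof.
apply/cL2_piP.
apply: filterS (cL2_scaleE b x) => t /(_ I) h _.
by rewrite !(sqfunE, cL2_reprE) h mulrA.
Qed.

Lemma cL2_scale1 : left_id 1 cL2_scale.
Proof. by move=> x; rewrite /cL2_scale scale1r /cL2_pi reprK. Qed.

Lemma cL2_scaleDr : right_distributive cL2_scale +%R.
Proof.
move=> a x y; apply/cL2_piP.
apply: filterS3 (cL2_addE x y) (cL2_scaleE a x) (cL2_scaleE a y) =>
  t /(_ I) h1 /(_ I) h2 /(_ I) h3 _.
by rewrite !(sqfunE, cL2_reprE) h1 h2 h3 mulrDr.
Qed.

Lemma cL2_scaleDl x : {morph cL2_scale^~ x : a b / a + b}.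
Proof.
move=> a b; apply/cL2_piP.
apply: filterS2 (cL2_scaleE a x) (cL2_scaleE b x) => t /(_ I) h1 /(_ I) h2 _.
by rewrite !(sqfunE, cL2_reprE) h1 h2 mulrDl.
Qed.

HB.instance Definition _ := GRing.Zmodule_isLmodule.Build R[i] cL2
  cL2_scaleA cL2_scale1 cL2_scaleDr cL2_scaleDl.

Lemma cL2_meas (x : cL2) : cmeasurable x.
Proof. by have /sqintP[] := valP (repr x). Qed.

Lemma cL2_Lfun (x : cL2) : (normc \o x) \in Lfun mu 2%:E.
Proof. by have /sqintP[] := valP (repr x). Qed.

Lemma cL2_fin (x : cL2) : Lnorm mu 2%:E (EFin \o (normc \o x)) \is a fin_num.
Proof.
have := cL2_Lfun x; rewrite inE => /andP[_]; rewrite inE /= => lx.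
by rewrite ge0_fin_numE ?Lnorm_ge0.
Qed.

(* The norm of a normedModType takes its values in the scalar field, here R[i]. *)
Definition cL2_norm (x : cL2) : R[i] :=
  (fine (Lnorm mu 2%:E (EFin \o (normc \o x))))%:C.

Lemma cL2_normD (x y : cL2) : cL2_norm (x + y) <= cL2_norm x + cL2_norm y.
Proof.
rewrite /cL2_norm -rmorphD /= lecR -lee_fin (EFinD (fine _)) !fineK ?cL2_fin//.
have mx := measurable_normc (cL2_meas x).
have my := measurable_normc (cL2_meas y).
have mxy := measurable_normc (cmeasurableD (cL2_meas x) (cL2_meas y)).
rewrite (@ae_eq_Lnorm2 _ (normc \o ((x : T -> R[i]) + (y : T -> R[i])))) //.
- apply: le_trans (eminkowski _ _ _ _) => //; last by rewrite lee1n.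
  apply: le_Lnorm2 => // [|t /=]; first exact: measurable_funD.
  rewrite ger0_norm ?normc_ge0//; exact: le_normcD.
- exact: measurable_normc (cL2_meas _).
- by apply: filterS (cL2_addE x y) => t /(_ I) h _ /=; rewrite h.
Qed.

Lemma cL2_normZ (a : R[i]) (x : cL2) : cL2_norm (a *: x) = `|a| * cL2_norm x.
Proof.
have mx := cL2_meas x.
have max : cmeasurable (fun t => a * x t).
  exact: (cmeasurableM (cmeasurable_cst a)).
rewrite /cL2_norm (@ae_eq_Lnorm2 _ (normc \o (fun t => a * x t))).
- have lx := cL2_Lfun x.
  have := LnormZ (Lfun_Sub (lee1n 2) lx) (normc a).
  rewrite /= ger0_norm ?normc_ge0// => E.
  rewrite (_ : normc \o _ = normc a \*: (normc \o x)); last first.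
    by apply/funext => t /=; rewrite normcZ.
  by rewrite E fineM ?cL2_fin// rmorphM.
- exact: measurable_normc (cL2_meas _).
- exact: measurable_normc.
- by apply: filterS (cL2_scaleE a x) => t /(_ I) h _ /=; rewrite h.
Qed.

Lemma cL2_norm0 (x : cL2) : cL2_norm x = 0 -> x = 0.
Proof.
move=> x0; have := congr1 (fun z => (complex.Re z)%:E) x0.
rewrite /= fineK ?cL2_fin// => h0; apply/cL2P.
have mx := measurable_normc (cL2_meas x).
have h' : (EFin \o (normc \o x)) = cst 0%E %[ae mu].
  by apply: Lnorm_eq0_eq0 h0 => //; exact/measurable_EFinP.
apply: filterS2 h' cL2_zeroE => t /(_ I) [] /Normc.eq0_normc -> /(_ I) h2 _.
by rewrite h2.
Qed.

HB.instance Definition _ := Lmodule_isNormed.Build R[i] cL2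
  cL2_normD cL2_normZ cL2_norm0.

(* The default value 0 is only reached when a * x is not square-integrable,    *)
(* which does not happen for bounded measurable a: see cL2_mulE.               *)
Definition cL2_mul (a : T -> R[i]) (x : cL2) : cL2 :=
  cL2_pi (insubd 0 (fun t => a t * x t)).

Lemma cL2_mulE (a : T -> R[i]) (M : R) (x : cL2) :
  cmeasurable a -> (forall t, normc (a t) <= M) ->
  (cL2_mul a x : T -> R[i]) = (fun t => a t * x t) %[ae mu].
Proof.
move=> ma aM.
have axP : (fun t => a t * x t) \in sqint.
  apply: (@sqint_le _ (M *: (normc \o x))).
  - exact: cmeasurableM (cL2_meas x).
  - rewrite -[_ *: _]addr0; apply: (@Lfun_submod_closed _ T R mu 2%:E (lee1n 2)).2.
      exact: cL2_Lfun.
    exact: (@Lfun_submod_closed _ T R mu 2%:E (lee1n 2)).1.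
  - by move=> t; rewrite normcZ; apply: ler_wpM2r => //; exact: normc_ge0.
have E : val (insubd (0 : sqfun) (fun t => a t * x t)) = (fun t => a t * x t).
  exact: insubdK.
apply: filterS (cL2_piE (insubd 0 (fun t => a t * x t))) => t /(_ I) -> _.
exact: (congr1 (@^~ t) E).
Qed.

Definition cintegral (f : T -> R[i]) : R[i] :=
  (\int[mu]_x complex.Re (f x)) +i* (\int[mu]_x complex.Im (f x)).

Definition cL2_dot (x y : cL2) : R[i] :=
  cintegral (fun t => x t * (y t)^*%C).

Definition cL2_orth (M : set cL2) : set cL2 :=
  [set x | forall y, M y -> cL2_dot x y = 0].

(* At most one y qualifies when M is a subspace, and one exists when M is       *)
(* moreover closed; otherwise the value may be arbitrary.                       *)
Definition cL2_proj (M : set cL2) (x : cL2) : cL2 :=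
  xget 0 [set y | M y /\ cL2_orth M (x - y)].

End complex_L2.

Section operators.
Variables (K : numFieldType) (V : normedModType K).

Definition bounded_operator (A : V -> V) :=
  linear A /\ exists M : K, forall x, `|A x| <= M * `|x|.

Definition spectrum (A : V -> V) : set K :=
  [set a | ~ exists B : V -> V, bounded_operator B /\
     (forall x, B (A x - a *: x) = x) /\ (forall x, A (B x) - a *: B x = x)].

End operators.

Section circle.
Variable R : realType.

Definition S1 : Type := set_type [set z : R[i] | `|z| = 1].

HB.instance Definition _ := Topological.on S1.

Definition S1_val (z : S1) : R[i] := set_val z.

Lemma expi_subproof (t : R) : (cos t +i* sin t) \in [set z : R[i] | `|z| = 1].
Proof. by rewrite inE /= normc_def /= cos2Dsin2 sqrtr1. Qed.

Definition expi (t : R) : S1 := exist _ (cos t +i* sin t) (expi_subproof t).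

Lemma cvg_complex (u v : R -> R) :
  continuous u -> continuous v -> continuous (fun t => u t +i* v t : R[i]).
Proof.
move=> cu cv t; apply/cvgrPdist_lt => -[e e'].
rewrite ltcE /= => /andP[/eqP-> e0].
have e20 : 0 < e / 2 by rewrite divr_gt0.
have /cvgrPdist_lt/(_ _ e20) hu := cu t.
have /cvgrPdist_lt/(_ _ e20) hv := cv t.
near=> s.
have us : `|u t - u s| < e / 2 by near: s.
have vs : `|v t - v s| < e / 2 by near: s.
rewrite normc_def ltcE /= eqxx /=.
rewrite (@le_lt_trans _ _ (`|u t - u s| + `|v t - v s|))//; last first.
  by rewrite (splitr e) ltrD.
rewrite -[leRHS]ger0_norm ?addr_ge0// -sqrtr_sqr ler_sqrt ?sqr_ge0//.
rewrite [leRHS]sqrrD !real_normK ?num_real// lerD2r lerDl.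
by rewrite mulrn_wge0// mulr_ge0.
Unshelve. all: by end_near. Qed.

Lemma continuous_expi : continuous expi.
Proof.
apply: continuous_comp_initial.
apply: cvg_complex; [exact: continuous_cos|exact: continuous_sin].
Qed.

HB.instance Definition _ := isPointed.Build S1 (expi 0).
HB.instance Definition _ :=
  Measurable.copy S1 (g_sigma_algebraType (@open S1)).

Lemma measurable_expi :
  @measurable_fun _ _ (measurableTypeR R) S1 [set: measurableTypeR R] expi.
Proof.
apply: (@measurability _ _ _ _ _ _ (@open S1)) => //.
move=> _ [U oU <-]; rewrite setTI; apply: open_measurable.
by move/continuousP : continuous_expi; exact.
Qed.

Lemma twopi_gt0 : (0 : R) < 2 * pi.
Proof. by rewrite mulr_gt0// pi_gt0. Qed.

Definition expi_mfun : {mfun measurableTypeR R >-> S1} :=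
  @mfun_Sub _ _ (measurableTypeR R) S1 expi (mem_set measurable_expi).

(* Normalized Lebesgue measure, as the law of exp(it) for t uniform on [0, 2pi]. *)
Definition S1_measure := distribution (uniform_prob twopi_gt0) expi_mfun.
HB.instance Definition _ := Probability.on S1_measure.

End circle.
Arguments S1_measure : clear implicits.

Notation L2 R := (cL2 (S1_measure R)).

Section toeplitz.
Variable R : realType.

Definition fourier_coeff (f : L2 R) (n : int) : R[i] :=
  cintegral (S1_measure R) (fun z => f z * S1_val z ^ (- n)).

Definition hardy2 : set (L2 R) :=
  [set f | forall n : int, n < 0 -> fourier_coeff f n = 0].

Definition hardy_proj (f : L2 R) : L2 R := cL2_proj hardy2 f.

Definition hardy_coproj (f : L2 R) : L2 R := f - hardy_proj f.

Definition singular_op (alpha beta : S1 R -> R[i]) (f : L2 R) : L2 R :=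
  cL2_mul alpha (hardy_proj f) + cL2_mul beta (hardy_coproj f).

End toeplitz.

Section index.
Variable R : realType.

(* The path gamma is only continuous, so the integral of f along gamma is      *)
(* F b - F a for F a primitive of f along gamma: near each parameter, F is the  *)
(* composition with gamma of a local holomorphic primitive of f.               *)
Definition primitive_along (f : R[i] -> R[i]) (gamma : R -> R[i]) (a b : R)
    (F : R -> R[i]) :=
  forall t, t \in `[a, b] -> exists (U : set R[i]) (G : R[i] -> R[i]),
    [/\ open U, forall z, U z -> is_derive z (1 : R[i]) G (f z) &
      \forall s \near within [set` `[a, b]] (nbhs t),
        U (gamma s) /\ F s = G (gamma s)].

Definition path_integral (f : R[i] -> R[i]) (gamma : R -> R[i]) (a b : R) :
    R[i] :=
  xget 0 [set F b - F a | F in primitive_along f gamma a b].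

Definition winding_index (a : R[i]) (phi : S1 R -> R[i]) : R[i] :=
  (2 * pi%:C * 'i%C)^-1 *
  path_integral (fun z => (z - a)^-1) (phi \o @expi R) 0 (2 * pi).

End index.

(* Main.v *)
(**
  An operator S_{a,b} = aP + bQ is multiplicative in its symbols whenever the
  right factor has an analytic first symbol and a coanalytic second one:
  S_{a,b} S_{h,k} = S_{ah,bk}.  By Fejer interpolation at the roots of unity, a
  nonvanishing continuous f is a trigonometric polynomial up to a factor u with
  |u - 1| small; splitting the roots of the polynomial according to their
  position with respect to the circle gives f = u z^n h k with h, 1/h analytic
  and k, 1/k coanalytic.  Each factor has an explicit continuous logarithm along
  the circle, whence ind_0 f = n.  Dividing the factorizations of alpha - a and
  beta - a reduces the invertibility of S_{alpha,beta} - a to that of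
  S_{u z^n,1} with n = ind_a alpha - ind_a beta.  For n = 0 this is a Neumann
  series; for n > 0 it is S_{u,1} S_{z^n,1}, where S_{u,1} is invertible and
  S_{z^n,1} misses the constants; for n < 0 multiply by S_{z^-n,1} on the right.
  Finally, if alpha - a vanishes at z0, then S_{alpha,beta} - a is not bounded
  below on the polynomials sum_{j < m} (z / z0)^j, on which it is multiplication
  by alpha - a, and whose square moduli concentrate at z0; negative exponents
  give the same for beta.
*)
Require Import Defs.
From HB Require Import structures.
From mathcomp Require Import all_boot all_order all_algebra.
From mathcomp Require Import complex.
From mathcomp Require Import all_classical all_reals all_analysis measurable_realfun.
From mathcomp Require Import ring lra zify.

Set Implicit Arguments.
Unset Strict Implicit.
Unset Printing Implicit Defensive.

Import Order.TTheory GRing.Theory Num.Theory ComplexField.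
Import numFieldNormedType.Exports.

Local Open Scope classical_set_scope.
Local Open Scope complex_scope.
Local Open Scope ring_scope.

Local Notation Re := (@complex.Re _).
Local Notation Im := (@complex.Im _).
Local Notation normc := (@Normc.normc _).

(** * Complex numbers and the Hilbert space L2 *)
Section complex_norm.
Variable R : realType.
Implicit Types z w : R[i].

(** The factor [u] is never split into analytic and coanalytic parts: [S_{u,1} = I + (u - 1)P] and
    [P] is a contraction, so uniform closeness to 1 is enough. This matters because the Riesz
    projections of a continuous function need not be bounded. The product formula constrains only
    the right factor. With [alpha - a = (beta - a) u z^n h k], the operator is therefore
    multiplication by [(beta - a) k], after [S_{u z^n,1}], after [S_{h,1/k}]: the coanalytic factor
    enters the last one inverted. Both [cL2_proj] and [path_integral] are choices with a default
    value, and each has to be shown meaningful. The projection needs completeness of L2 and a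
    minimizing sequence; H2 is described as the orthogonal complement of the negative modes, which
    makes closedness automatic. The path integral needs that two primitives along a path have the
    same increment; then any continuous logarithm computes the index. *)

Lemma normC_normc z : `|z| = (normc z)%:C.
Proof. by case: z => a b; rewrite normc_def. Qed.

Lemma normc_sq z : normc z ^+ 2 = Re z ^+ 2 + Im z ^+ 2.
Proof. by case: z => a b /=; rewrite sqr_sqrtr// addr_ge0// sqr_ge0. Qed.

Lemma mulc_conjc z : z * z^*%C = (normc z ^+ 2)%:C.
Proof.
rewrite normc_sq; case: z => a b /=; simpc; rewrite -!expr2; congr (_ +i* _).
by rewrite [b * a]mulrC addNr.
Qed.

Lemma normc_conjc z : normc z^*%C = normc z.
Proof. by case: z => a b /=; rewrite sqrrN. Qed.

Lemma Re_le_normc z : `|Re z| <= normc z.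
Proof.
case: z => a b /=; rewrite -sqrtr_sqr ler_wsqrtr// lerDl; exact: sqr_ge0.
Qed.

Lemma Im_le_normc z : `|Im z| <= normc z.
Proof.
case: z => a b /=; rewrite -sqrtr_sqr ler_wsqrtr// lerDr; exact: sqr_ge0.
Qed.

Lemma normc_le_ReIm z : normc z <= `|Re z| + `|Im z|.
Proof.
case: z => a b /=; have ab0 : 0 <= `|a| + `|b| by rewrite addr_ge0.
rewrite -[leRHS](ger0_norm ab0) -(sqrtr_sqr (_ + _)).
rewrite ler_wsqrtr// sqrrD !real_normK ?num_real// lerD2r lerDl.
by rewrite mulrn_wge0// mulr_ge0.
Qed.

Lemma normc_real (a : R) : normc a%:C = `|a|.
Proof. by rewrite /= expr0n /= addr0 sqrtr_sqr. Qed.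

Lemma normcB z w : normc (z - w) = normc (w - z).
Proof. by rewrite -normcN opprB. Qed.

Lemma ler_dist_normc z w : `|normc z - normc w| <= normc (z - w).
Proof.
have h1 := le_normcD (z - w) w; have h2 := le_normcD (w - z) z.
rewrite !subrK (normcB w) in h1 h2.
by rewrite ler_norml; apply/andP; split; lra.
Qed.

Lemma normc_gt0 z : (0 < normc z) = (z != 0).
Proof.
rewrite lt_neqAle normc_ge0 andbT eq_sym; congr negb.
by apply/eqP/eqP => [/Normc.eq0_normc|->]; last exact: Normc.normc0.
Qed.

Lemma normc_eq1 z : `|z| = 1 -> normc z = 1.
Proof. by rewrite normC_normc => /(@complexI R). Qed.

Lemma complex_gt0 z : 0 < z -> exists2 r : R, 0 < r & z = r%:C.
Proof.
case: z => a b; rewrite ltcE /= => /andP[/eqP-> a0].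
by exists a.
Qed.

End complex_norm.

Lemma nbhs_normc (R : realType) (z : R[i]) (U : set R[i]) : nbhs z U <->
  exists2 r : R, 0 < r & forall w, normc (z - w) < r -> U w.
Proof.
split=> [/nbhs_ballP[_ /= /complex_gt0[r r0 ->] rU]|[r r0 rU]].
  by exists r => // w zw; apply: rU; rewrite /ball /= normC_normc ltcR.
apply/nbhs_ballP; exists r%:C => [|w]; first by rewrite /= ltcR.
by rewrite /ball /= normC_normc ltcR; exact: rU.
Qed.

Lemma cvg_normcP (R : realType) (T : Type) (F : set_system T) (FF : Filter F)
    (f : T -> R[i]) z : f x @[x --> F] --> z <->
  forall e : R, 0 < e -> \forall x \near F, normc (z - f x) < e.
Proof.
split=> [/cvgrPdist_lt H e e0|H].
  have eC : 0 < e%:C by rewrite ltcR.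
  by apply: filterS (H _ eC) => x; rewrite normC_normc ltcR.
apply/cvgrPdist_lt => _ /complex_gt0[e e0 ->].
by apply: filterS (H e e0) => x; rewrite normC_normc ltcR.
Qed.

(** Both [g] and [u + g] are nondecreasing and bounded, and [u] is their difference. *)
Lemma cvg_dominated_increments (R : realType) (u g : nat -> R) (B : R) :
  (forall n, `|u n.+1 - u n| <= g n.+1 - g n) -> (forall n, g n <= B) ->
  cvgn u.
Proof.
move=> ug gB.
have g_nd : nondecreasing_seq g.
  by apply/nondecreasing_seqP => n; rewrite -subr_ge0 (le_trans _ (ug n)).
have cg : cvgn g.
  by apply: nondecreasing_is_cvgn => //; exists B => _ [n _ <-].
have cug : cvgn (u \+ g).
  apply: nondecreasing_is_cvgn.
    apply/nondecreasing_seqP => n /=; have := ug n.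
    by rewrite ler_norml => /andP[h _]; lra.
  have H n : u n <= u 0%N + g n - g 0%N.
    elim: n => [|n IH]; first by rewrite addrK.
    by have := ug n; rewrite ler_norml => /andP[_ h]; lra.
  exists (u 0%N + B - g 0%N + B) => _ [n _ <-] /=.
  by have := H n; have := gB n; lra.
have -> : u = (u \+ g) \- g by apply/funext => n /=; rewrite addrK.
exact: is_cvgB.
Qed.

Section cL2_hilbert.
Context d (T : measurableType d) (R : realType).
Variable mu : {measure set T -> \bar R}.
Implicit Types x y z : cL2 mu.

(** The norm of [cL2] takes values in [R[i]]; order and limit arguments are carried out on this real
    version. *)
Definition hnorm x : R := fine (Lnorm mu 2%:E (EFin \o (normc \o x))).

Lemma normr_hnorm x : `|x| = (hnorm x)%:C.
Proof. by []. Qed.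

Lemma hnorm_ge0 x : 0 <= hnorm x.
Proof. by rewrite fine_ge0// Lnorm_ge0. Qed.

Lemma hnorm0 : hnorm 0 = 0.
Proof. by apply: (@complexI R); rewrite -normr_hnorm normr0. Qed.

Lemma hnorm_eq0 x : hnorm x = 0 -> x = 0.
Proof. by move=> x0; apply/normr0_eq0; rewrite normr_hnorm x0. Qed.

Lemma hnormD x y : hnorm (x + y) <= hnorm x + hnorm y.
Proof. by have := ler_normD x y; rewrite !normr_hnorm -rmorphD lecR. Qed.

Lemma hnormN x : hnorm (- x) = hnorm x.
Proof. by apply: (@complexI R); rewrite -!normr_hnorm normrN. Qed.

Lemma hnormBC x y : hnorm (x - y) = hnorm (y - x).
Proof. by rewrite -hnormN opprB. Qed.

Lemma hnormB x y : hnorm (x - y) <= hnorm x + hnorm y.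
Proof. by rewrite -(hnormN y) hnormD. Qed.

Lemma hnormZ a x : hnorm (a *: x) = normc a * hnorm x.
Proof.
by apply: (@complexI R); rewrite -normr_hnorm normrZ rmorphM /= -normC_normc.
Qed.

Lemma Lnorm2_sq (f : T -> \bar R) : Lnorm mu 2%:E f \is a fin_num ->
  ((fine (Lnorm mu 2%:E f) ^+ 2)%:E = \int[mu]_t (`|f t| `^ 2))%E.
Proof.
move=> ff; rewrite -poweR_Lnorm// -{2}(fineK ff) poweR_EFin.
by rewrite powR_mulrn// fine_ge0// Lnorm_ge0.
Qed.

Lemma hnorm_sqE x : ((hnorm x ^+ 2)%:E = \int[mu]_t (normc (x t) ^+ 2)%:E)%E.
Proof.
rewrite Lnorm2_sq ?cL2_fin//; apply: eq_integral => t _ /=.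
by rewrite powR_mulrn// ger0_norm// normc_ge0.
Qed.

Lemma measurable_normc_sq (f : T -> R[i]) : cmeasurable f ->
  measurable_fun setT (fun t => (normc (f t) ^+ 2)%:E).
Proof.
move=> mf; apply/measurable_EFinP; apply: measurable_funX.
exact: measurable_normc.
Qed.

Lemma cmeasurableN (f : T -> R[i]) : cmeasurable f -> cmeasurable (fun t => - f t).
Proof.
move=> mf; rewrite (_ : (fun _ => _) = (fun t => cst (-1) t * f t)).
  by apply: cmeasurableM => //; exact: cmeasurable_cst.
by apply/funext => t; rewrite mulN1r.
Qed.

Lemma cL2_subE x y :
  ((x - y : cL2 mu) : T -> R[i]) = (fun t => x t - y t) %[ae mu].
Proof.
by apply: filterS2 (cL2_addE x (- y)) (cL2_oppE y) => t /(_ I) h1 /(_ I) h2 _;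
  rewrite h1 h2.
Qed.

Lemma hnorm_subE x y :
  ((hnorm (x - y) ^+ 2)%:E = \int[mu]_t (normc (x t - y t) ^+ 2)%:E)%E.
Proof.
rewrite hnorm_sqE; apply: ae_eq_integral => //.
- exact/measurable_normc_sq/cL2_meas.
- apply: measurable_normc_sq; apply: cmeasurableD (cL2_meas _) _.
  exact/cmeasurableN/cL2_meas.
- by apply: filterS (cL2_subE x y) => t /(_ I) -> _.
Qed.

Definition cintegrable (f : T -> R[i]) :=
  mu.-integrable setT (EFin \o (Re \o f)) /\
  mu.-integrable setT (EFin \o (Im \o f)).

Lemma cmeasurable_conj (f : T -> R[i]) :
  cmeasurable f -> cmeasurable (fun t => (f t)^*%C).
Proof.
move=> [mf1 mf2]; split.
  by rewrite (_ : _ \o _ = Re \o f)//; apply/funext => t /=; case: (f t).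
rewrite (_ : _ \o _ = \- (Im \o f)); first exact: measurable_funN.
by apply/funext => t /=; case: (f t).
Qed.

Lemma cintegrable_le (f : T -> R[i]) (g : T -> R) : cmeasurable f ->
  mu.-integrable setT (EFin \o g) -> (forall t, normc (f t) <= g t) ->
  cintegrable f.
Proof.
move=> [mf1 mf2] ig fg.
split; apply: le_integrable ig => //; try exact/measurable_EFinP;
  move=> t _ /=; rewrite lee_fin (le_trans _ (ler_norm _))// (le_trans _ (fg t))//.
- exact: Re_le_normc.
- exact: Im_le_normc.
Qed.

Lemma cL2_dot_measurable x y : cmeasurable (fun t => x t * (y t)^*%C).
Proof. by apply: cmeasurableM (cL2_meas x) _; exact/cmeasurable_conj/cL2_meas. Qed.

Lemma cL2_dot_integrable x y : cintegrable (fun t => x t * (y t)^*%C).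
Proof.
have /Lfun1_integrable := Lfun2_mul_Lfun1 (cL2_Lfun x) (cL2_Lfun y).
move/(cintegrable_le (cL2_dot_measurable x y)); apply => t.
by rewrite normcZ normc_conjc.
Qed.

Lemma cintegralD f g : cintegrable f -> cintegrable g ->
  cintegral mu (fun t => f t + g t) = cintegral mu f + cintegral mu g.
Proof.
move=> [f1 f2] [g1 g2]; rewrite /cintegral.
under eq_Rintegral do rewrite raddfD.
under [X in _ +i* X = _]eq_Rintegral do rewrite raddfD.
by rewrite !RintegralD.
Qed.

Lemma cintegralZ c f : cintegrable f ->
  cintegral mu (fun t => c * f t) = c * cintegral mu f.
Proof.
move=> [f1 f2]; case: c => a b; rewrite /cintegral.
have E1 t : Re ((a +i* b) * f t) = a * Re (f t) - b * Im (f t) by case: (f t).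
have E2 t : Im ((a +i* b) * f t) = a * Im (f t) + b * Re (f t) by case: (f t).
under eq_Rintegral do rewrite E1.
under [X in _ +i* X = _]eq_Rintegral do rewrite E2.
have iZ r g : mu.-integrable setT (EFin \o g) ->
    mu.-integrable setT (EFin \o (fun t => r * g t)).
  by move=> ig; rewrite (_ : _ \o _ = (fun t => r%:E * (EFin \o g) t)%E)//;
    exact: integrableZl.
by rewrite RintegralB ?RintegralD ?RintegralZl//; exact: iZ.
Qed.

Lemma cintegral_conj f : cintegrable f ->
  cintegral mu (fun t => (f t)^*%C) = (cintegral mu f)^*%C.
Proof.
move=> [f1 f2]; rewrite /cintegral /=.
have E1 t : Re ((f t)^*%C) = Re (f t) by case: (f t).
have E2 t : Im ((f t)^*%C) = -1 * Im (f t) by rewrite mulN1r; case: (f t).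
under eq_Rintegral do rewrite E1.
under [X in _ +i* X = _]eq_Rintegral do rewrite E2.
by rewrite RintegralZl// mulN1r.
Qed.

Lemma ae_eq_cintegral f g : cmeasurable f -> cmeasurable g -> f = g %[ae mu] ->
  cintegral mu f = cintegral mu g.
Proof.
move=> [f1 f2] [g1 g2] fg; congr (fine _ +i* fine _); apply: ae_eq_integral => //;
  try exact/measurable_EFinP; by apply: filterS fg => t /(_ I) -> _.
Qed.

Lemma cL2_dotC x y : cL2_dot y x = (cL2_dot x y)^*%C.
Proof.
rewrite /cL2_dot -cintegral_conj; last exact: cL2_dot_integrable.
by congr cintegral; apply/funext => t; rewrite rmorphM /= conjcK mulrC.
Qed.

Lemma cL2_dotDl x y z : cL2_dot (x + y) z = cL2_dot x z + cL2_dot y z.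
Proof.
rewrite /cL2_dot -cintegralD; try exact: cL2_dot_integrable.
apply: ae_eq_cintegral; first exact: cL2_dot_measurable.
  by apply: cmeasurableD; exact: cL2_dot_measurable.
by apply: filterS (cL2_addE x y) => t /(_ I) -> _; rewrite mulrDl.
Qed.

Lemma cL2_dotZl a x y : cL2_dot (a *: x) y = a * cL2_dot x y.
Proof.
rewrite /cL2_dot -cintegralZ; last exact: cL2_dot_integrable.
apply: ae_eq_cintegral; first exact: cL2_dot_measurable.
  by apply: cmeasurableM (cmeasurable_cst _ _) _; exact: cL2_dot_measurable.
by apply: filterS (cL2_scaleE a x) => t /(_ I) -> _; rewrite mulrA.
Qed.

Lemma cL2_dotDr x y z : cL2_dot x (y + z) = cL2_dot x y + cL2_dot x z.
Proof. by rewrite !(cL2_dotC _ x) cL2_dotDl rmorphD. Qed.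

Lemma cL2_dotZr a x y : cL2_dot x (a *: y) = a^*%C * cL2_dot x y.
Proof. by rewrite !(cL2_dotC _ x) cL2_dotZl rmorphM. Qed.

Lemma cL2_dotNl x y : cL2_dot (- x) y = - cL2_dot x y.
Proof. by rewrite -scaleN1r cL2_dotZl mulN1r. Qed.

Lemma cL2_dotNr x y : cL2_dot x (- y) = - cL2_dot x y.
Proof. by rewrite !(cL2_dotC _ x) cL2_dotNl rmorphN. Qed.

Lemma cL2_dotBl x y z : cL2_dot (x - y) z = cL2_dot x z - cL2_dot y z.
Proof. by rewrite cL2_dotDl cL2_dotNl. Qed.

Lemma cL2_dot0l x : cL2_dot 0 x = 0.
Proof. by rewrite -(scale0r 0) cL2_dotZl mul0r. Qed.

Lemma cL2_dot0r x : cL2_dot x 0 = 0.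
Proof. by rewrite cL2_dotC cL2_dot0l rmorph0. Qed.

Lemma cL2_dotxx x : cL2_dot x x = (hnorm x ^+ 2)%:C.
Proof.
rewrite /cL2_dot /cintegral.
under eq_Rintegral do rewrite mulc_conjc.
under [X in _ +i* X = _]eq_Rintegral do rewrite mulc_conjc.
by rewrite /= /Rintegral integral0 -hnorm_sqE.
Qed.

Lemma hnormD_sq x y :
  hnorm (x + y) ^+ 2 = hnorm x ^+ 2 + hnorm y ^+ 2 + 2 * Re (cL2_dot x y).
Proof.
apply: (@complexI R); rewrite -cL2_dotxx cL2_dotDl !cL2_dotDr !cL2_dotxx.
rewrite (cL2_dotC x y); case: (cL2_dot x y) => a b /=.
by apply/eqP; rewrite eq_complex /=; apply/andP; split; apply/eqP; ring.
Qed.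

Lemma hnormB_sq x y :
  hnorm (x - y) ^+ 2 = hnorm x ^+ 2 + hnorm y ^+ 2 - 2 * Re (cL2_dot x y).
Proof.
by rewrite hnormD_sq hnormN cL2_dotNr raddfN /= mulrN.
Qed.

(** Pythagoras for the distance from [x] to the line of [y]. It yields both the Cauchy-Schwarz
    inequality and the orthogonality of a minimizer. *)
Lemma hnorm_sub_proj x y : hnorm y != 0 ->
  hnorm (x - (cL2_dot x y / (hnorm y ^+ 2)%:C) *: y) ^+ 2 =
  hnorm x ^+ 2 - normc (cL2_dot x y) ^+ 2 / hnorm y ^+ 2.
Proof.
move=> y0; have y2 : hnorm y ^+ 2 != 0 by rewrite expf_neq0.
rewrite hnormB_sq hnormZ cL2_dotZr exprMn !normc_sq -fmorphV.
by case: (cL2_dot x y) => a b /=; field.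
Qed.

Lemma cauchy_schwarz x y : normc (cL2_dot x y) <= hnorm x * hnorm y.
Proof.
have [y0|y0] := eqVneq (hnorm y) 0.
  by rewrite (hnorm_eq0 y0) cL2_dot0r Normc.normc0 hnorm0 mulr0.
have yp : 0 < hnorm y by rewrite lt_neqAle eq_sym y0 hnorm_ge0.
rewrite -(@ler_pXn2r _ 2%N) ?nnegrE ?mulr_ge0 ?normc_ge0 ?hnorm_ge0//.
by rewrite exprMn -ler_pdivrMr ?exprn_gt0// -subr_ge0 -hnorm_sub_proj// sqr_ge0.
Qed.

End cL2_hilbert.

(** * Completeness of L2 (Riesz-Fischer) *)

Lemma limn_einf_le (R : realType) (u : (\bar R)^nat) (c : \bar R) :
  (forall n, u n <= c)%E -> (limn_einf u <= c)%E.
Proof.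
move=> uc; rewrite limn_einf_lim; apply: lime_le; first exact: is_cvg_einfs.
by apply: nearW => n; apply: le_trans (uc n); apply: ereal_inf_lbound; exists n => /=.
Qed.

Lemma measurable_fun_limn_einf d (T : measurableType d) (R : realType)
    (D : set T) (f : (T -> \bar R)^nat) :
  (forall n, measurable_fun D (f n)) ->
  measurable_fun D (fun x => limn_einf (f ^~ x)).
Proof.
move=> mf; rewrite /limn_einf; apply: measurableT_comp => //.
by apply: (@measurable_fun_limn_esup _ _ _ _ (fun n t => (- f n t)%E)) => n;
  exact: measurableT_comp.
Qed.

Section cL2_complete.
Context d (T : measurableType d) (R : realType).
Variable mu : {measure set T -> \bar R}.
Variables (x : nat -> cL2 mu) (M : R).
Hypothesis xM : forall N, \sum_(n < N) hnorm (x n.+1 - x n) <= M.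

Let D n (t : T) := normc (x n.+1 t - x n t).
Let G N t := \sum_(n < N) D n t.
Let s N := \sum_(n < N) hnorm (x n.+1 - x n).

Let mB m n : cmeasurable (fun t => x m t - x n t).
Proof. by apply: cmeasurableD (cL2_meas _) _; exact/cmeasurableN/cL2_meas. Qed.

Let mD n : measurable_fun setT (D n).
Proof. exact: measurable_normc (mB _ _). Qed.

Let mG N : measurable_fun setT (G N).
Proof. by apply: measurable_sum => n; exact: mD. Qed.

Let D_ge0 n t : 0 <= D n t.
Proof. exact: normc_ge0. Qed.

Let G_ge0 N t : 0 <= G N t.
Proof. by apply: sumr_ge0 => n _; exact: D_ge0. Qed.

Let D_Lnorm n : Lnorm mu 2%:E (EFin \o D n) = (hnorm (x n.+1 - x n))%:E.
Proof.
rewrite /hnorm fineK ?cL2_fin//; apply: ae_eq_Lnorm2 => //.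
  exact/measurable_normc/cL2_meas.
by apply: filterS (cL2_subE (x n.+1) (x n)) => t /(_ I) h _ /=; rewrite h.
Qed.

Let sS N : s N.+1 = s N + hnorm (x N.+1 - x N).
Proof. by rewrite /s big_ord_recr. Qed.

Let G_Lnorm N : (Lnorm mu 2%:E (EFin \o G N) <= (s N)%:E)%E.
Proof.
elim: N => [|N IH].
  rewrite (_ : _ \o _ = cst 0%E) ?Lnorm0 ?lee_fin /s ?big_ord0//.
  by apply/funext => t; rewrite /= /G big_ord0.
rewrite sS [(s N + _)%:E]EFinD -D_Lnorm.
rewrite (_ : G N.+1 = (G N \+ D N)); last first.
  by apply/funext => t; rewrite /G big_ord_recr.
by apply: le_trans (eminkowski _ _ _ _) _ => //; [rewrite lee1n|exact: leeD].
Qed.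

Let s_ge0 N : 0 <= s N.
Proof. by apply: sumr_ge0 => n _; exact: hnorm_ge0. Qed.

Let intG N : (\int[mu]_t (G N t ^+ 2)%:E <= (M ^+ 2)%:E)%E.
Proof.
have Gfin : Lnorm mu 2%:E (EFin \o G N) \is a fin_num.
  by rewrite ge0_fin_numE ?Lnorm_ge0// (le_lt_trans (G_Lnorm N))// ltry.
rewrite (_ : (\int[mu]_t _)%E = (fine (Lnorm mu 2%:E (EFin \o G N)) ^+ 2)%:E).
  rewrite lee_fin ler_pXn2r ?nnegrE ?fine_ge0 ?Lnorm_ge0//.
    by rewrite -lee_fin fineK// (le_trans (G_Lnorm N))// lee_fin; exact: xM.
  exact: le_trans (s_ge0 0) (xM 0).
rewrite Lnorm2_sq//; apply: eq_integral => t _ /=.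
by rewrite powR_mulrn// ger0_norm.
Qed.

(** By Minkowski the L2 norm of [G N] is at most [M]. Fatou makes the lower limit of [G N ^+ 2]
    integrable, hence finite almost everywhere, and monotonicity in [N] turns this limit into a
    supremum. *)
Let ae_bounded : {ae mu, forall t, exists B, forall N, G N t <= B}.
Proof.
pose g := fun t => limn_einf (fun N => (G N t ^+ 2)%:E).
have mG2 N : measurable_fun setT (fun t => (G N t ^+ 2)%:E).
  by apply/measurable_EFinP; exact: measurable_funX.
have mg : measurable_fun setT g by exact: measurable_fun_limn_einf.
have g0 t : (0 <= g t)%E.
  rewrite /g limn_einf_lim; apply: lime_ge; first exact: is_cvg_einfs.
  apply: nearW => n; apply/ereal_infP => _ [m _ <-].
  by rewrite lee_fin sqr_ge0.
have ig : mu.-integrable setT g.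
  apply/integrableP; split => //.
  rewrite (eq_integral g); last by move=> t _; rewrite gee0_abs.
  apply: le_lt_trans (fatou mu measurableT mG2 _) _.
    by move=> n t _; rewrite lee_fin sqr_ge0.
  by apply: le_lt_trans (limn_einf_le intG) _; rewrite ltry.
apply: filterS (integrable_ae measurableT ig) => t /(_ I) gt_fin.
have nd : nondecreasing_seq (fun N => (G N t ^+ 2)%:E).
  apply/nondecreasing_seqP => n; rewrite lee_fin ler_pXn2r ?nnegrE//.
  by rewrite /G big_ord_recr /= lerDl.
have cg := ereal_nondecreasing_cvgn nd.
have gE : g t = ereal_sup (range (fun N => (G N t ^+ 2)%:E)).
  by rewrite /g is_cvg_limn_einfE ?(cvg_lim _ cg)//; apply/cvg_ex; eexists; exact: cg.
(* The square root is avoided: [(G - 1)^2 >= 0] gives [2 G <= 1 + G^2]. *)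
exists (1 + fine (g t)) => N.
have h : G N t ^+ 2 <= fine (g t).
  by rewrite -lee_fin fineK// gE; apply: ereal_sup_ubound; exists N.
by have := sqr_ge0 (G N t - 1); nra.
Qed.

(** Upper limits are measurable and defined everywhere, and agree with the limit wherever there is
    one. *)
Let l t := fine (limn_esup (fun n => (Re (x n t))%:E)) +i*
           fine (limn_esup (fun n => (Im (x n t))%:E)).

Let ml : cmeasurable l.
Proof.
split; apply: (@measurableT_comp _ _ _ _ _ _ fine) => //;
  apply: measurable_fun_limn_esup => n; apply/measurable_EFinP.
- exact: (cL2_meas (x n)).1.
- exact: (cL2_meas (x n)).2.
Qed.

Let ae_cvg : {ae mu, forall t, (Re (x n t) @[n --> \oo] --> Re (l t)) /\
  (Im (x n t) @[n --> \oo] --> Im (l t))}.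
Proof.
apply: filterS ae_bounded => t [B GB].
have cvgp (p : R[i] -> R) : {morph p : a b / a - b} ->
    (forall z, `|p z| <= normc z) ->
    p (x n t) @[n --> \oo] --> fine (limn_esup (fun n => (p (x n t))%:E)).
  move=> pB pn.
  have cu : cvgn (fun n => p (x n t)).
    apply: (@cvg_dominated_increments _ _ (fun N => G N t) B) => // n.
    by rewrite /G big_ord_recr /= addrAC subrr add0r -pB; exact: pn.
  have ce : (p (x n t))%:E @[n --> \oo] --> (limn (fun n => p (x n t)))%:E.
    by apply: cvg_EFin => //; apply: nearW.
  rewrite is_cvg_limn_esupE; last by apply/cvg_ex; eexists; exact: ce.
  by rewrite (cvg_lim _ ce).
split; apply: cvgp.
- by move=> ? ?; rewrite raddfB.
- exact: Re_le_normc.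
- by move=> ? ?; rewrite raddfB.
- exact: Im_le_normc.
Qed.

Let hnorm_tail n m : hnorm (x n - x (m + n)%N) <= s (m + n) - s n.
Proof.
elim: m => [|m IH]; first by rewrite add0n !subrr hnorm0.
rewrite addSn sS.
have := hnormD (x n - x (m + n)%N) (x (m + n)%N - x (m + n).+1).
rewrite addrA subrK (hnormBC (x (m + n)%N)); lra.
Qed.

(** Fatou for [|x n - x (m + n)|^2] as [m] grows; each of these integrals is controlled by the tail
    of the summable increments. *)
Let fatou_bound n c : (forall m, s m <= c) ->
  (\int[mu]_t (normc (x n t - l t) ^+ 2)%:E <= ((c - s n) ^+ 2)%:E)%E.
Proof.
move=> sc.
pose h m t := (normc (x n t - x (m + n)%N t) ^+ 2)%:E.
have mh m : measurable_fun setT (h m) by exact: measurable_normc_sq.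
apply: (@le_trans _ _ (\int[mu]_t limn_einf (h ^~ t))%E).
  rewrite le_eqVlt; apply/orP; left; apply/eqP; apply: ae_eq_integral => //.
  - apply: measurable_normc_sq; apply: cmeasurableD (cL2_meas _) _.
    exact/cmeasurableN.
  - exact: measurable_fun_limn_einf.
  apply: filterS ae_cvg => t [cRe cIm] _.
  suff H : h m t @[m --> \oo] --> (normc (x n t - l t) ^+ 2)%:E.
    by rewrite is_cvg_limn_einfE ?(cvg_lim _ H)//; apply/cvg_ex; eexists; exact: H.
  apply: cvg_EFin; first exact: nearW.
  rewrite /h /=.
  under eq_fun do rewrite normc_sq !raddfB.
  rewrite normc_sq !raddfB /=.
  have cvg_sq (p : R[i] -> R) (a : R) : p (x k t) @[k --> \oo] --> a ->
      (p (x n t) - p (x (m + n)%N t)) ^+ 2 @[m --> \oo] --> (p (x n t) - a) ^+ 2.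
    move=> pa; rewrite expr2; under eq_fun do rewrite expr2.
    have pa' : p (x (m + n)%N t) @[m --> \oo] --> a.
      by rewrite (cvg_shiftn n (fun k => p (x k t))).
    by apply: cvgM; apply: cvgB => //; exact: cvg_cst.
  by apply: cvgD; exact: cvg_sq.
apply: le_trans (fatou mu measurableT mh _) _.
  by move=> m t _; rewrite lee_fin sqr_ge0.
apply: limn_einf_le => m; rewrite /h -hnorm_subE lee_fin.
rewrite ler_pXn2r ?nnegrE ?hnorm_ge0 ?subr_ge0//.
by rewrite (le_trans (hnorm_tail n m))// lerB.
Qed.

Theorem cL2_complete : exists y, hnorm (x n - y) @[n --> \oo] --> 0.
Proof.
have s_nd : nondecreasing_seq s.
  apply/nondecreasing_seqP => n; rewrite /s big_ord_recr /= lerDl.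
  exact: hnorm_ge0.
have cs : cvgn s.
  by apply: nondecreasing_is_cvgn => //; exists M => _ [n _ <-]; exact: xM.
have sl m : s m <= limn s by exact: nondecreasing_cvgn_le.
have ml0 : cmeasurable (fun t => x 0%N t - l t).
  by apply: cmeasurableD (cL2_meas _) _; exact/cmeasurableN.
have xl : (fun t => x 0%N t - l t) \in sqint mu.
  apply/sqintP; split => //; rewrite inE; apply/andP; split; rewrite inE //=.
    exact: measurable_normc.
  rewrite /finite_norm unlock /Lnorm; apply: poweR_lty.
  rewrite (eq_integral (fun t => (normc (x 0%N t - l t) ^+ 2)%:E)); last first.
    by move=> t _ /=; rewrite powR_mulrn// ger0_norm// normc_ge0.
  by apply: le_lt_trans (fatou_bound 0 sl) _; rewrite ltry.
pose dl : sqfun mu := exist (fun f => f \in sqint mu) _ xl.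
(* Square integrability is known for [x 0 - l], not for [l] itself, so the limit is represented as
   [x 0 - (x 0 - l)]. *)
exists (x 0%N - cL2_pi dl).
have H n : hnorm (x n - (x 0%N - cL2_pi dl)) <= limn s - s n.
  rewrite -(@ler_pXn2r _ 2%N) ?nnegrE ?hnorm_ge0 ?subr_ge0//.
  rewrite -lee_fin hnorm_subE; apply: le_trans _ (fatou_bound n sl).
  rewrite le_eqVlt; apply/orP; left; apply/eqP; apply: ae_eq_integral => //.
  - apply: measurable_normc_sq; apply: cmeasurableD (cL2_meas _) _.
    exact/cmeasurableN/cL2_meas.
  - apply: measurable_normc_sq; apply: cmeasurableD (cL2_meas _) _.
    exact/cmeasurableN.
  apply: filterS2 (cL2_subE (x 0%N) (cL2_pi dl)) (cL2_piE dl).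
  by move=> t /(_ I) h1 /(_ I) h2 _; rewrite h1 h2 [dl t]/(x 0%N t - l t) subKr.
apply: (@squeeze_cvgr _ _ _ _ (cst 0) (fun n => limn s - s n)).
- by apply: nearW => n; rewrite hnorm_ge0 H.
- exact: cvg_cst.
- by rewrite -(subrr (limn s)); apply: cvgB => //; exact: cvg_cst.
Qed.

End cL2_complete.

(** * Orthogonal projections onto orthogonal complements *)

Section cL2_projection.
Context d (T : measurableType d) (R : realType).
Variable mu : {measure set T -> \bar R}.
Implicit Types (E : set (cL2 mu)) (x y z : cL2 mu).

Lemma cL2_orthD E x y : cL2_orth E x -> cL2_orth E y -> cL2_orth E (x + y).
Proof. by move=> Ex Ey z Ez; rewrite cL2_dotDl Ex// Ey// addr0. Qed.

Lemma cL2_orthZ E a x : cL2_orth E x -> cL2_orth E (a *: x).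
Proof. by move=> Ex z Ez; rewrite cL2_dotZl Ex// mulr0. Qed.

Lemma cL2_orthN E x : cL2_orth E x -> cL2_orth E (- x).
Proof. by rewrite -scaleN1r; exact: cL2_orthZ. Qed.

Lemma cL2_orthB E x y : cL2_orth E x -> cL2_orth E y -> cL2_orth E (x - y).
Proof. by move=> Ex Ey; apply/cL2_orthD/cL2_orthN. Qed.

Lemma cL2_orth0 E : cL2_orth E 0.
Proof. by move=> z _; rewrite cL2_dot0l. Qed.

Lemma cL2_orth_closed E (u : nat -> cL2 mu) x : (forall n, cL2_orth E (u n)) ->
  hnorm (u n - x) @[n --> \oo] --> 0 -> cL2_orth E x.
Proof.
move=> Eu ux z Ez; apply: Normc.eq0_normc; apply/eqP.
rewrite eq_le normc_ge0 andbT.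
have H n : normc (cL2_dot x z) <= hnorm (u n - x) * hnorm z.
  by rewrite hnormBC -{1}(subrK (u n) x) cL2_dotDl Eu// addr0 cauchy_schwarz.
have c : hnorm (u n - x) * hnorm z @[n --> \oo] --> 0.
  by rewrite -(mul0r (hnorm z)); apply: cvgM ux _; exact: cvg_cst.
by rewrite -(cvg_lim _ c)//; apply: limr_ge; [apply/cvg_ex; eexists; exact: c|exact: nearW].
Qed.

(** A minimizing sequence with squared error [4^-n] has, by the parallelogram identity, steps of
    size at most [2 * 2^-n]; these are summable, so completeness gives a limit. The limit stays in
    the subspace because an orthogonal complement is closed. *)
Lemma cL2_orth_proj_ex E x :
  exists y, cL2_orth E y /\ cL2_orth (cL2_orth E) (x - y).
Proof.
pose S := [set hnorm (x - y) ^+ 2 | y in cL2_orth E].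
pose D := inf S.
have hS : has_inf S.
  split; first by exists (hnorm (x - 0) ^+ 2); exists 0 => //; exact: cL2_orth0.
  by exists 0 => _ [y _ <-]; exact: sqr_ge0.
have SD y : cL2_orth E y -> D <= hnorm (x - y) ^+ 2.
  by move=> Ey; apply: ge_inf; [exact: hS.2|exists y].
have e_gt0 n : 0 < (2^-1 ^+ n) ^+ 2 :> R by rewrite !exprn_gt0// invr_gt0.
have /choice[u uP] : forall n, exists y,
    cL2_orth E y /\ hnorm (x - y) ^+ 2 <= D + (2^-1 ^+ n) ^+ 2.
  move=> n; have [_ [y Ey <-] h] := inf_adherent (e_gt0 n) hS.
  by exists y; split => //; exact: ltW.
have u_step n : hnorm (u n.+1 - u n) <= 2 * 2^-1 ^+ n.
  have [E1 h1] := uP n.+1; have [E0 h0] := uP n.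
  have /SD hm : cL2_orth E (2^-1 *: (u n.+1 + u n)).
    exact/cL2_orthZ/cL2_orthD.
  have e_ge0 : 0 <= 2^-1 ^+ n :> R by rewrite exprn_ge0// invr_ge0.
  rewrite -(@ler_pXn2r _ 2%N) ?nnegrE ?hnorm_ge0 ?mulr_ge0//.
  have -> : u n.+1 - u n = (x - u n) - (x - u n.+1).
    by rewrite opprB [RHS]addrC addrA subrK.
  rewrite hnormB_sq.
  have E2 : x - 2^-1 *: (u n.+1 + u n) = 2^-1 *: ((x - u n) + (x - u n.+1)).
    rewrite addrACA -opprD scalerBr -[x + x]mulr2n -(scaler_nat 2 x) scalerA.
    rewrite mulVf ?scale1r//.
    by rewrite (addrC (u n)).
  move: hm; rewrite E2 hnormZ exprMn (hnormD_sq (x - u n)) normc_sq.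
  have -> : 2^-1 = (2^-1)%:C :> R[i] by rewrite fmorphV rmorph_nat.
  move: h1 h0; rewrite [2^-1 ^+ n.+1]exprS !exprMn /=.
  have : 0 <= (2^-1 ^+ n) ^+ 2 :> R by rewrite exprn_ge0.
  set q := (2^-1 ^+ n) ^+ 2; lra.
have us N : \sum_(n < N) hnorm (u n.+1 - u n) <= 4.
  apply: (@le_trans _ _ (4 - 4 * 2^-1 ^+ N)); last first.
    by rewrite gerBl mulr_ge0// exprn_ge0// invr_ge0.
  elim: N => [|N IH]; first by rewrite big_ord0 expr0; lra.
  by rewrite big_ord_recr exprS /=; have := u_step N; lra.
have [y uy] := cL2_complete us.
have Ey : cL2_orth E y by apply: cL2_orth_closed uy => n; exact: (uP n).1.
exists y; split => // z Ez.
have yD : hnorm (x - y) ^+ 2 <= D.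
  have c1 : hnorm (x - u n) @[n --> \oo] --> hnorm (x - y).
    apply: (@squeeze_cvgr _ _ _ _ (fun n => hnorm (x - y) - hnorm (u n - y))
                                 (fun n => hnorm (x - y) + hnorm (u n - y))).
    - apply: nearW => n.
      have := hnormD (x - u n) (u n - y); have := hnormD (x - y) (y - u n).
      rewrite !addrA !subrK (hnormBC y) => h1 h2.
      by apply/andP; split; lra.
    - by rewrite -[X in _ --> X]subr0; apply: cvgB => //; exact: cvg_cst.
    - by rewrite -[X in _ --> X]addr0; apply: cvgD => //; exact: cvg_cst.
  have c2 : D + (2^-1 ^+ n) ^+ 2 @[n --> \oo] --> D + 0 * 0.
    apply: cvgD; first exact: cvg_cst.
    under eq_fun do rewrite expr2.
    by apply: cvgM; apply: cvg_expr; rewrite ger0_norm ?invr_ge0// invf_lt1 ?ltr1n.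
  rewrite mul0r addr0 in c2.
  have c3 : hnorm (x - u n) ^+ 2 @[n --> \oo] --> hnorm (x - y) ^+ 2.
    by rewrite expr2; under eq_fun do rewrite expr2; exact: cvgM.
  rewrite -(cvg_lim _ c2)// -(cvg_lim _ c3)//; apply: ler_lim.
  - by apply/cvg_ex; eexists; exact: c3.
  - by apply/cvg_ex; eexists; exact: c2.
  - by apply: nearW => n; exact: (uP n).2.
have [z0|z0] := eqVneq (hnorm z) 0; first by rewrite (hnorm_eq0 z0) cL2_dot0r.
(* Moving [y] by the component of [x - y] along [z] would lower the squared distance by
   [|<x - y, z>|^2 / |z|^2], which minimality forbids unless the product vanishes. *)
have /SD := cL2_orthD Ey (cL2_orthZ (cL2_dot (x - y) z / (hnorm z ^+ 2)%:C) Ez).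
rewrite opprD addrA hnorm_sub_proj// => /(le_trans yD).
rewrite lerDl oppr_ge0 => h.
apply: Normc.eq0_normc; apply/eqP; rewrite -sqrf_eq0 eq_le sqr_ge0 andbT.
by move: h; rewrite pmulr_lle0// invr_gt0 exprn_gt0// lt_neqAle eq_sym z0 hnorm_ge0.
Qed.

Lemma cL2_orth_proj_uniq E x y y' :
  cL2_orth E y -> cL2_orth (cL2_orth E) (x - y) ->
  cL2_orth E y' -> cL2_orth (cL2_orth E) (x - y') -> y = y'.
Proof.
move=> Ey oy Ey' oy'; apply/eqP; rewrite -subr_eq0; apply/eqP.
have E1 : y - y' = (x - y') - (x - y).
  by rewrite opprB [RHS]addrC addrA subrK.
apply: hnorm_eq0; apply/eqP; rewrite -sqrf_eq0; apply/eqP.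
apply: (@complexI R); rewrite -cL2_dotxx {1}E1.
by apply: (cL2_orthB oy' oy); exact: cL2_orthB.
Qed.

Lemma cL2_projP E x : cL2_orth E (cL2_proj (cL2_orth E) x) /\
  cL2_orth (cL2_orth E) (x - cL2_proj (cL2_orth E) x).
Proof.
rewrite /cL2_proj; have [y Hy] := cL2_orth_proj_ex E x.
by case: xgetP => [z -> //|/(_ y)].
Qed.

Lemma cL2_proj_eq E x y : cL2_orth E y -> cL2_orth (cL2_orth E) (x - y) ->
  cL2_proj (cL2_orth E) x = y.
Proof.
by move=> Ey oy; have [h1 h2] := cL2_projP E x; exact: (cL2_orth_proj_uniq h1 h2).
Qed.

Lemma cL2_proj_linear E : linear (cL2_proj (cL2_orth E)).
Proof.
move=> a x y; have [x1 x2] := cL2_projP E x; have [y1 y2] := cL2_projP E y.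
apply: cL2_proj_eq; first by apply: cL2_orthD => //; exact: cL2_orthZ.
set px := cL2_proj _ x; set py := cL2_proj _ y.
have -> : a *: x + y - (a *: px + py) = a *: (x - px) + (y - py).
  by rewrite scalerBr opprD addrACA.
exact: cL2_orthD (cL2_orthZ a x2) y2.
Qed.

Lemma hnorm_cL2_proj E x : hnorm (cL2_proj (cL2_orth E) x) <= hnorm x.
Proof.
have [x1 x2] := cL2_projP E x; set p := cL2_proj _ x in x1 x2 *.
rewrite -(@ler_pXn2r _ 2%N) ?nnegrE ?hnorm_ge0//.
rewrite -[in leRHS](subrK p x) hnormD_sq x2// mulr0 addr0 lerDr; exact: sqr_ge0.
Qed.

End cL2_projection.

(** * Multiplication operators *)

Section cL2_multiplication.
Context d (T : measurableType d) (R : realType).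
Variable mu : {measure set T -> \bar R}.
Implicit Types (a b : T -> R[i]) (x y : cL2 mu).

Lemma ae_and (P Q : T -> Prop) : (\forall t \ae mu, P t) ->
  (\forall t \ae mu, Q t) -> \forall t \ae mu, P t /\ Q t.
Proof. by apply: filterS2 => t. Qed.

Definition bounded_symbol a :=
  cmeasurable a /\ exists M : R, forall t, normc (a t) <= M.

Lemma bounded_symbol_cst c : bounded_symbol (fun=> c).
Proof. by split; [exact: cmeasurable_cst|exists (normc c)]. Qed.

Lemma bounded_symbolM a b : bounded_symbol a -> bounded_symbol b ->
  bounded_symbol (fun t => a t * b t).
Proof.
move=> [ma [A aA]] [mb [B bB]]; split; first exact: cmeasurableM.
by exists (A * B) => t; rewrite normcZ ler_pM ?normc_ge0.
Qed.

Lemma bounded_symbolD a b : bounded_symbol a -> bounded_symbol b ->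
  bounded_symbol (fun t => a t + b t).
Proof.
move=> [ma [A aA]] [mb [B bB]]; split; first exact: cmeasurableD.
by exists (A + B) => t; rewrite (le_trans (le_normcD _ _))// lerD.
Qed.

Lemma bounded_symbol_conj a : bounded_symbol a ->
  bounded_symbol (fun t => (a t)^*%C).
Proof.
move=> [ma [A aA]]; split; first exact: cmeasurable_conj.
by exists A => t; rewrite normc_conjc.
Qed.

Lemma cL2_mul_ae a x : bounded_symbol a ->
  (cL2_mul a x : T -> R[i]) = (fun t => a t * x t) %[ae mu].
Proof. by move=> [ma [A aA]]; exact: cL2_mulE ma aA. Qed.

Lemma eq_cL2_mul a b x : a =1 b -> cL2_mul a x = cL2_mul b x.
Proof. by move=> /funext ->. Qed.

Lemma cL2_mul_linear a : bounded_symbol a -> linear (@cL2_mul _ _ _ mu a).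
Proof.
move=> ba c x y; apply/cL2P.
have H := ae_and (ae_and (cL2_mul_ae (c *: x + y) ba) (cL2_addE (c *: x) y))
  (ae_and (cL2_scaleE c x)
    (ae_and (ae_and (cL2_mul_ae x ba) (cL2_mul_ae y ba))
             (ae_and (cL2_scaleE c (cL2_mul a x))
               (cL2_addE (c *: cL2_mul a x) (cL2_mul a y))))).
apply: filterS H => t /=.
move=> [[/(_ I) h1 /(_ I) h2] [/(_ I) h3 [[/(_ I) h4 /(_ I) h5]]]].
move=> [/(_ I) h6 /(_ I) h7] _.
rewrite h1 [(_ *: _ + _ : cL2 mu) t]h2 [(_ *: _ : cL2 mu) t]h3.
by rewrite [RHS]h7 [(_ *: _ : cL2 mu) t]h6 h4 h5; ring.
Qed.

Lemma cL2_mulM a b x : bounded_symbol a -> bounded_symbol b ->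
  cL2_mul a (cL2_mul b x) = cL2_mul (fun t => a t * b t) x.
Proof.
move=> ba bb; apply/cL2P.
have H := ae_and (cL2_mul_ae (cL2_mul b x) ba)
  (ae_and (cL2_mul_ae x bb) (cL2_mul_ae x (bounded_symbolM ba bb))).
apply: filterS H => t /= [/(_ I) h1 [/(_ I) h2 /(_ I) h3]] _.
by rewrite h1 h2 h3 mulrA.
Qed.

Lemma cL2_mulDs a b x : bounded_symbol a -> bounded_symbol b ->
  cL2_mul (fun t => a t + b t) x = cL2_mul a x + cL2_mul b x.
Proof.
move=> ba bb; apply/cL2P.
have H := ae_and (ae_and (cL2_mul_ae x (bounded_symbolD ba bb)) (cL2_mul_ae x ba))
  (ae_and (cL2_mul_ae x bb) (cL2_addE (cL2_mul a x) (cL2_mul b x))).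
apply: filterS H => t /= [[/(_ I) h1 /(_ I) h2] [/(_ I) h3 /(_ I) h4]] _.
by rewrite h1 [RHS]h4 h2 h3 mulrDl.
Qed.

Lemma cL2_mul_cst c x : cL2_mul (fun=> c) x = c *: x.
Proof.
apply/cL2P.
have H := ae_and (cL2_mul_ae x (bounded_symbol_cst c)) (cL2_scaleE c x).
by apply: filterS H => t /= [/(_ I) h1 /(_ I) h2] _; rewrite h1 [RHS]h2.
Qed.

Lemma cL2_mul_dot a x y : bounded_symbol a ->
  cL2_dot (cL2_mul a x) y = cL2_dot x (cL2_mul (fun t => (a t)^*%C) y).
Proof.
move=> ba; apply: ae_eq_cintegral; try exact: cL2_dot_measurable.
have H := ae_and (cL2_mul_ae x ba) (cL2_mul_ae y (bounded_symbol_conj ba)).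
apply: filterS H => t /= [/(_ I) h1 /(_ I) h2] _.
by rewrite h1 h2 rmorphM /= conjcK; ring.
Qed.

Lemma hnorm_cL2_mul a (M : R) x : cmeasurable a -> (forall t, normc (a t) <= M) ->
  hnorm (cL2_mul a x) <= M * hnorm x.
Proof.
(* A point of [T] is what gives [0 <= M]; on an empty [T] the bound may be negative, but there all
   norms are 0. *)
move=> ma aM; have [t0|T0] := pselect (exists t : T, True).
  have M0 : 0 <= M by case: t0 => t _; exact: le_trans (normc_ge0 (a t)) (aM t).
  have -> : M = normc M%:C by rewrite normc_real ger0_norm.
  rewrite -hnormZ -(@ler_pXn2r _ 2%N) ?nnegrE ?hnorm_ge0// -lee_fin !hnorm_sqE.
  apply: ae_ge0_le_integral => //.
  - by move=> t _; rewrite lee_fin sqr_ge0.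
  - exact/measurable_normc_sq/cL2_meas.
  - by move=> t _; rewrite lee_fin sqr_ge0.
  - exact/measurable_normc_sq/cL2_meas.
  have ba : bounded_symbol a by split => //; exists M.
  have H := ae_and (cL2_mul_ae x ba) (cL2_scaleE M%:C x).
  apply: filterS H => t /= [/(_ I) h1 /(_ I) h2] _.
  rewrite h1 [(_ *: _ : cL2 mu) t]h2 lee_fin ler_pXn2r ?nnegrE ?normc_ge0//.
  by rewrite !normcZ ler_wpM2r ?normc_ge0// normc_real (le_trans (aM t))// ler_norm.
have z0 (z : cL2 mu) : hnorm z = 0.
  suff -> : z = 0 by exact: hnorm0.
  by apply/cL2P; apply: nearW => t; case: T0; exists t.
by rewrite !z0 mulr0.
Qed.

End cL2_multiplication.

(** * The unit circle *)

Section complex_continuity.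
Context (T : topologicalType) (R : realType).
Implicit Types f g : T -> R[i].

Lemma continuous_cst_c (c : R[i]) : continuous (fun _ : T => c).
Proof. by move=> z; exact: cvg_cst. Qed.

Lemma continuousM_c f g : continuous f -> continuous g ->
  continuous (fun z => f z * g z).
Proof. by move=> cf cg z; apply: cvgM; [exact: cf|exact: cg]. Qed.

Lemma continuousD_c f g : continuous f -> continuous g ->
  continuous (fun z => f z + g z).
Proof. by move=> cf cg z; apply: cvgD; [exact: cf|exact: cg]. Qed.

Lemma continuousV_c f : continuous f -> (forall z, f z != 0) ->
  continuous (fun z => (f z)^-1).
Proof. by move=> cf f0 z; apply: cvgV => //; exact: cf. Qed.

Lemma continuous_conj_c f : continuous f -> continuous (fun z => (f z)^*%C).
Proof.
move=> cf z; apply/cvgrPdist_le => e e0; have /cvgrPdist_le/(_ e e0) := cf z.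
by apply: filterS => w; rewrite -rmorphB normcJ.
Qed.

Lemma continuousX_c f (n : int) : continuous f -> (forall z, f z != 0) ->
  continuous (fun z => f z ^ n).
Proof.
move=> cf f0.
have cX m : continuous (fun z => f z ^+ m).
  elim: m => [|m IH]; first by under eq_fun do rewrite expr0; exact: continuous_cst_c.
  by under eq_fun do rewrite exprS; exact: continuousM_c.
case: n => n; first exact: cX.
by apply: (continuousV_c (cX n.+1)) => z; rewrite expf_neq0.
Qed.

Lemma continuous_le_normc (p : R[i] -> R) f : {morph p : a b / a - b} ->
  (forall z, `|p z| <= normc z) -> continuous f -> continuous (fun z => p (f z)).
Proof.
move=> pB pn cf z; apply/cvgrPdist_lt => e e0.
have /cvg_normcP/(_ _ e0) := cf z.
by apply: filterS => w; rewrite -pB; exact: le_lt_trans.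
Qed.

Lemma continuous_Re f : continuous f -> continuous (fun z => Re (f z)).
Proof. by apply: continuous_le_normc => [? ?|]; [rewrite raddfB|exact: Re_le_normc]. Qed.

Lemma continuous_Im f : continuous f -> continuous (fun z => Im (f z)).
Proof. by apply: continuous_le_normc => [? ?|]; [rewrite raddfB|exact: Im_le_normc]. Qed.

Lemma continuous_normc f : continuous f -> continuous (fun z => normc (f z)).
Proof.
move=> cf z; apply/cvgrPdist_lt => e e0; have /cvg_normcP/(_ _ e0) := cf z.
by apply: filterS => w; exact/le_lt_trans/ler_dist_normc.
Qed.

End complex_continuity.

Section circle_topology.
Variable R : realType.
Implicit Types z w : S1 R.

Lemma normc_S1 z : normc (S1_val z) = 1.
Proof.
by have := valP z; rewrite inE => /normc_eq1.
Qed.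

Lemma S1_val_neq0 z : S1_val z != 0.
Proof. by rewrite -normc_gt0 normc_S1. Qed.

Lemma S1_conj z : (S1_val z)^*%C = (S1_val z)^-1.
Proof.
apply: (mulfI (S1_val_neq0 z)).
by rewrite mulc_conjc normc_S1 expr1n divff// S1_val_neq0.
Qed.

Lemma S1_conjX z (n : int) : ((S1_val z) ^ n)^*%C = S1_val z ^ (- n).
Proof. by rewrite rmorphXz ?unitfE ?S1_val_neq0//= S1_conj -exprz_inv. Qed.

Lemma continuous_S1_val : continuous (@S1_val R).
Proof. exact: initial_continuous. Qed.

Lemma continuous_S1X (n : int) : continuous (fun z : S1 R => S1_val z ^ n).
Proof. by apply: continuousX_c; [exact: continuous_S1_val|exact: S1_val_neq0]. Qed.

Lemma S1_nbhs z (U : set (S1 R)) : nbhs z U <->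
  exists2 e : R, 0 < e & forall w, normc (S1_val z - S1_val w) < e -> U w.
Proof.
split.
  move=> [_ [[B oB <-] Bz BU]].
  have /nbhs_normc[e e0 eB] : nbhs (S1_val z) B by exact: open_nbhs_nbhs.
  by exists e => // w zw; apply/BU/eB.
move=> [e e0 eU]; have /cvg_normcP/(_ _ e0) := @continuous_S1_val z.
by apply: filterS => w; exact: eU.
Qed.

Lemma expi_surj z : exists2 t : R, t \in `[- pi, pi] & expi t = z.
Proof.
suff [t tpi h] : exists2 t : R, t \in `[- pi, pi] & S1_val z = cos t +i* sin t.
  by exists t =>//; apply: val_inj; rewrite /= -h.
have := normc_S1 z; case: (S1_val z) => x y /= h.
have xy : x ^+ 2 + y ^+ 2 = 1.
  by rewrite -(@sqr_sqrtr _ (x ^+ 2 + y ^+ 2)) ?addr_ge0 ?sqr_ge0// h expr1n.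
have x1 : -1 <= x <= 1 by have := sqr_ge0 y; apply: contraPT => /nandP; nra.
have ca : cos (acos x) = x by apply: acosK; rewrite in_itv.
have s2 : sin (acos x) ^+ 2 = y ^+ 2.
  by have := cos2Dsin2 (acos x); rewrite ca; lra.
have a0 := acos_ge0 x1; have api := acos_lepi x1.
have pi0 := pi_gt0 R.
have /eqP := s2; rewrite eqf_sqr => /orP[]/eqP ys.
  exists (acos x); first by rewrite in_itv /= api andbT; lra.
  by rewrite ca ys.
exists (- acos x); first by rewrite in_itv /=; lra.
by rewrite cosN sinN ca ys opprK.
Qed.

Lemma compact_S1 : compact [set: S1 R].
Proof.
have -> : [set: S1 R] = @expi R @` [set` `[(- pi : R), pi]].
  by apply/seteqP; split => // z _; have [t ? <-] := expi_surj z; exists t.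
apply: continuous_compact; last exact: segment_compact.
exact/continuous_subspaceT/continuous_expi.
Qed.

(** Compactness in its near-covering form: half of the radius found at a point serves all points
    within that half. *)
Lemma S1_uniform_continuity (f : S1 R -> R[i]) (e : R) : continuous f -> 0 < e ->
  exists2 r : R, 0 < r & forall z w, normc (S1_val z - S1_val w) < r ->
    normc (f z - f w) < e.
Proof.
move=> cf e0.
have /compact_near_coveringP K := compact_S1.
pose P (r : R) z := forall w, normc (S1_val z - S1_val w) < r -> normc (f z - f w) < e.
have H : \forall r \near 0^'+, [set: S1 R] `<=` P r.
  apply: K => z _.
  have e2 : 0 < e / 2 by rewrite divr_gt0.
  have /cvg_normcP/(_ _ e2)/S1_nbhs[r r0 rf] := cf z.
  have r2 : 0 < r / 2 by rewrite divr_gt0.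
  exists ([set w | normc (S1_val z - S1_val w) < r / 2], [set s | s < r / 2]).
    by split; [apply/S1_nbhs; exists (r / 2)|exact: nbhs_right_lt].
  move=> [w s] [/= zw sr] v wv.
  have h1 : normc (f z - f w) < e / 2.
    by apply: rf; lra.
  have h2 : normc (f z - f v) < e / 2.
    apply: rf; have := le_normcD (S1_val z - S1_val w) (S1_val w - S1_val v).
    rewrite addrA subrK; lra.
  have := le_normcD (f w - f z) (f z - f v).
  by rewrite addrA subrK (normcB (f w) (f z)); lra.
have [r [r0 rP]] : exists r : R, 0 < r /\ [set: S1 R] `<=` P r.
  near (0 : R)^'+ => r; exists r; split.
    by near: r; exact: nbhs_right_gt.
  by near: r.
by exists r => // z w; exact: rP.
Unshelve. all: by end_near. Qed.

Lemma S1_bounded (f : S1 R -> R[i]) : continuous f ->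
  exists2 M : R, 0 < M & forall z, normc (f z) <= M.
Proof.
move=> cf.
have cK : compact ((fun z => normc (f z)) @` [set: S1 R]).
  apply: continuous_compact compact_S1.
  exact/continuous_subspaceT/continuous_normc.
have [N [_ NP]] := compact_bounded cK.
exists (`|N| + 1) => [|z]; first by rewrite ltr_pwDr.
rewrite (le_trans (ler_norm _))//; apply: NP; last by exists z.
by rewrite (le_lt_trans (ler_norm N))// ltrDl.
Qed.

Lemma S1_continuous_measurable (f : S1 R -> R) : continuous f ->
  @measurable_fun _ _ (S1 R) (measurableTypeR R) [set: S1 R] f.
Proof.
move=> /continuousP cf; apply: (measurability _ (RGenOpens.measurableE R)).
move=> _ [_ [a [b ->] <-]]; rewrite setTI; apply: sub_sigma_algebra.
exact/cf/interval_open.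
Qed.

Lemma S1_bounded_symbol (f : S1 R -> R[i]) : continuous f -> bounded_symbol f.
Proof.
move=> cf; split; last by have [M _ fM] := S1_bounded cf; exists M.
by split; apply: S1_continuous_measurable; [exact: continuous_Re|exact: continuous_Im].
Qed.

End circle_topology.

(** * Fourier coefficients and the Hardy projection *)

Section fourier.
Variable R : realType.
Local Notation mu := (S1_measure R).
Implicit Types (f g : S1 R -> R[i]) (x y : L2 R) (n : int).

Lemma expiX (t : R) n : S1_val (expi t) ^ n = cos (n%:~R * t) +i* sin (n%:~R * t).
Proof.
have eX (m : nat) : (cos t +i* sin t) ^+ m = cos (m%:R * t) +i* sin (m%:R * t).
  elim: m => [|m IH]; first by rewrite expr0 mul0r cos0 sin0.
  rewrite exprSr IH -natr1 mulrDl mul1r cosD sinD; simpc.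
  by congr (_ +i* _); rewrite addrC.
case: n => m; first exact: eX.
rewrite NegzE -S1_conjX mulrNz mulNr cosN sinN.
by have -> : S1_val (expi t) ^ m.+1 = cos (m.+1%:R * t) +i* sin (m.+1%:R * t)
  by exact: eX.
Qed.

Lemma S1_mean0 (g : S1 R -> R) (F : R -> R) :
  continuous g -> (forall z, `|g z| <= 1) ->
  (forall t : R, is_derive t (1 : R) F (g (expi t))) -> F (2 * pi) = F 0 ->
  \int[mu]_z g z = 0.
Proof.
move=> cg g1 dF F0.
have mg := S1_continuous_measurable cg.
have ig : mu.-integrable setT (EFin \o g).
  apply: (@le_integrable _ _ _ _ _ _ _ (cst 1%E)) => //.
  - exact/measurable_EFinP.
  - by move=> z _ /=; rewrite lee_fin normr1.
  - exact: finite_measure_integrable_cst.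
have i1 : mu.-integrable setT (EFin \o (fun=> 1)).
  exact: finite_measure_integrable_cst.
have cgt : continuous (g \o @expi R).
  by move=> t; apply: continuous_comp; [exact: continuous_expi|exact: cg].
have pi2 := twopi_gt0 R.
(* Adding 1 makes the integrand nonnegative, as the transfer to the uniform law on [[0, 2 pi]]
   requires. *)
suff H : \int[mu]_z (1 + g z) = 1.
  move: H; rewrite RintegralD// Rintegral_cst// mul1r [X in fine X]probability_setT.
  by rewrite /=; lra.
rewrite /Rintegral ge0_integral_distribution; last 2 first.
- apply/measurable_EFinP; exact: measurable_funD.
- by move=> z; rewrite lee_fin; have := g1 z; rewrite ler_norml => /andP[]; lra.
rewrite integral_uniform; last 2 first.
- apply/measurable_EFinP; apply: measurable_funD => //.
  exact: continuous_measurable_fun.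
- by move=> t; rewrite lee_fin; have := g1 (expi t); rewrite ler_norml => /andP[]; lra.
rewrite (@continuous_FTC2 _ (fun t => 1 + g (expi t)) (fun t => t + F t))//.
- rewrite F0 subr0 -EFinB -EFinM /=.
  by rewrite (_ : _ - _ = 2 * pi) ?mulVf//; [rewrite gt_eqF|ring].
- apply: continuous_subspaceT => t; apply: cvgD; [exact: cvg_cst|exact: cgt].
- have dG (t : R) : derivable (fun t => t + F t) t 1 by apply: derivableD.
  have cG : continuous (fun t => t + F t).
    by move=> t; apply/differentiable_continuous; rewrite -derivable1_diffP.
  split; first by move=> t _.
  + by apply: cvg_at_right_filter; exact: cG.
  + by apply: cvg_at_left_filter; exact: cG.
- move=> t _; rewrite derive1E deriveD// derive_id.
  by rewrite [X in _ + X](@derive_val _ _ _ _ _ _ _ (dF t)).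
Qed.

Lemma is_derive_scaled (h : R -> R) (a t dh : R) : a != 0 ->
  is_derive (a * t) (1 : R) h dh -> is_derive t (1 : R) (fun u => h (a * u) / a) dh.
Proof.
move=> a0 dh1.
have da : is_derive t (1 : R) ( *%R a) a.
  by have := @is_deriveZ _ _ _ id a t 1 1 _; rewrite /GRing.scale /= mulr1; apply.
have dc := @is_derive1_comp _ h ( *%R a) t dh a dh1 da.
have := @is_deriveZ _ _ _ _ a^-1 _ _ _ dc; rewrite /GRing.scale /=.
rewrite mulrCA mulVf// mulr1 (_ : a^-1 \*: _ = fun u => h (a * u) / a)//.
by apply/funext => u; exact: mulrC.
Qed.

Lemma expi2pi : S1_val (expi (2 * pi : R)) = 1.
Proof.
have -> : S1_val (expi (2 * pi : R)) = cos (2 * pi) +i* sin (2 * pi) by [].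
by rewrite mulr_natl cos2pi sin2pi.
Qed.

Lemma cintegral_S1X n : cintegral mu (fun z => S1_val z ^ n) = (n == 0)%:R.
Proof.
have [->|n0] := eqVneq n 0.
  rewrite /cintegral; under eq_Rintegral do rewrite expr0z.
  under [X in _ +i* X]eq_Rintegral do rewrite expr0z.
  rewrite !Rintegral_cst// mul0r mul1r.
  by rewrite [X in fine X]probability_setT.
have nR : n%:~R != 0 :> R by rewrite intr_eq0.
have e1 (z : S1 R) : normc (S1_val z ^ n) = 1.
  have [t _ <-] := expi_surj z.
  by rewrite expiX /= cos2Dsin2 sqrtr1.
have cX := @continuous_S1X R n.
rewrite /cintegral.
have -> : \int[mu]_z Re (S1_val z ^ n) = 0.
  apply: (@S1_mean0 _ (fun t => sin (n%:~R * t) / n%:~R)).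
  - exact: continuous_Re.
  - by move=> z; rewrite (le_trans (Re_le_normc _))// e1.
  - by move=> t; rewrite expiX /=; apply: is_derive_scaled.
  - have := expiX (2 * pi) n; rewrite expi2pi exp1rz => /eqP; rewrite eq_complex /=.
    by move=> /andP[_ /eqP <-]; rewrite mulr0 sin0.
have -> : \int[mu]_z Im (S1_val z ^ n) = 0.
  apply: (@S1_mean0 _ (fun t => - cos (n%:~R * t) / n%:~R)).
  - exact: continuous_Im.
  - by move=> z; rewrite (le_trans (Im_le_normc _))// e1.
  - move=> t; rewrite expiX /= -[sin _]opprK.
    by apply: (@is_derive_scaled (fun u => - cos u)) => //; apply: is_deriveN.
  - have := expiX (2 * pi) n; rewrite expi2pi exp1rz => /eqP; rewrite eq_complex /=.
    by move=> /andP[/eqP <- _]; rewrite mulr0 cos0.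
by [].
Qed.

Lemma cst1_sqint : (fun _ : S1 R => 1 : R[i]) \in sqint mu.
Proof.
apply/sqintP; split; first exact: cmeasurable_cst.
have -> : normc \o (fun _ : S1 R => 1 : R[i]) = cst 1.
  by apply/funext => z; rewrite /= expr1n expr0n addr0 sqrtr1.
exact: (@Lfun_cst _ _ _ mu).
Qed.

Definition cL2_one : L2 R := cL2_pi (exist (fun f => f \in sqint mu) _ cst1_sqint).

Lemma cL2_one_ae : (cL2_one : S1 R -> R[i]) = (fun=> 1) %[ae mu].
Proof. exact: cL2_piE. Qed.

(** The class of [f], obtained by letting [f] act on the constant 1; products of functions then
    become compositions of multiplication operators. *)
Definition cL2_of (f : S1 R -> R[i]) : L2 R := cL2_mul f cL2_one.

Lemma cL2_of_ae f : continuous f -> (cL2_of f : S1 R -> R[i]) = f %[ae mu].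
Proof.
move=> /S1_bounded_symbol bf.
have H := ae_and (cL2_mul_ae cL2_one bf) cL2_one_ae.
by apply: filterS H => z /= [/(_ I) h1 /(_ I) h2] _; rewrite h1 h2 mulr1.
Qed.

Lemma cL2_mul_of f g : continuous f -> continuous g ->
  cL2_mul f (cL2_of g) = cL2_of (fun z => f z * g z).
Proof. by move=> cf cg; rewrite /cL2_of cL2_mulM//; exact: S1_bounded_symbol. Qed.

Lemma cL2_dot_of f g : continuous f -> continuous g ->
  cL2_dot (cL2_of f) (cL2_of g) = cintegral mu (fun z => f z * (g z)^*%C).
Proof.
move=> cf cg.
have cfg : continuous (fun z : S1 R => f z * (g z)^*%C).
  exact: (continuousM_c cf (continuous_conj_c cg)).
apply: ae_eq_cintegral; first exact: cL2_dot_measurable.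
  exact: (S1_bounded_symbol cfg).1.
have H := ae_and (cL2_of_ae cf) (cL2_of_ae cg).
by apply: filterS H => z /= [/(_ I) h1 /(_ I) h2] _; rewrite h1 h2.
Qed.

Definition mode n : L2 R := cL2_of (fun z => S1_val z ^ n).

Lemma fourier_coeff_dot x n : fourier_coeff x n = cL2_dot x (mode n).
Proof.
have cXN := @continuous_S1X R (- n).
apply: ae_eq_cintegral; last 1 first.
- apply: filterS (cL2_of_ae (@continuous_S1X R n)) => z /(_ I) -> _.
  by rewrite S1_conjX.
- apply: cmeasurableM; first exact: cL2_meas.
  exact: (S1_bounded_symbol cXN).1.
- exact: cL2_dot_measurable.
Qed.

Lemma dot_mode m n : cL2_dot (mode m) (mode n) = (m == n)%:R.
Proof.
rewrite cL2_dot_of; try exact: continuous_S1X.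
rewrite -(subr_eq0 m n) -cintegral_S1X; congr cintegral; apply/funext => z.
by rewrite S1_conjX expfzDr// S1_val_neq0.
Qed.

Lemma mul_mode m n : cL2_mul (fun z => S1_val z ^ m) (mode n) = mode (m + n).
Proof.
rewrite cL2_mul_of; try exact: continuous_S1X.
by apply: eq_cL2_mul => z; rewrite expfzDr// S1_val_neq0.
Qed.

Lemma dot_mul_mode m n x :
  cL2_dot (cL2_mul (fun z => S1_val z ^ m) x) (mode n) = cL2_dot x (mode (n - m)).
Proof.
rewrite cL2_mul_dot; last exact/S1_bounded_symbol/continuous_S1X.
congr cL2_dot; rewrite addrC -mul_mode; apply: eq_cL2_mul => z.
by rewrite S1_conjX.
Qed.

(** In this form H2 is a closed subspace for free, and the general results on [cL2_proj] apply to
    it. *)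
Lemma hardy2E : hardy2 (R := R) = cL2_orth (mode @` [set n | n < 0]).
Proof.
apply/seteqP; split => x hx.
  by move=> _ [n n0 <-]; rewrite -fourier_coeff_dot; exact: hx.
by move=> n n0; rewrite fourier_coeff_dot; apply: hx; exists n.
Qed.

Lemma hardy2P x : hardy2 x <-> forall n, n < 0 -> cL2_dot x (mode n) = 0.
Proof.
by split=> h n n0; [rewrite -fourier_coeff_dot|rewrite fourier_coeff_dot]; exact: h.
Qed.

Lemma hardy2_mode n : 0 <= n -> hardy2 (mode n).
Proof.
move=> n0; apply/hardy2P => m m0; rewrite dot_mode.
by rewrite [_ == _]gt_eqF// (lt_le_trans m0).
Qed.

Lemma hardy2_orth_mode n : n < 0 -> cL2_orth (@hardy2 R) (mode n).
Proof.
by move=> n0 x /hardy2P hx; rewrite cL2_dotC hx// rmorph0.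
Qed.

Lemma hardy_proj_in x : hardy2 (hardy_proj x).
Proof. by rewrite /hardy_proj hardy2E; exact: (cL2_projP _ _).1. Qed.

Lemma hardy_coproj_in x : cL2_orth (@hardy2 R) (hardy_coproj x).
Proof. by rewrite /hardy_coproj /hardy_proj hardy2E; exact: (cL2_projP _ _).2. Qed.

Lemma hardy_proj_eq x y : hardy2 y -> cL2_orth (@hardy2 R) (x - y) ->
  hardy_proj x = y.
Proof. by rewrite /hardy_proj hardy2E; exact: cL2_proj_eq. Qed.

Lemma hardy_proj_linear : linear (@hardy_proj R).
Proof. by rewrite /hardy_proj hardy2E; exact: cL2_proj_linear. Qed.

Lemma hnorm_hardy_proj x : hnorm (hardy_proj x) <= hnorm x.
Proof. by rewrite /hardy_proj hardy2E; exact: hnorm_cL2_proj. Qed.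

Lemma hardy_proj_split x y : hardy2 x -> cL2_orth (@hardy2 R) y ->
  hardy_proj (x + y) = x /\ hardy_coproj (x + y) = y.
Proof.
move=> hx hy; have -> : hardy_proj (x + y) = x.
  by apply: hardy_proj_eq => //; rewrite addrC addKr.
suff E : hardy_proj (x + y) = x by rewrite /hardy_coproj E addrC addKr.
by apply: hardy_proj_eq => //; rewrite addrC addKr.
Qed.

Lemma hardy_proj_coproj x : hardy_proj x + hardy_coproj x = x.
Proof. by rewrite /hardy_coproj addrC subrK. Qed.

End fourier.

(** * Bounded and invertible operators *)

Section cL2_operators.
Context d (T : measurableType d) (R : realType).
Variable mu : {measure set T -> \bar R}.
Local Notation V := (cL2 mu).
Implicit Types (A B : V -> V) (x y : V).

Lemma bounded_operatorP A : bounded_operator A <->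
  linear A /\ exists M : R, forall x, hnorm (A x) <= M * hnorm x.
Proof.
split=> -[lA [M AM]]; split => //; last first.
  by exists M%:C => x; rewrite !normr_hnorm -rmorphM lecR.
exists (Re M) => x; have := AM x; rewrite !normr_hnorm lecE => /andP[_].
by case: (M) => a b /=; rewrite mulr0 subr0.
Qed.

Lemma bounded_operator_ge0 A : bounded_operator A ->
  exists2 M : R, 0 < M & forall x, hnorm (A x) <= M * hnorm x.
Proof.
move=> /bounded_operatorP[_ [M AM]]; exists (`|M| + 1) => [|x].
  by rewrite ltr_pwDr.
rewrite (le_trans (AM x))// ler_wpM2r ?hnorm_ge0//.
by rewrite (le_trans (ler_norm _))// lerDl.
Qed.

Lemma bounded_operator_comp A B : bounded_operator A -> bounded_operator B ->
  bounded_operator (A \o B).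
Proof.
move=> bA bB; have [M M0 AM] := bounded_operator_ge0 bA.
have [N N0 BN] := bounded_operator_ge0 bB.
apply/bounded_operatorP; split; first by move=> a x y /=; rewrite bB.1 bA.1.
exists (M * N) => x /=; rewrite (le_trans (AM _))// -mulrA ler_wpM2l//.
exact: ltW.
Qed.

Lemma linear_sub A x y : linear A -> A (x - y) = A x - A y.
Proof.
by move=> lA; rewrite addrC -(scaleN1r y) lA scaleN1r addrC.
Qed.

Definition invertible_op A := bounded_operator A /\
  exists B, [/\ bounded_operator B, cancel A B & cancel B A].

Lemma invertible_comp A B : invertible_op A -> invertible_op B ->
  invertible_op (A \o B).
Proof.
move=> [bA [A' [bA' AK KA]]] [bB [B' [bB' BK KB]]].
split; first exact: bounded_operator_comp.
exists (B' \o A'); split; first exact: bounded_operator_comp.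
- by move=> x /=; rewrite AK BK.
- by move=> x /=; rewrite KB KA.
Qed.

Lemma invertible_inv A : invertible_op A ->
  exists B, [/\ invertible_op B, cancel A B & cancel B A].
Proof.
move=> [bA [B [bB AK KA]]]; exists B; split => //.
by split => //; exists A.
Qed.

Lemma invertible_bounded_below A : invertible_op A ->
  exists2 M : R, 0 < M & forall x, hnorm x <= M * hnorm (A x).
Proof.
move=> [_ [B [/bounded_operator_ge0[M M0 BM] AK _]]].
by exists M => // x; rewrite -{1}(AK x).
Qed.

(** The lower bound gives injectivity and also bounds the inverse by [c^-1], so no open mapping
    theorem is involved. *)
Lemma invertible_bij A (c : R) : bounded_operator A -> 0 < c ->
  (forall x, c * hnorm x <= hnorm (A x)) -> (forall y, exists x, A x = y) ->
  invertible_op A.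
Proof.
move=> bA c0 cA /choice[B AB]; have lA := bA.1.
have injA x y : A x = A y -> x = y.
  move=> xy; apply/eqP; rewrite -subr_eq0; apply/eqP/hnorm_eq0/eqP.
  have := cA (x - y); rewrite linear_sub// xy subrr hnorm0.
  by rewrite pmulr_rle0// eq_le hnorm_ge0 andbT.
split => //; exists B; split => //; last by move=> x; apply: injA; rewrite AB.
apply/bounded_operatorP; split.
  by move=> a x y; apply: injA; rewrite lA !AB.
by exists c^-1 => x; rewrite -[X in _ <= _ * hnorm X]AB mulrC ler_pdivlMr// mulrC.
Qed.

(** Surjectivity comes from the iteration [u (n+1) = y - A (u n)], whose increments decay like
    [q^n]; its limit solves [x + A x = y]. *)
Lemma neumann A (q : R) : linear A -> q < 1 ->
  (forall x, hnorm (A x) <= q * hnorm x) -> invertible_op (fun x => x + A x).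
Proof.
move=> lA q1 Aq.
(* A negative [q] forces [A] to vanish, and then 0 is an admissible bound as well. *)
wlog q0 : q q1 Aq / 0 <= q.
  move=> H; have [q0|q0] := leP 0 q; first exact: (H q).
  apply: (H 0) => // x; rewrite mul0r.
  by rewrite (le_trans (Aq x))// nmulr_rle0// hnorm_ge0.
have q1' : 0 < 1 - q by rewrite subr_gt0.
apply: (@invertible_bij _ (1 - q)) => //.
- apply/bounded_operatorP; split.
    by move=> a x y; rewrite lA scalerDr addrACA.
  exists (1 + q) => x; rewrite mulrDl mul1r (le_trans (hnormD _ _))// lerD2l.
  exact: Aq.
- move=> x; have := hnormB (x + A x) (A x); rewrite addrK => h.
  by have := Aq x; rewrite mulrBl mul1r; lra.
move=> y.
pose u := fix u n := if n is n'.+1 then y - A (u n') else 0 : V.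
have A0 : A 0 = 0 by have := linear_sub 0 0 lA; rewrite !subrr.
have us n : hnorm (u n.+1 - u n) <= q ^+ n * hnorm y.
  elim: n => [|n IH]; first by rewrite /= A0 !subr0 expr0 mul1r.
  rewrite [u n.+2]/(y - A (u n.+1)) {2}[u n.+1]/(y - A (u n)).
  have -> : y - A (u n.+1) - (y - A (u n)) = A (u n - u n.+1).
    by rewrite (linear_sub _ _ lA) opprB addrC addrA subrK.
  rewrite exprS -mulrA (le_trans (Aq _))// ler_wpM2l//.
  by rewrite hnormBC.
have sum_le N : \sum_(n < N) hnorm (u n.+1 - u n) <= hnorm y / (1 - q).
  rewrite ler_pdivlMr//.
  suff : (\sum_(n < N) hnorm (u n.+1 - u n)) * (1 - q) <= hnorm y * (1 - q ^+ N).
    move/le_trans; apply; rewrite ler_piMr ?hnorm_ge0// gerBl exprn_ge0//.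
  elim: N => [|N IH]; first by rewrite big_ord0 mul0r expr0 subrr mulr0.
  rewrite big_ord_recr /= mulrDl exprS.
  have : hnorm (u N.+1 - u N) * (1 - q) <= (q ^+ N * hnorm y) * (1 - q).
    by rewrite ler_pM2r.
  by move: IH; rewrite /=; lra.
have [x ux] := cL2_complete sum_le.
exists x; apply/eqP; rewrite -subr_eq0; apply/eqP/hnorm_eq0/eqP.
rewrite eq_le hnorm_ge0 andbT.
have H n : hnorm (x + A x - y) <= hnorm (u n.+1 - x) + q * hnorm (u n - x).
  have -> : x + A x - y = (x - u n.+1) + A (x - u n).
    rewrite (linear_sub _ _ lA) [u n.+1]/(y - A (u n)) opprB addrACA addrA.
    by rewrite addrA [RHS]addrAC addrK.
  by rewrite (le_trans (hnormD _ _))// hnormBC lerD2l [in leRHS]hnormBC.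
have c : hnorm (u n.+1 - x) + q * hnorm (u n - x) @[n --> \oo] --> 0 + q * 0.
  apply: cvgD; last by apply: cvgM => //; exact: cvg_cst.
  by move: ux; rewrite -(cvg_shiftS (fun n => hnorm (u n - x))).
rewrite mulr0 addr0 in c; rewrite -(cvg_lim _ c)//.
by apply: limr_ge; [apply/cvg_ex; eexists; exact: c|exact: nearW].
Qed.

End cL2_operators.

(** * Products of singular integral operators *)

Section csymbol.
Variable R : realType.
Implicit Types f g : S1 R -> R[i].

(* An inductive wrapper around continuity: the unifier never unfolds it. *)
Variant csymbol f : Prop := CSymbol of continuous f.

Lemma csymbol_cst c : csymbol (fun=> c).
Proof. by split; exact: continuous_cst_c. Qed.

Lemma csymbolM f g : csymbol f -> csymbol g -> csymbol (fun z => f z * g z).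
Proof. by move=> [cf] [cg]; split; exact: (continuousM_c cf cg). Qed.

Lemma csymbolD f g : csymbol f -> csymbol g -> csymbol (fun z => f z + g z).
Proof. by move=> [cf] [cg]; split; exact: (continuousD_c cf cg). Qed.

Lemma csymbolV f : csymbol f -> (forall z, f z != 0) -> csymbol (fun z => (f z)^-1).
Proof. by move=> [cf] f0; split; exact: (continuousV_c cf f0). Qed.

Lemma csymbol_conj f : csymbol f -> csymbol (fun z => (f z)^*%C).
Proof. by move=> [cf]; split; exact: (continuous_conj_c cf). Qed.

Lemma csymbol_S1X (n : int) : csymbol (fun z => S1_val z ^ n).
Proof. by split; exact: continuous_S1X. Qed.

Lemma csymbol_bounded f : csymbol f -> bounded_symbol f.
Proof. by move=> [cf]; exact: S1_bounded_symbol. Qed.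

Lemma csymbol_sup f : csymbol f ->
  exists2 M : R, 0 < M & forall z, normc (f z) <= M.
Proof. by move=> [cf]; exact: S1_bounded. Qed.

End csymbol.

Section singular_operators.
Variable R : realType.
Local Notation mu := (S1_measure R).
Local Notation sym := (S1 R -> R[i]).
Local Notation H2 := (@hardy2 R).
Implicit Types (f g h a b u : sym) (x y : L2 R).

Lemma mul_bounded_operator f : csymbol f ->
  bounded_operator (@cL2_mul _ _ _ mu f).
Proof.
move=> cf; have bf := csymbol_bounded cf; apply/bounded_operatorP; split.
  exact: cL2_mul_linear.
have [M _ fM] := csymbol_sup cf; exists M => x.
by apply: hnorm_cL2_mul => //; exact: bf.1.
Qed.

Lemma S1_mulM f g x : csymbol f -> csymbol g ->
  cL2_mul f (cL2_mul g x) = cL2_mul (fun z => f z * g z) x.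
Proof. by move=> cf cg; apply: cL2_mulM; exact: csymbol_bounded. Qed.

Lemma S1_mulD f x y : csymbol f -> cL2_mul f (x + y) = cL2_mul f x + cL2_mul f y.
Proof.
by move=> cf; have := (mul_bounded_operator cf).1 1 x y; rewrite !scale1r.
Qed.

Lemma S1_mulB f x y : csymbol f -> cL2_mul f (x - y) = cL2_mul f x - cL2_mul f y.
Proof. by move=> cf; apply/linear_sub/(mul_bounded_operator cf).1. Qed.

Lemma S1_mul0 f : csymbol f -> cL2_mul f 0 = 0 :> L2 R.
Proof. by move=> cf; have := S1_mulB 0 0 cf; rewrite !subrr. Qed.

Lemma mul1_op x : cL2_mul (fun _ : S1 R => 1) x = x.
Proof. by rewrite cL2_mul_cst scale1r. Qed.

Lemma hardy_coproj_linear : linear (@hardy_coproj R).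
Proof.
move=> c x y; rewrite /hardy_coproj hardy_proj_linear.
by rewrite scalerBr opprD addrACA.
Qed.

Lemma singular_bounded_operator a b : csymbol a -> csymbol b ->
  bounded_operator (singular_op a b).
Proof.
move=> ca cb; have ba := mul_bounded_operator ca; have bb := mul_bounded_operator cb.
apply/bounded_operatorP; split.
  move=> c x y; rewrite /singular_op hardy_proj_linear hardy_coproj_linear.
  by rewrite ba.1 bb.1 scalerDr addrACA.
have [A A0 aA] := bounded_operator_ge0 ba; have [B B0 bB] := bounded_operator_ge0 bb.
exists (A + B * 2) => x; rewrite mulrDl (le_trans (hnormD _ _))// lerD//.
  by rewrite (le_trans (aA _))// ler_wpM2l ?hnorm_hardy_proj// ltW.
rewrite (le_trans (bB _))// -mulrA ler_wpM2l//; first exact: ltW.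
have := hnormB x (hardy_proj x); have := hnorm_hardy_proj x.
by rewrite /hardy_coproj; lra.
Qed.

Lemma singular_opB_scale a b (c : R[i]) x : csymbol a -> csymbol b ->
  singular_op a b x - c *: x = singular_op (fun z => a z - c) (fun z => b z - c) x.
Proof.
move=> ca cb; rewrite /singular_op.
have bc := bounded_symbol_cst (S1 R) (- c).
rewrite (cL2_mulDs _ (csymbol_bounded ca) bc) (cL2_mulDs _ (csymbol_bounded cb) bc).
rewrite !cL2_mul_cst.
by rewrite addrACA -scalerDr hardy_proj_coproj scaleNr.
Qed.

Lemma mul_invertible f : csymbol f -> (forall z, f z != 0) ->
  invertible_op (@cL2_mul _ _ _ mu f).
Proof.
move=> cf f0; have cV := csymbolV cf f0.
split; first exact: mul_bounded_operator.
exists (@cL2_mul _ _ _ mu (fun z => (f z)^-1)); split.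
- exact: mul_bounded_operator.
- move=> x; rewrite S1_mulM// -[RHS]mul1_op; apply: eq_cL2_mul => z.
  by rewrite mulVf.
- move=> x; rewrite S1_mulM// -[RHS]mul1_op; apply: eq_cL2_mul => z.
  by rewrite mulfV.
Qed.

(** * Analytic and coanalytic symbols *)

(** Analyticity is stated as invariance of H2 under multiplication rather than through Fourier
    coefficients: this is exactly what the product formula consumes, and it is visibly stable under
    products. *)
Variant analytic_symbol h : Prop :=
  AnalyticSymbol of (forall x, H2 x -> H2 (cL2_mul h x)).

Variant coanalytic_symbol h : Prop :=
  CoanalyticSymbol of
    (forall x, cL2_orth H2 x -> cL2_orth H2 (cL2_mul h x)).

(** Multiplication by the conjugate is the adjoint, and the adjoint of an operator preserving H2
    preserves its complement. *)
Lemma analytic_coanalytic h : csymbol h ->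
  analytic_symbol (fun z => (h z)^*%C) -> coanalytic_symbol h.
Proof.
move=> ch [ah]; split => x ox y hy; rewrite cL2_mul_dot; last exact: csymbol_bounded.
by apply: ox; exact: ah.
Qed.

(** In [h P x + k Q x] the first term stays in H2 and the second in its complement, so [P] and [Q]
    simply recover them. *)
Lemma singular_op_comp a b h k x : csymbol a -> csymbol b ->
  csymbol h -> csymbol k -> analytic_symbol h -> coanalytic_symbol k ->
  singular_op a b (singular_op h k x) =
  singular_op (fun z => a z * h z) (fun z => b z * k z) x.
Proof.
move=> ca cb ch ck [ah] [ak]; rewrite {2}/singular_op /singular_op.
have [-> ->] := hardy_proj_split (ah _ (hardy_proj_in x)) (ak _ (hardy_coproj_in x)).
by rewrite !S1_mulM.
Qed.

Lemma mul_singular_op f a b x : csymbol f -> csymbol a -> csymbol b ->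
  cL2_mul f (singular_op a b x) =
  singular_op (fun z => f z * a z) (fun z => f z * b z) x.
Proof. by move=> cf ca cb; rewrite /singular_op S1_mulD// !S1_mulM. Qed.

Lemma eq_singular_op a a' b b' : a =1 a' -> b =1 b' ->
  singular_op a b =1 singular_op a' b'.
Proof. by move=> /funext -> /funext ->. Qed.

Lemma singular_op11 x : singular_op (fun=> 1) (fun=> 1) x = x.
Proof. by rewrite /singular_op !mul1_op hardy_proj_coproj. Qed.

Definition cst1 : sym := fun=> 1.

Lemma csymbol_cst1 : csymbol cst1.
Proof. exact: csymbol_cst. Qed.

Lemma coanalytic_cst1 : coanalytic_symbol cst1.
Proof. by split=> x ox; rewrite mul1_op. Qed.

(** [S_{u,1} = I + (u - 1) P], and [P] has norm at most 1. *)
Lemma singular_invertible_near1 u (q : R) : csymbol u -> q < 1 ->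
  (forall z, normc (u z - 1) <= q) -> invertible_op (singular_op u cst1).
Proof.
move=> cu q1 uq.
have cu1 : csymbol (fun z => u z - 1).
  by apply: csymbolD => //; exact: csymbol_cst.
have -> : singular_op u cst1 = (fun x => x + cL2_mul (fun z => u z - 1) (hardy_proj x)).
  apply/funext => x; rewrite /singular_op mul1_op.
  have := hardy_proj_coproj x.
  move: (hardy_proj x) (hardy_coproj x) => p q' <-.
  rewrite addrAC -{2}(mul1_op p) -(cL2_mulDs _ (bounded_symbol_cst _ 1) (csymbol_bounded cu1)).
  by congr (_ + _); apply: eq_cL2_mul => z; rewrite addrC subrK.
apply: (@neumann _ _ _ _ _ q) => //.
  by move=> c x y; rewrite hardy_proj_linear (mul_bounded_operator cu1).1.
move=> x; have [z0 _] : exists z : S1 R, True by exists (expi 0).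
have q0 : 0 <= q by exact: le_trans (normc_ge0 _) (uq z0).
have h := hnorm_cL2_mul (hardy_proj x) (csymbol_bounded cu1).1 uq.
by rewrite (le_trans h)// ler_wpM2l// hnorm_hardy_proj.
Qed.

Lemma analytic_S1X (n : int) : 0 <= n -> analytic_symbol (fun z => S1_val z ^ n).
Proof.
move=> n0; split => x /hardy2P hx; apply/hardy2P => m m0.
by rewrite dot_mul_mode hx//; lia.
Qed.

(** The constant 1 is orthogonal to the whole range: [z^n P x] has no coefficient of index 0 because
    [P x] has none of index [- n], and [Q x] is orthogonal to H2. *)
Lemma shift_not_surjective (n : int) : 0 < n ->
  ~ (forall y, exists x, singular_op (fun z => S1_val z ^ n) cst1 x = y).
Proof.
move=> n0 /(_ (mode R 0))[x xE].
have : cL2_dot (mode R 0) (mode R 0) = 0.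
  rewrite -{1}xE cL2_dotDl mul1_op dot_mul_mode.
  have /hardy2P -> := hardy_proj_in x; last by lia.
  by rewrite add0r hardy_coproj_in//; exact: hardy2_mode.
by rewrite dot_mode eqxx => /eqP; rewrite oner_eq0.
Qed.

Lemma shift_near1_invertible u (q : R) (n : int) : csymbol u -> q < 1 ->
  (forall z, normc (u z - 1) <= q) ->
  invertible_op (singular_op (fun z => u z * S1_val z ^ n) cst1) <-> n = 0.
Proof.
move=> cu q1 uq; have iu := singular_invertible_near1 cu q1 uq.
have cX m := @csymbol_S1X R m.
have cuX m := csymbolM cu (cX m).
have cc1 := csymbol_cst1.
split=> [[_ [B [_ BK KB]]]|->]; last first.
  by rewrite (_ : (fun z => _) = u)//; apply/funext => z; rewrite expr0z mulr1.
have [n0|n0|//] := ltgtP n 0.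
  have m0 : 0 < - n by rewrite oppr_gt0.
  have [_ [C [_ CK KC]]] := iu.
  case: (shift_not_surjective m0) => y.
  (* From [S_{u z^n,1} S_{z^-n,1} = S_{u,1}]: this is the preimage of [y] under the second factor,
     checked after applying the injective first one. *)
  exists (C (singular_op (fun z => u z * S1_val z ^ n) cst1 y)).
  apply: (can_inj BK); have an := analytic_S1X (ltW m0).
  rewrite (singular_op_comp _ (cuX n) cc1 (cX (- n)) cc1 an coanalytic_cst1).
  rewrite -[RHS]KC; apply: eq_singular_op => z; last by rewrite mulr1.
  by rewrite -mulrA -expfzDr ?S1_val_neq0// subrr expr0z mulr1.
case: (shift_not_surjective n0) => y.
have [_ [C [_ CK KC]]] := iu.
(* Here [S_{u,1} S_{z^n,1} = S_{u z^n,1}], so the inverse [B] of the right-hand side produces a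
   preimage under the shift. *)
exists (B (singular_op u cst1 y)); apply: (can_inj CK).
have an := analytic_S1X (ltW n0).
rewrite (singular_op_comp _ cu cc1 (cX n) cc1 an coanalytic_cst1).
rewrite -[RHS]KB; apply: eq_singular_op => z //.
by rewrite /cst1 mulr1.
Qed.

(** The units among the continuous analytic symbols. Coanalytic units are expressed by applying this
    to the conjugate, so that a single notion has to be studied. *)
Definition outer_symbol h := [/\ csymbol h, forall z, h z != 0,
  analytic_symbol h & analytic_symbol (fun z => (h z)^-1)].

Lemma outer_conj k : outer_symbol (fun z => (k z)^*%C) ->
  [/\ csymbol k, forall z, k z != 0, coanalytic_symbol k &
      coanalytic_symbol (fun z => (k z)^-1)].
Proof.
move=> [ck k0 ak akV].
have ck' : csymbol k.
  have := csymbol_conj ck; rewrite (_ : (fun z => _) = k)//.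
  by apply/funext => z; rewrite conjcK.
have k0' z : k z != 0 by rewrite -conjc_eq0.
split=> //; first exact: analytic_coanalytic.
apply: analytic_coanalytic; first exact: csymbolV.
by rewrite (_ : (fun z => _) = (fun z => ((k z)^*%C)^-1))//;
  apply/funext => z; rewrite fmorphV.
Qed.

(** The inverse is [S_{1/h,k}]; the product formula applies in both orders because [h], [1/h] are
    analytic and [k], [1/k] coanalytic. *)
Lemma outer_singular_invertible h k : outer_symbol h ->
  outer_symbol (fun z => (k z)^*%C) ->
  invertible_op (singular_op h (fun z => (k z)^-1)).
Proof.
move=> [ch h0 ah ahV] /outer_conj[ck k0 cok cokV].
have ckV := csymbolV ck k0; have chV := csymbolV ch h0.
split; first exact: singular_bounded_operator.
exists (singular_op (fun z => (h z)^-1) k); split.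
- exact: singular_bounded_operator.
- move=> x; rewrite singular_op_comp// -[RHS]singular_op11.
  by apply: eq_singular_op => z; rewrite ?mulVf ?mulfV.
- move=> x; rewrite singular_op_comp// -[RHS]singular_op11.
  by apply: eq_singular_op => z; rewrite ?mulVf ?mulfV.
Qed.

(** [S_{a,b} = (b k) S_{u z^n,1} S_{h,1/k}]: the second symbols multiply to [b k * 1 / k = b], the
    first ones to [a]. The outer two operators are invertible, so the middle one decides.
    Multiplying on the left is unrestricted, which is why [b] may be an arbitrary nonvanishing
    symbol. *)
Lemma factored_invertible a b u h k (n : int) (q : R) :
  csymbol b -> (forall z, b z != 0) -> csymbol u -> q < 1 ->
  (forall z, normc (u z - 1) <= q) -> outer_symbol h ->
  outer_symbol (fun z => (k z)^*%C) ->
  (forall z, a z = b z * (u z * S1_val z ^ n * h z * k z)) ->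
  invertible_op (singular_op a b) <-> n = 0.
Proof.
move=> cb b0 cu q1 uq oh ok /funext ->.
have ihk := outer_singular_invertible oh ok.
have [ch h0 ah ahV] := oh; have [ck k0 cok cokV] := outer_conj ok.
have ckV := csymbolV ck k0.
have cbk := csymbolM cb ck.
have bk0 z : b z * k z != 0 by rewrite mulf_neq0.
have ibk := mul_invertible cbk bk0.
have cuX := csymbolM cu (@csymbol_S1X R n).
set A := singular_op (fun z => u z * S1_val z ^ n) cst1.
set E := singular_op h (fun z => (k z)^-1) in ihk.
set D := cL2_mul _ in ibk.
have SE : singular_op (fun z => b z * (u z * S1_val z ^ n * h z * k z)) b =
    D \o (A \o E).
  apply/funext => x /=; rewrite /A /E singular_op_comp//; last exact: csymbol_cst1.
  rewrite /D mul_singular_op//; last 2 first.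
  - exact: (csymbolM cuX ch).
  - exact: (csymbolM csymbol_cst1 ckV).
  apply: eq_singular_op => z; first by ring.
  by rewrite /cst1 mul1r mulfK.
rewrite SE -(shift_near1_invertible n cu q1 uq) -/A; split=> iA; last first.
  exact: (invertible_comp ibk (invertible_comp iA ihk)).
have [D' [iD' DK KD]] := invertible_inv ibk.
have [E' [iE' EK KE]] := invertible_inv ihk.
have -> : A = D' \o ((D \o (A \o E)) \o E').
  by apply/funext => x /=; rewrite DK KE.
exact: (invertible_comp iD' (invertible_comp iA iE')).
Qed.

End singular_operators.

(** * Zeros of the symbols *)

Section nonvanishing.
Variable R : realType.
Local Notation mu := (S1_measure R).
Local Notation H2 := (@hardy2 R).
Variable z0 : S1 R.
Local Notation c0 := (S1_val z0).
Implicit Types (s : int) (m : nat).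

(* The square of the modulus of this function is m times the Fejer kernel at z0. *)
Definition fejer_poly s m : L2 R :=
  \sum_(j < m) c0 ^ (- (s + j%:Z)) *: mode R (s + j%:Z).

Lemma fejer_polyS s m : fejer_poly s m.+1 =
  fejer_poly s m + c0 ^ (- (s + m%:Z)) *: mode R (s + m%:Z).
Proof. by rewrite /fejer_poly big_ord_recr. Qed.

Lemma hnorm_mode (n : int) : hnorm (mode R n) = 1.
Proof.
apply/eqP; rewrite -(@pexpr_eq1 _ _ 2%N) ?hnorm_ge0//; apply/eqP.
by apply: (@complexI R); rewrite -cL2_dotxx dot_mode eqxx.
Qed.

Lemma normc_S1X (z : S1 R) (n : int) : normc (S1_val z ^ n) = 1.
Proof.
by have [t _ <-] := expi_surj z; rewrite expiX /= cos2Dsin2 sqrtr1.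
Qed.

Lemma fejer_poly_sqnorm s m : hnorm (fejer_poly s m) ^+ 2 = m%:R.
Proof.
elim: m => [|m IH]; first by rewrite /fejer_poly big_ord0 hnorm0 expr0n.
have d0 k : (k <= m)%N -> cL2_dot (fejer_poly s k) (mode R (s + m%:Z)) = 0.
  elim: k => [|k IHk] km; first by rewrite /fejer_poly big_ord0 cL2_dot0l.
  rewrite fejer_polyS cL2_dotDl IHk ?(ltnW km)// add0r cL2_dotZl dot_mode.
  by rewrite (_ : _ == _ = false) ?mulr0//; apply/negbTE; lia.
rewrite fejer_polyS hnormD_sq IH cL2_dotZr d0// mulr0 /= mulr0 addr0.
by rewrite hnormZ normc_S1X hnorm_mode mulr1 expr1n natr1.
Qed.

Lemma mul_sub_mode (n : int) :
  cL2_mul (fun z => S1_val z - c0) (mode R n) = mode R (n + 1) - c0 *: mode R n.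
Proof.
have c1 : csymbol (fun z : S1 R => S1_val z).
  by split; exact: continuous_S1_val.
rewrite (cL2_mulDs _ (csymbol_bounded c1) (bounded_symbol_cst _ _)).
rewrite cL2_mul_cst scaleNr; congr (_ - _).
by rewrite addrC -mul_mode; apply: eq_cL2_mul => z; rewrite expr1z.
Qed.

Lemma csymbol_sub : csymbol (fun z : S1 R => S1_val z - c0).
Proof.
by apply: csymbolD; [split; exact: continuous_S1_val|exact: csymbol_cst].
Qed.

(** The geometric sum telescopes, leaving two terms of norm 1. So [z - c0] maps the polynomial to
    norm at most 2, whereas the polynomial itself has norm [sqrt m]. *)
Lemma mul_sub_fejer_poly s m : cL2_mul (fun z => S1_val z - c0) (fejer_poly s m) =
  c0 *: (c0 ^ (- (s + m%:Z)) *: mode R (s + m%:Z) - c0 ^ (- s) *: mode R s).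
Proof.
elim: m => [|m IH].
  by rewrite /fejer_poly big_ord0 addr0 subrr scaler0 (S1_mul0 csymbol_sub).
have L := (mul_bounded_operator csymbol_sub).1.
rewrite fejer_polyS addrC L IH mul_sub_mode.
have e1 : (s + m.+1%:Z = s + m%:Z + 1)%R by lia.
have e2 : c0 * c0 ^ (- (s + m.+1%:Z)) = c0 ^ (- (s + m%:Z)).
  rewrite -{1}(expr1z c0) -expfzDr ?S1_val_neq0//; congr (_ ^ _); lia.
rewrite e1 in e2 *; rewrite !scalerBr !scalerA e2 addrA; congr (_ - _).
by rewrite [c0 * _]mulrC subrK.
Qed.

Lemma hnorm_mul_sub_fejer_poly s m :
  hnorm (cL2_mul (fun z => S1_val z - c0) (fejer_poly s m)) <= 2.
Proof.
rewrite mul_sub_fejer_poly hnormZ normc_S1 mul1r (le_trans (hnormB _ _))//.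
by rewrite !hnormZ !normc_S1X !hnorm_mode !mulr1.
Qed.

(** An algebraic substitute for localizing integrals near [z0]: with [D = |z - c0|^2 + eta], write
    [f = f * eta / D + f * |z - c0|^2 / D]. The second term is divisible by [z - c0], since
    [|z - c0|^2] is the product of [z - c0] and its conjugate. *)
Lemma vanishing_split (f : S1 R -> R[i]) (e : R) : csymbol f -> f z0 = 0 -> 0 < e ->
  exists f1 f2 : S1 R -> R[i], [/\ csymbol f1, csymbol f2,
    forall z, normc (f1 z) <= e &
    forall z, f z = f1 z + f2 z * (S1_val z - c0)].
Proof.
move=> cf f0 e0.
have [M M0 fM] := csymbol_sup cf.
have [cf'] := cf; have [r r0 rf] := S1_uniform_continuity cf' e0.
(* Within [r] of [z0], [|f| < e] and [eta / D <= 1]. Farther away,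
   [|f| * eta <= M * eta = e * r^2 <= e * D]. *)
pose eta := e * r ^+ 2 / M.
have eta0 : 0 < eta by rewrite divr_gt0// mulr_gt0// exprn_gt0.
pose D (z : S1 R) := (S1_val z - c0) * (S1_val z - c0)^*%C + eta%:C.
have DE z : D z = (normc (S1_val z - c0) ^+ 2 + eta)%:C.
  by rewrite /D mulc_conjc rmorphD.
have Dp z : 0 < normc (S1_val z - c0) ^+ 2 + eta by rewrite ltr_wpDl// sqr_ge0.
have D0 z : D z != 0 by rewrite DE; apply/eqP => -[] h; have := Dp z; rewrite h ltxx.
have cD : csymbol D.
  apply: csymbolD; last exact: csymbol_cst.
  exact: (csymbolM csymbol_sub (csymbol_conj csymbol_sub)).
have cDV := csymbolV cD D0.
exists (fun z => f z * (eta%:C * (D z)^-1)),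
  (fun z => f z * ((S1_val z - c0)^*%C * (D z)^-1)); split.
- exact: (csymbolM cf (csymbolM (csymbol_cst _) cDV)).
- exact: (csymbolM cf (csymbolM (csymbol_conj csymbol_sub) cDV)).
- move=> z; rewrite !normcZ normc_real DE -fmorphV normc_real.
  rewrite !gtr0_norm ?invr_gt0//.
  set t := normc (S1_val z - c0); have t0 : 0 <= t by exact: normc_ge0.
  rewrite mulrA ler_pdivrMr ?Dp//; have [tr|rt] := ltP t r.
    have := rf z z0 tr; rewrite f0 subr0 => fe.
    have n0 := normc_ge0 (f z).
    rewrite (@le_trans _ _ (e * eta))//; first by rewrite ler_wpM2r// ltW.
    by rewrite (ler_wpM2l (ltW e0))// lerDr sqr_ge0.
  rewrite (@le_trans _ _ (M * eta))//; first by rewrite ler_wpM2r// ltW.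
  rewrite /eta mulrC mulfVK ?gt_eqF// ler_wpM2l//; first exact: ltW.
  by rewrite (ler_wpDr (ltW eta0))// ler_pXn2r// nnegrE; exact: ltW.
- by move=> z; rewrite -[LHS]mulr1 -(divff (D0 z)) {1}/D; ring.
Qed.

(* Otherwise the operator would be bounded below on the Fejer polynomials
   concentrated at the zero of the symbol. *)
Lemma not_bounded_below (f : S1 R -> R[i]) (s : nat -> int) (M : R) :
  csymbol f -> f z0 = 0 -> 0 < M ->
  ~ (forall m, hnorm (fejer_poly (s m) m) <=
               M * hnorm (cL2_mul f (fejer_poly (s m) m))).
Proof.
move=> cf f0 M0 H.
(* With this tolerance the small part accounts for only half of the norm in the lower bound.
   Absorbing it leaves [4 * M * N], uniform in [m], against [sqrt m]. *)
have e0 : 0 < (2 * M)^-1 by rewrite invr_gt0 mulr_gt0.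
have [f1 [f2 [cf1 cf2 f1e fE]]] := vanishing_split cf f0 e0.
have [N N0 f2N] := csymbol_sup cf2.
have bd m : hnorm (fejer_poly (s m) m) <= 4 * M * N.
  set g := fejer_poly (s m) m.
  have h2 : hnorm (cL2_mul f g) <= (2 * M)^-1 * hnorm g + N * 2.
    have -> : f = (fun z => f1 z + f2 z * (S1_val z - c0)) by exact/funext.
    have cf3 := csymbolM cf2 csymbol_sub.
    rewrite (cL2_mulDs _ (csymbol_bounded cf1) (csymbol_bounded cf3)).
    rewrite (le_trans (hnormD _ _))// lerD//.
      by apply: hnorm_cL2_mul => //; exact: (csymbol_bounded cf1).1.
    rewrite -S1_mulM//; last exact: csymbol_sub.
    apply: le_trans (hnorm_cL2_mul _ (csymbol_bounded cf2).1 f2N) _.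
    by rewrite ler_wpM2l ?hnorm_mul_sub_fejer_poly// ltW.
  have h1 := H m; rewrite -/g in h1.
  have h3 : M * hnorm (cL2_mul f g) <= M * ((2 * M)^-1 * hnorm g + N * 2).
    by rewrite ler_wpM2l// ltW.
  have h4 : M * ((2 * M)^-1 * hnorm g + N * 2) = hnorm g / 2 + 2 * M * N.
    by field; rewrite gt_eqF.
  by lra.
pose B := 4 * M * N.
have [m mB] : exists m : nat, B ^+ 2 < m%:R.
  by exists (Num.bound (B ^+ 2)); rewrite archi_boundP// sqr_ge0.
have := bd m; apply/negP; rewrite -ltNge.
rewrite -(@ltr_pXn2r _ 2%N) ?nnegrE ?hnorm_ge0 ?fejer_poly_sqnorm//.
by rewrite !mulr_ge0// ltW.
Qed.

Lemma hardy2_fejer_poly m : H2 (fejer_poly 0 m).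
Proof.
elim: m => [|m IH].
  by rewrite /fejer_poly big_ord0 hardy2E; exact: cL2_orth0.
rewrite fejer_polyS; move: IH; rewrite hardy2E => IH; apply: cL2_orthD => //.
by apply: cL2_orthZ; rewrite -hardy2E; exact: hardy2_mode.
Qed.

Lemma hardy2_orth_fejer_poly m k : (k <= m)%N ->
  cL2_orth H2 (fejer_poly (- m%:Z) k).
Proof.
elim: k => [|k IH] km; first by rewrite /fejer_poly big_ord0; exact: cL2_orth0.
rewrite fejer_polyS; apply: cL2_orthD; first exact/IH/ltnW.
by apply/cL2_orthZ/hardy2_orth_mode; lia.
Qed.

Lemma invertible_nonvanishing (a b : S1 R -> R[i]) : csymbol a -> csymbol b ->
  invertible_op (singular_op a b) -> a z0 != 0 /\ b z0 != 0.
Proof.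
move=> ca cb /invertible_bounded_below[M M0 HM]; split; apply/eqP => v0.
- apply: (@not_bounded_below a (fun=> 0) M) => // m.
  have [e1 e2] := hardy_proj_split (hardy2_fejer_poly m)
    (@cL2_orth0 _ _ _ mu H2 : cL2_orth H2 0).
  have := HM (fejer_poly 0 m); rewrite /singular_op.
  rewrite addr0 in e1 e2; rewrite e1 e2.
  by rewrite S1_mul0// addr0.
(* The exponents run from [- m] to [- 1], so [P] annihilates the polynomial and only [b] acts. *)
- apply: (@not_bounded_below b (fun m => - m%:Z) M) => // m.
  have h0 : H2 0 by rewrite hardy2E; exact: cL2_orth0.
  have [e1 e2] := hardy_proj_split h0 (hardy2_orth_fejer_poly (leqnn m)).
  have := HM (fejer_poly (- m%:Z) m); rewrite /singular_op.
  rewrite add0r in e1 e2; rewrite e1 e2.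
  by rewrite S1_mul0// add0r.
Qed.

End nonvanishing.

(** * Primitives along paths *)

Section derivative_epsilon.
Variable K : numFieldType.
Implicit Types (f : K^o -> K^o) (x c : K^o).

(** The increment form involves no division and admits [h = 0]; it serves for [R] and [R[i]]
    alike. *)
Lemma is_derive_eps f x c : is_derive x (1 : K^o) f c <->
  forall e : K, 0 < e -> exists2 r : K, 0 < r &
    forall h, `|h| < r -> `|f (x + h) - f x - c * h| <= e * `|h|.
Proof.
split=> [[df dfc] e e0|H].
  have : (fun h => h^-1 *: ((f \o shift x) (h *: (1 : K^o)) - f x)) @ 0^' --> c.
    by rewrite -dfc; exact: df.
  move=> /cvgrPdist_le/(_ e e0); rewrite near_withinE => /nbhs_ballP[r r0 rP].
  exists r => // h hr; have [->|h0] := eqVneq h 0.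
    by rewrite addr0 subrr mulr0 subrr normr0 mulr0.
  have := rP h; rewrite /ball /= sub0r normrN => /(_ hr h0).
  rewrite /GRing.scale /= mulr1 (addrC h) distrC => hle.
  have -> : f (x + h) - f x - c * h = h * (h^-1 * (f (x + h) - f x) - c).
    by rewrite mulrBr mulrA mulfV// mul1r (mulrC h c).
  by rewrite normrM mulrC ler_wpM2r.
have C : (fun h => h^-1 *: ((f \o shift x) (h *: (1 : K^o)) - f x)) @ 0^' --> c.
  apply/cvgrPdist_le => e e0; have [r r0 rP] := H e e0.
  rewrite near_withinE; apply/nbhs_ballP; exists r => // h.
  rewrite /ball /= sub0r normrN => hr h0.
  have := rP h hr; rewrite /GRing.scale /= mulr1 (addrC h).
  have -> : f (x + h) - f x - c * h = h * (h^-1 * (f (x + h) - f x) - c).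
    by rewrite mulrBr mulrA mulfV// mul1r (mulrC h c).
  by rewrite normrM mulrC distrC ler_pM2r// normr_gt0.
by split; [apply/cvg_ex; exists c; exact: C|exact: cvg_lim C].
Qed.

End derivative_epsilon.

Lemma is_derive_normc (R : realType) (f : R[i] -> R[i]) (z c : R[i]) :
  is_derive z (1 : R[i]) f c <->
  forall e : R, 0 < e -> exists2 r : R, 0 < r &
    forall h, normc h < r -> normc (f (z + h) - f z - c * h) <= e * normc h.
Proof.
split=> [/(@is_derive_eps R[i]) H e e0|H].
  have eC : 0 < e%:C by rewrite ltcR.
  have [_ /complex_gt0[r r0 ->] rP] := H _ eC; exists r => // h hr.
  by have := rP h; rewrite !normC_normc -rmorphM ltcR lecR; exact.
apply/(@is_derive_eps R[i]) => _ /complex_gt0[e e0 ->].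
have [r r0 rP] := H e e0; exists r%:C => [|h]; first by rewrite ltcR.
by rewrite !normC_normc -rmorphM ltcR lecR; exact: rP.
Qed.

Section flat_paths.
Variable R : realType.

Lemma flat_on_segment (D : R -> R[i]) (a b : R) : a <= b ->
  (forall t, a <= t <= b -> forall e : R, 0 < e -> exists2 r : R, 0 < r &
    forall s, a <= s <= b -> `|s - t| < r -> normc (D s - D t) <= e * `|s - t|) ->
  D a = D b.
Proof.
move=> ab H.
(* Clamping to [[a, b]] is 1-Lipschitz and fixes the end points. It extends [D] to the whole line
   with derivative 0 everywhere, where the constancy criterion for real functions applies to each
   coordinate. *)
pose c (t : R) := Num.max a (Num.min b t).
have cab t : a <= c t <= b.
  by rewrite /c le_max lexx /= ge_max ab ge_min lexx.
have cc t s : `|c s - c t| <= `|s - t|.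
  rewrite ler_norml; have := ler_norm (s - t); have := ler_norm (t - s).
  rewrite (distrC t) /c.
  case: (leP b t) => ?; case: (leP b s) => ?; case: (leP a b) => ?;
  case: (leP a t) => ?; case: (leP a s) => ? ? ?; lra.
have key (p : R[i] -> R) : {morph p : x y / x - y} ->
    (forall z, `|p z| <= normc z) -> p (D a) = p (D b).
  move=> pB pn.
  have d0 x : is_derive x (1 : R) (fun t => p (D (c t))) 0.
    apply/(@is_derive_eps R) => e e0; have [r r0 rP] := H _ (cab x) e e0.
    exists r => // h hr; rewrite mul0r subr0 -pB (le_trans (pn _))//.
    have hx : `|c (x + h) - c x| <= `|h| by rewrite (le_trans (cc _ _))// addrC addKr.
    rewrite (le_trans (rP _ (cab _) _))//; first exact: le_lt_trans hr.
    by rewrite ler_pM2l.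
  have := is_derive_0_is_cst a b d0.
  by rewrite /c (min_r ab) maxxx minxx (max_r ab).
apply/eqP; rewrite eq_complex; apply/andP; split; apply/eqP; apply: key.
- by move=> ? ?; rewrite raddfB.
- exact: Re_le_normc.
- by move=> ? ?; rewrite raddfB.
- exact: Im_le_normc.
Qed.

(* The difference of two local primitives has zero complex derivative on a disc,
   hence is flat along its radii. *)
Lemma primitive_along_unique (f : R[i] -> R[i]) (gamma : R -> R[i]) (a b : R)
    (F1 F2 : R -> R[i]) : a <= b -> continuous gamma ->
  primitive_along f gamma a b F1 -> primitive_along f gamma a b F2 ->
  F1 b - F1 a = F2 b - F2 a.
Proof.
move=> ab cg P1 P2.
suff : F1 a - F2 a = F1 b - F2 b.
  by move/eqP; rewrite subr_eq addrAC eq_sym subr_eq => /eqP h;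
    rewrite -[F1 b](addrK (F2 a)) h; ring.
apply: (flat_on_segment (D := fun t => F1 t - F2 t) ab) => t tab e e0.
have tab' : t \in `[a, b] by rewrite in_itv.
have [U1 [G1 [oU1 dG1 nF1]]] := P1 t tab'; have [U2 [G2 [oU2 dG2 nF2]]] := P2 t tab'.
have [r1 r10 r1P] : exists2 r : R, 0 < r & forall s, a <= s <= b -> `|s - t| < r ->
    [/\ U1 (gamma s), U2 (gamma s), F1 s = G1 (gamma s) & F2 s = G2 (gamma s)].
  have n12 : \forall s \near nbhs t, s \in `[a, b] ->
      (U1 (gamma s) /\ F1 s = G1 (gamma s)) /\ (U2 (gamma s) /\ F2 s = G2 (gamma s)).
    move: nF1 nF2; rewrite !near_withinE; apply: filterS2 => s h1 h2 sab.
    by split; [exact: h1|exact: h2].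
  move: n12 => /nbhs_ballP[r r0 rP].
  exists r => // s sab st; have := rP s; rewrite /ball /= distrC => /(_ st).
  by case; [rewrite in_itv|move=> [? ?] [? ?]].
have [U1t U2t F1t F2t] := r1P t tab (ltac:(by rewrite subrr normr0)).
have [r2 r20 r2P] : exists2 r : R, 0 < r &
    forall w, normc (w - gamma t) < r -> U1 w /\ U2 w.
  have /nbhs_normc[r r0 rP] : nbhs (gamma t) (U1 `&` U2).
    by apply: open_nbhs_nbhs; split; [exact: openI|].
  by exists r => // w wr; apply: rP; rewrite normcB.
have [r3 r30 r3P] : exists2 r : R, 0 < r &
    forall s, `|s - t| < r -> normc (gamma s - gamma t) < r2.
  have /cvg_normcP/(_ _ r20)/nbhs_ballP[r r0 rP] := cg t.
  exists r => // s st; have := rP s; rewrite /ball /= distrC => /(_ st).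
  by rewrite normcB.
exists (Num.min r1 r3) => [|s sab]; first by rewrite lt_min r10.
rewrite lt_min => /andP[s1 s3].
have [_ _ F1s F2s] := r1P s sab s1; have := r3P s s3.
rewrite F1s F2s F1t F2t; move: (gamma s) => w wt.
(* The two local primitives differ by a constant on the disc, so the increment is not merely small
   but zero. *)
suff -> : G1 w - G2 w = G1 (gamma t) - G2 (gamma t).
  by rewrite subrr Normc.normc0 mulr_ge0// ltW.
pose v := w - gamma t.
pose seg (x : R) := gamma t + x%:C * v.
have seg0 : seg 0 = gamma t by rewrite /seg mul0r addr0.
have seg1 : seg 1 = w by rewrite /seg mul1r addrC subrK.
rewrite -seg0 -seg1.
apply/esym; apply: (@flat_on_segment (fun x => G1 (seg x) - G2 (seg x)) 0 1) => //.
move=> x /andP[x0 x1] e' e'0.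
have [/dG1 d1 /dG2 d2] : U1 (seg x) /\ U2 (seg x).
  apply: r2P; rewrite /seg addrC addKr normcZ normc_real ger0_norm//.
  by rewrite (le_lt_trans _ wt)// ler_piMl// normc_ge0.
have [v0|v0] := eqVneq v 0.
  exists 1 => // y _ _; rewrite /seg v0 !mulr0 subrr Normc.normc0 mulr_ge0//.
  exact: ltW.
have nv : 0 < normc v by rewrite normc_gt0.
(* Each primitive may use half of [e']; [normc v] converts the parameter of the radius into a
   distance. *)
have e2 : 0 < e' / (2 * normc v) by rewrite divr_gt0// mulr_gt0.
have /is_derive_normc/(_ _ e2)[q1 q10 q1P] := d1.
have /is_derive_normc/(_ _ e2)[q2 q20 q2P] := d2.
exists (Num.min q1 q2 / normc v).
  by rewrite divr_gt0// lt_min q10.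
move=> y _; rewrite ltr_pdivlMr// lt_min => /andP[y1 y2].
have segy : seg y = seg x + (y - x)%:C * v.
  by rewrite /seg (rmorphB (real_complex R)) /=; ring.
have nh : normc ((y - x)%:C * v) = `|y - x| * normc v by rewrite normcZ normc_real.
have := q1P ((y - x)%:C * v); rewrite nh => /(_ y1).
have := q2P ((y - x)%:C * v); rewrite nh => /(_ y2).
rewrite -segy => h2 h1.
have eE : e' / (2 * normc v) * (`|y - x| * normc v) = e' / 2 * `|y - x|.
  by field; rewrite gt_eqF.
rewrite eE in h1 h2.
have := le_normcD (G1 (seg y) - G1 (seg x) - f (seg x) * ((y - x)%:C * v))
   (- (G2 (seg y) - G2 (seg x) - f (seg x) * ((y - x)%:C * v))).
rewrite normcN; set X := normc (_ + _).
have -> : X = normc (G1 (seg y) - G2 (seg y) - (G1 (seg x) - G2 (seg x))).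
  by rewrite /X; congr normc; ring.
by move=> h; rewrite (le_trans h)//; lra.
Qed.

End flat_paths.

(** * Complex exponential and logarithm *)

Section complex_exponential.
Variable R : realType.
Implicit Types z w v : R[i].

Definition cexp z : R[i] := (expR (Re z) * cos (Im z)) +i* (expR (Re z) * sin (Im z)).

(** The principal logarithm, but only on the right half-plane, where [atan (Im z / Re z)] is the
    argument. Every use is arranged to stay there. *)
Definition clog z : R[i] := ln (normc z) +i* atan (Im z / Re z).

Lemma cexpD z w : cexp (z + w) = cexp z * cexp w.
Proof.
rewrite /cexp !raddfD /= expRD cosD sinD; simpc.
by congr (_ +i* _); ring.
Qed.

Lemma cexp0 : cexp 0 = 1.
Proof. by rewrite /cexp /= expR0 cos0 sin0 mulr1 mulr0. Qed.

Lemma cexp_neq0 z : cexp z != 0.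
Proof.
have : cexp z * cexp (- z) = 1 by rewrite -cexpD subrr cexp0.
by move=> h; apply/eqP => h0; move: h; rewrite h0 mul0r => /eqP; rewrite eq_sym oner_eq0.
Qed.

Lemma cexpN z : cexp (- z) = (cexp z)^-1.
Proof.
apply: (mulfI (cexp_neq0 z)).
by rewrite -cexpD subrr cexp0 mulfV// cexp_neq0.
Qed.

Lemma cexpB z w : cexp (z - w) = cexp z / cexp w.
Proof. by rewrite cexpD cexpN. Qed.

Lemma cexp_eq1 z : `|Im z| < pi -> cexp z = 1 -> z = 0.
Proof.
case: z => x y /= yp [] h1 h2.
have ex := expR_gt0 x.
have s0 : sin y = 0 by apply: (mulfI (lt0r_neq0 ex)); rewrite mulr0.
have y0 : y = 0.
  have [yn|yp'|//] := ltgtP y 0.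
    have : 0 < sin (- y) by apply: sin_gt0_pi; rewrite oppr_gt0 yn /=; rewrite ltr0_norm in yp.
    by rewrite sinN s0 oppr0 ltxx.
  have : 0 < sin y by apply: sin_gt0_pi; rewrite yp' /=; rewrite gtr0_norm in yp.
  by rewrite s0 ltxx.
by rewrite y0 cos0 mulr1 in h1 *; rewrite -(expRK x) h1 ln1.
Qed.

Lemma clogK z : 0 < Re z -> cexp (clog z) = z.
Proof.
case: z => x y /= x0; rewrite /cexp /=.
have n0 : 0 < x ^+ 2 + y ^+ 2 by rewrite ltr_pwDl ?exprn_gt0 ?sqr_ge0.
rewrite lnK ?posrE ?sqrtr_gt0//.
have xn0 : x != 0 by rewrite gt_eqF.
have q0 : 0 < 1 + (y / x) ^+ 2 by rewrite ltr_wpDr ?sqr_ge0.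
have ca := cos_atan (y / x).
have nE : Num.sqrt (x ^+ 2 + y ^+ 2) = x * Num.sqrt (1 + (y / x) ^+ 2).
  rewrite -{2}(ger0_norm (ltW x0)) -sqrtr_sqr -sqrtrM ?sqr_ge0//.
  by congr Num.sqrt; field.
have sq0 : Num.sqrt (1 + (y / x) ^+ 2) != 0 by rewrite gt_eqF// sqrtr_gt0.
have c0 : cos (atan (y / x)) != 0 by rewrite ca invr_eq0.
have sa : sin (atan (y / x)) = (y / x) * cos (atan (y / x)).
  by have := atanK (y / x); rewrite /tan => {2}<-; rewrite mulfVK.
by rewrite sa ca nE; congr (_ +i* _); field; rewrite ?sq0 ?xn0.
Qed.

Lemma Im_clog z : `|Im (clog z)| < pi / 2.
Proof. by rewrite /clog /= ltr_norml atan_gtNpi2 atan_ltpi2. Qed.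

Lemma cexp_inj_clog z w : `|Im z| < pi / 2 -> 0 < Re w -> cexp z = w -> z = clog w.
Proof.
move=> zp w0 zw; apply/eqP; rewrite -subr_eq0; apply/eqP/cexp_eq1.
  rewrite raddfB /=; have := ler_normB (Im z) (Im (clog w)).
  by have := Im_clog w; rewrite /clog /=; lra.
by rewrite cexpB clogK// zw divff// -zw cexp_neq0.
Qed.

Lemma clog1 : clog 1 = 0.
Proof.
by rewrite /clog /= expr1n expr0n addr0 sqrtr1 ln1 mul0r atan0.
Qed.

Lemma cvg_complexP (T : Type) (F : set_system T) (FF : Filter F) (f : T -> R[i]) z :
  f x @[x --> F] --> z <->
  (Re (f x) @[x --> F] --> Re z) /\ (Im (f x) @[x --> F] --> Im z).
Proof.
split=> [/cvg_normcP fz|[/cvgrPdist_lt fr /cvgrPdist_lt fi]].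
  split; apply/cvgrPdist_lt => e e0; apply: filterS (fz e e0) => x;
    apply: le_lt_trans; rewrite -raddfB; [exact: Re_le_normc|exact: Im_le_normc].
apply/cvg_normcP => e e0; have e2 : 0 < e / 2 by rewrite divr_gt0.
apply: filterS2 (fr _ e2) (fi _ e2) => x h1 h2.
by rewrite (le_lt_trans (normc_le_ReIm _))// !raddfB /=; lra.
Qed.

Lemma cvg_normc (T : Type) (F : set_system T) (FF : Filter F) (f : T -> R[i]) z :
  f x @[x --> F] --> z -> normc (f x) @[x --> F] --> normc z.
Proof.
move=> /cvg_normcP fz; apply/cvgrPdist_lt => e e0.
by apply: filterS (fz e e0) => x; exact/le_lt_trans/ler_dist_normc.
Qed.

Lemma cvg_clog (T : Type) (F : set_system T) (FF : Filter F) (f : T -> R[i]) w :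
  0 < Re w -> f x @[x --> F] --> w -> clog (f x) @[x --> F] --> clog w.
Proof.
move=> w0 fw; have [cr ci] := (cvg_complexP FF f w).1 fw.
have n0 : 0 < normc w by rewrite (lt_le_trans w0)// (le_trans (ler_norm _))// Re_le_normc.
apply/cvg_complexP; split.
  exact: (continuous_cvg _ (continuous_ln n0) (cvg_normc FF fw)).
apply: (continuous_cvg _ (@continuous_atan R (Im w / Re w))).
by apply: cvgM => //; apply: cvgV => //; rewrite gt_eqF.
Qed.

Lemma cvg_cexp (T : Type) (F : set_system T) (FF : Filter F) (f : T -> R[i]) w :
  f x @[x --> F] --> w -> cexp (f x) @[x --> F] --> cexp w.
Proof.
move=> fw; have [cr ci] := (cvg_complexP FF f w).1 fw.
have ce : expR (Re (f x)) @[x --> F] --> expR (Re w).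
  exact: continuous_cvg (@continuous_expR R (Re w)) cr.
have cc : cos (Im (f x)) @[x --> F] --> cos (Im w).
  exact: continuous_cvg (@continuous_cos R (Im w)) ci.
have cs : sin (Im (f x)) @[x --> F] --> sin (Im w).
  exact: continuous_cvg (@continuous_sin R (Im w)) ci.
by apply/cvg_complexP; split; exact: cvgM.
Qed.

Lemma cexp_near0 (e : R) : 0 < e -> exists2 r : R, 0 < r &
  forall v, normc v < r -> normc (cexp v - 1 - v) <= e * normc v.
Proof.
(* Each coordinate of the error is bounded by [3 * q * n], and [6 * q <= e]. *)
move=> e0; pose q : R := Num.min (e / 8) 1.
have q0 : 0 < q by rewrite lt_min ltr01 andbT divr_gt0.
have [qe q1] : q <= e / 8 /\ q <= 1 by split; rewrite ge_min lexx ?orbT.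
have /(@is_derive_eps R)/(_ _ q0)[r1 r10 h1] := is_derive_expR (0 : R).
have /(@is_derive_eps R)/(_ _ q0)[r2 r20 h2] := is_derive_cos (0 : R).
have /(@is_derive_eps R)/(_ _ q0)[r3 r30 h3] := is_derive_sin (0 : R).
(* [q / 2] absorbs the quadratic term [|E - 1| * |y| <= 2 * n^2]; [1 / 16] keeps [E <= 2]. *)
pose r := Num.min (Num.min r1 r2) (Num.min r3 (Num.min (q / 2) (1 / 16))).
exists r; first by rewrite !lt_min r10 r20 r30 !divr_gt0.
case=> x y; set n := normc _; rewrite !lt_min.
move=> /andP[/andP[n1 n2] /andP[n3 /andP[n4 n5]]].
have xn : `|x| <= n := Re_le_normc (x +i* y).
have yn : `|y| <= n := Im_le_normc (x +i* y).
have := h1 x (le_lt_trans xn n1); have := h2 y (le_lt_trans yn n2).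
have := h3 y (le_lt_trans yn n3).
rewrite expR0 cos0 sin0 !(add0r, oppr0, mul1r, mul0r, addr0) => hs hc he.
apply: le_trans (normc_le_ReIm _) _; rewrite /cexp /=.
have E0 := expR_gt0 x.
set E := expR x in he E0 *; set C := cos y in hc *; set S := sin y in hs *.
have n0 : 0 <= n by exact: normc_ge0.
have qn : q * n <= n by rewrite ler_piMl.
have {}he : `|E - 1 - x| <= q * n by rewrite (le_trans he)// ler_wpM2l// ltW.
have {}hc : `|C - 1| <= q * n by rewrite (le_trans hc)// ler_wpM2l// ltW.
have {}hs : `|S - y| <= q * n.
  by rewrite (le_trans hs)// ler_wpM2l// ltW.
have hE1 : `|E - 1| <= 2 * n.
  by rewrite -(subrK x (E - 1)) (le_trans (ler_normD _ _))//; lra.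
have E2 : E <= 2 by have := ler_norm (E - 1); lra.
have hre : `|E * C - 1 - x| <= 3 * (q * n).
  have -> : E * C - 1 - x = (E - 1 - x) + E * (C - 1) by ring.
  rewrite (le_trans (ler_normD _ _))// normrM (gtr0_norm E0).
  have : E * `|C - 1| <= 2 * (q * n) by rewrite ler_pM// ltW.
  by lra.
have him : `|E * S - y| <= 3 * (q * n).
  have -> : E * S - y = E * (S - y) + (E - 1) * y by ring.
  rewrite (le_trans (ler_normD _ _))// !normrM (gtr0_norm E0).
  have : E * `|S - y| <= 2 * (q * n) by rewrite ler_pM// ltW.
  have : `|E - 1| * `|y| <= (2 * n) * n by rewrite ler_pM.
  have : n * n <= q / 2 * n by rewrite ler_wpM2r// ltW.
  by lra.
have : q * n <= e / 8 * n by rewrite ler_wpM2r.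
rewrite !subr0; have en : 0 <= e * n by rewrite mulr_ge0// ltW.
by lra.
Qed.

(** The derivative of an inverse: [v = clog (1 + k)] satisfies [cexp v = 1 + k], so
    [|k - v| <= q |v|]. With [q <= 1 / 2] this gives [|k - v| <= 2 q |k|]. *)
Lemma clog_near1 (e : R) : 0 < e -> exists2 r : R, 0 < r &
  forall k, normc k < r -> normc (clog (1 + k) - k) <= e * normc k.
Proof.
move=> e0; pose q : R := Num.min (e / 2) (1 / 2).
have q0 : 0 < q by rewrite lt_min !divr_gt0.
have [qe q1] : q <= e / 2 /\ q <= 1 / 2 by split; rewrite ge_min lexx ?orbT.
have [r r0 rP] := cexp_near0 q0.
have c1 : clog (1 + k) @[k --> (0 : R[i])] --> (0 : R[i]).
  rewrite -[X in _ --> X]clog1.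
  apply: (@cvg_clog _ (nbhs (0 : R[i])) _ (fun k => 1 + k) 1) => //=.
  by rewrite -[X in _ --> X](addr0 (1 : R[i])); apply: cvgD; [exact: cvg_cst|exact: cvg_id].
have /cvg_normcP/(_ _ r0)/nbhs_normc[d d0 dP] := c1.
exists (Num.min d 1) => [|k]; first by rewrite lt_min d0 ltr01.
rewrite lt_min => /andP[kd k1].
set v := clog (1 + k).
have vr : normc v < r.
  by have := dP k; rewrite !sub0r !normcN; exact.
have vk : cexp v = 1 + k.
  apply: clogK; rewrite raddfD /=; have := Re_le_normc k.
  by rewrite ler_norml => /andP[]; lra.
have := rP v vr; rewrite vk (addrC 1) addrK => h.
rewrite normcB; have := le_normcD (v - k) k; rewrite subrK (normcB v) => h2.
have n0 := normc_ge0 v; have n1 := normc_ge0 k; have n2 := normc_ge0 (k - v).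
have : q * normc v <= 1 / 2 * normc v by rewrite ler_wpM2r.
have : q * normc v <= q * (normc (k - v) + normc k) by rewrite ler_wpM2l// ltW.
have : q * normc (k - v) <= 1 / 2 * normc (k - v) by rewrite ler_wpM2r.
have : q * normc k <= e / 2 * normc k by rewrite ler_wpM2r.
by lra.
Qed.

End complex_exponential.

Section winding_logarithm.
Variable R : realType.

(** The two sides have the same exponential. Their imaginary parts differ by less than
    [pi / 2 + pi / 2], by continuity of [clog] at [zeta] and by the bound on its argument, so they
    cannot differ by a nonzero period. *)
Lemma clogM_near (zeta : R[i]) : 0 < Re zeta -> exists2 r : R, 0 < r &
  forall k, normc k < r -> clog (zeta * (1 + k)) = clog zeta + clog (1 + k).
Proof.
move=> z0.
have c1 : zeta * (1 + k) @[k --> (0 : R[i])] --> zeta.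
  have ck : continuous (fun k : R[i] => zeta * (1 + k)).
    apply: (@continuousM_c R[i]); first exact: continuous_cst_c.
    apply: (@continuousD_c R[i]); first exact: continuous_cst_c.
    by move=> z; exact: cvg_id.
  by have := ck 0; rewrite /continuous_at addr0 mulr1.
have [cRe _] := (cvg_complexP _ _ _).1 c1.
have c2 : clog (zeta * (1 + k)) @[k --> (0 : R[i])] --> clog zeta.
  exact: (@cvg_clog _ _ (nbhs (0 : R[i])) _ (fun k => zeta * (1 + k)) zeta z0 c1).
have p2 : 0 < pi / 2 :> R by rewrite divr_gt0// pi_gt0.
have n1 : \forall k \near (0 : R[i]), 0 < Re (zeta * (1 + k)).
  have /cvgrPdist_lt/(_ _ z0) := cRe; apply: filterS => k.
  by rewrite ltr_norml => /andP[_]; lra.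
have /cvg_normcP/(_ _ p2) n2 := c2.
have /nbhs_normc[d d0 dP] : \forall k \near (0 : R[i]), 0 < Re (zeta * (1 + k)) /\
    normc (clog zeta - clog (zeta * (1 + k))) < pi / 2.
  by apply: filterS2 n1 n2.
exists (Num.min d 1) => [|k]; first by rewrite lt_min d0 ltr01.
rewrite lt_min => /andP[kd k1].
have [h1 h2] : 0 < Re (zeta * (1 + k)) /\
    normc (clog zeta - clog (zeta * (1 + k))) < pi / 2.
  by apply: dP; rewrite sub0r normcN.
have h3 : 0 < Re (1 + k).
  rewrite raddfD /=; have := Re_le_normc k.
  by rewrite ler_norml => /andP[]; lra.
apply/eqP; rewrite -subr_eq0; apply/eqP/cexp_eq1; last first.
  rewrite cexpB cexpD !clogK// divff// mulf_neq0//.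
    by apply/eqP => h; move: z0; rewrite h ltxx.
  by apply/eqP => h; move: h3; rewrite h ltxx.
move: h2 (Im_clog (1 + k)).
move: (clog (zeta * (1 + k))) (clog zeta) (clog (1 + k)) => A B C h4 h5.
have := Im_le_normc (A - B); rewrite normcB => h6.
have := ler_normB (Im (A - B)) (Im C); rewrite -raddfB -addrA -opprD.
by move: h5 h4 h6; lra.
Qed.

Lemma is_derive_clog (a c w z : R[i]) : 0 < Re ((z - a) / w) ->
  is_derive z (1 : R[i]) (fun z => c + clog ((z - a) / w)) (z - a)^-1.
Proof.
move=> z0; have za : z - a != 0.
  by apply/eqP => h; move: z0; rewrite h mul0r ltxx.
have nza : 0 < normc (z - a) by rewrite normc_gt0.
apply/is_derive_normc => e e0.
have e1 : 0 < e * normc (z - a) by rewrite mulr_gt0.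
have [r1 r10 r1P] := clog_near1 e1; have [r2 r20 r2P] := clogM_near z0.
exists (Num.min r1 r2 * normc (z - a)).
  by rewrite mulr_gt0// lt_min r10.
move=> h hr.
have kE : normc (h / (z - a)) = normc h / normc (z - a).
  by rewrite normcZ Normc.normcV.
have : normc (h / (z - a)) < Num.min r1 r2 by rewrite kE ltr_pdivrMr.
rewrite lt_min => /andP[k1 k2].
have -> : (z + h - a) / w = (z - a) / w * (1 + h / (z - a)).
  by rewrite mulrAC mulrDr mulr1 mulrC (mulrC h) mulrA divff// mul1r; ring.
rewrite r2P//.
have -> : c + (clog ((z - a) / w) + clog (1 + h / (z - a))) -
   (c + clog ((z - a) / w)) - (z - a)^-1 * h = clog (1 + h / (z - a)) - h / (z - a).
  by rewrite (mulrC _ h); ring.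
rewrite (le_trans (r1P _ k1))// kE.
by rewrite le_eqVlt; apply/orP; left; apply/eqP; field; rewrite gt_eqF.
Qed.

(** A continuous logarithm is itself a primitive of [1 / (z - a)] along the path. Near [t] it
    factors through the branch [L t + clog ((z - a) / w)] with [w = gamma t - a], on the half-plane
    of points with [Re ((z - a) / w) > 0]. *)
Lemma primitive_along_log (a : R[i]) (gamma L : R -> R[i]) (b0 b1 : R) :
  continuous L -> (forall t, gamma t = a + cexp (L t)) ->
  primitive_along (fun z => (z - a)^-1) gamma b0 b1 L.
Proof.
move=> cL gE t _; pose w := cexp (L t); have w0 : w != 0 by exact: cexp_neq0.
exists [set z | 0 < Re ((z - a) / w)], (fun z => L t + clog ((z - a) / w)); split.
- have cf : continuous (fun z : R[i] => Re ((z - a) / w)).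
    apply: (@continuous_Re R[i]); apply: (@continuousM_c R[i]); last exact: continuous_cst_c.
    by apply: (@continuousD_c R[i]); [move=> z; exact: cvg_id|exact: continuous_cst_c].
  exact: ((continuousP (fun z : R[i] => Re ((z - a) / w))).1 cf _ (@open_gt R 0)).
- by move=> z; exact: is_derive_clog.
have cLt : L s - L t @[s --> t] --> (0 : R[i]).
  by rewrite -(subrr (L t)); apply: cvgB; [exact: cL|exact: cvg_cst].
have [_ cIm] := (cvg_complexP _ _ _).1 cLt.
have [cRe _] := (cvg_complexP _ _ _).1 (cvg_cexp _ cLt).
have p2 : 0 < pi / 2 :> R by rewrite divr_gt0// pi_gt0.
have : \forall s \near t, `|Im (L s - L t)| < pi / 2 /\ 0 < Re (cexp (L s - L t)).
  move/cvgrPdist_lt/(_ _ p2): cIm; move/cvgrPdist_lt/(_ _ ltr01): cRe.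
  apply: filterS2 => s; rewrite cexp0 /= => h1; rewrite sub0r normrN => h2.
  by split=> //; move: h1; rewrite ltr_norml => /andP[_]; rewrite /=; lra.
rewrite near_withinE; apply: filterS => s [h1 h2] _ /=.
have E : (gamma s - a) / w = cexp (L s - L t).
  by rewrite gE addrC addKr cexpB.
(* Less than a quarter turn away from [L t], the difference [L s - L t] is the principal logarithm
   of its exponential. *)
rewrite E; split=> //; rewrite -(cexp_inj_clog h1 h2 erefl).
by rewrite addrC subrK.
Qed.

(** [L] shows that a primitive exists, which excludes the default value; uniqueness of increments
    then replaces the chosen primitive by [L]. *)
Lemma winding_index_log (a : R[i]) (phi : S1 R -> R[i]) (L : R -> R[i]) :
  continuous phi -> continuous L -> (forall t, phi (expi t) = a + cexp (L t)) ->
  winding_index a phi = (2 * pi%:C * 'i%C)^-1 * (L (2 * pi) - L 0).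
Proof.
move=> cphi cL pE; rewrite /winding_index /path_integral; congr (_ * _).
have PL := @primitive_along_log a (phi \o @expi R) L 0 (2 * pi) cL pE.
have cg : continuous (phi \o @expi R).
  by move=> t; apply: continuous_comp; [exact: continuous_expi|exact: cphi].
have pi2 : 0 <= 2 * pi :> R by exact/ltW/twopi_gt0.
case: xgetP => [_ -> [F PF <-]|/(_ (L (2 * pi) - L 0))]; last by case; exists L.
exact: primitive_along_unique pi2 cg PF PL.
Qed.

End winding_logarithm.

(** * Fejer interpolation *)

Section trigonometric_approximation.
Variable R : realType.
Implicit Types (z : S1 R) (zeta : R[i]).

Lemma sum_normc (I : finType) (F : I -> R[i]) :
  normc (\sum_i F i) <= \sum_i normc (F i).
Proof.
elim/big_ind2: _ => [||//].
- by rewrite Normc.normc0.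
- by move=> x1 x2 y1 y2 h1 h2; rewrite (le_trans (le_normcD _ _))// lerD.
Qed.

Lemma expi_neq1 (x : R) : 0 < x < 2 * pi -> S1_val (expi x) != 1.
Proof.
move=> /andP[x0 xpi]; apply/eqP => -[c1 _].
have x2 : x = (x / 2) *+ 2 by rewrite -mulr_natr mulfVK.
have s0 : 0 < sin (x / 2).
  by apply: sin_gt0_pi; rewrite divr_gt0//= ltr_pdivrMr// mulrC.
move: c1; rewrite x2 cos_mulr2n cos2sin2 => c1.
have : 0 < sin (x / 2) ^+ 2 by rewrite exprn_gt0.
by move: c1; rewrite mulr2n; lra.
Qed.

Variable N : nat.
Local Notation n := N.+1.

Definition unity_node (k : nat) : S1 R := expi (k%:R * (2 * pi / n%:R)).
Local Notation om := (S1_val (unity_node 1)).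

Lemma unity_nodeE k : S1_val (unity_node k) = om ^+ k.
Proof.
by rewrite -[RHS]/(S1_val (expi _) ^ k) expiX mul1r.
Qed.

Lemma unity_node_expn : om ^+ n = 1.
Proof.
rewrite -[LHS]/(S1_val (expi _) ^ n) expiX mul1r mulrC mulfVK ?pnatr_eq0//.
exact: expi2pi.
Qed.

Lemma unity_node_inj i j : (i < n)%N -> (j < n)%N -> om ^+ i = om ^+ j -> i = j.
Proof.
wlog ij : i j / (i <= j)%N.
  by move=> H iN jN h; case: (leqP i j) => [|/ltnW] ij; [exact: H|apply/esym/H].
move=> iN jN h; apply/eqP; rewrite eqn_leq ij /= leqNgt; apply/negP => lij.
have : om ^+ (j - i) = 1.
  apply: (mulfI (expf_neq0 i (S1_val_neq0 (unity_node 1)))).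
  by rewrite -exprD subnKC// h mulr1.
rewrite -unity_nodeE; apply/eqP/expi_neq1.
have p2 := twopi_gt0 R; have n0 : 0 < n%:R :> R by rewrite ltr0n.
rewrite mulr_gt0 ?ltr0n ?subn_gt0 ?divr_gt0//=.
rewrite mulrA ltr_pdivrMr// mulrC ltr_pM2l// ltr_nat.
by rewrite (leq_ltn_trans (leq_subr _ _)).
Qed.

Definition geom_sum zeta := \sum_(j < n) zeta ^+ j.

Lemma conj_unit zeta : normc zeta = 1 -> zeta != 0 /\ zeta^*%C = zeta^-1.
Proof.
move=> z1; have z0 : zeta != 0.
  by rewrite -normc_gt0 z1.
by split=> //; apply: (mulfI z0); rewrite mulc_conjc z1 expr1n divff.
Qed.

(** Reversal of the summation order. It turns the polynomial [geom_sum zeta ^+ 2] into [zeta ^+ N]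
    times a squared modulus, so that a nonnegative kernel becomes polynomial in [z]. *)
Lemma geom_sum_conj zeta : normc zeta = 1 ->
  geom_sum zeta = zeta ^+ N * (geom_sum zeta)^*%C.
Proof.
move=> /conj_unit[z0 zc]; rewrite /geom_sum rmorph_sum /= mulr_sumr.
rewrite (reindex_inj rev_ord_inj) /=; apply: eq_bigr => j _.
have jN : (j <= N)%N by rewrite -ltnS.
have -> : zeta ^+ N = zeta ^+ (N - j) * zeta ^+ j by rewrite -exprD subnK.
by rewrite rmorphXn /= zc subSS -mulrA -exprMn mulfV// expr1n mulr1.
Qed.

(** The Fejer kernel of order [n] centered at the node [om ^+ k], divided once more by [n]. *)
Definition fejer_weight k z := normc (geom_sum (S1_val z / om ^+ k)) ^+ 2 / n%:R ^+ 2.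

Lemma normc_node_div k z : normc (S1_val z / om ^+ k) = 1.
Proof.
rewrite normcZ Normc.normcV normc_S1 -unity_nodeE normc_S1.
by rewrite invr1 mulr1.
Qed.

Lemma fejer_weight_ge0 k z : 0 <= fejer_weight k z.
Proof. by rewrite divr_ge0// sqr_ge0. Qed.

(** Expand the squared modulus into a double sum over [i] and [j]. Summing over the nodes,
    orthogonality of the roots of unity kills the terms [i != j], and the diagonal contributes
    [n * n]. *)
Lemma fejer_weight_sum z : \sum_(k < n) fejer_weight k z = 1.
Proof.
rewrite -mulr_suml; apply/eqP; rewrite -(inj_eq (@complexI R)); apply/eqP.
rewrite rmorphM rmorph_sum /=.
have nn : (n%:R ^+ 2)%:C != 0 :> R[i].
  by rewrite rmorphXn /= rmorph_nat expf_neq0// pnatr_eq0.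
have om0 := S1_val_neq0 (unity_node 1); have z0 := S1_val_neq0 z.
have E k : (normc (geom_sum (S1_val z / om ^+ k)) ^+ 2)%:C =
    \sum_(i < n) \sum_(j < n) S1_val z ^+ i / S1_val z ^+ j * (om ^+ j / om ^+ i) ^+ k.
  have [c0 cc] := conj_unit (normc_node_div k z).
  rewrite -mulc_conjc /geom_sum rmorph_sum /= mulr_suml; apply: eq_bigr => i _.
  rewrite mulr_sumr; apply: eq_bigr => j _.
  rewrite rmorphXn /= cc invf_div !expr_div_n -!exprM [(k * _)%N]mulnC [(k * _)%N]mulnC.
  by field; rewrite !expf_neq0.
under eq_bigr do rewrite E.
rewrite exchange_big /=.
under eq_bigr => i _.
  rewrite exchange_big /= (bigD1 i)//= [X in _ + X]big1 ?addr0; last first.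
    move=> j ji; rewrite -mulr_sumr.
    have y1 : om ^+ j / om ^+ i != 1.
      apply: contra ji => /eqP h.
      have h' : om ^+ j = om ^+ i.
        by rewrite -[LHS](divfK (expf_neq0 i om0)) h mul1r.
      exact/eqP/val_inj/(unity_node_inj (ltn_ord j) (ltn_ord i) h').
    suff -> : \sum_(k < n) (om ^+ j / om ^+ i) ^+ k = 0 by rewrite mulr0.
    apply: (mulfI (_ : om ^+ j / om ^+ i - 1 != 0)); first by rewrite subr_eq0.
    rewrite -subrX1 mulr0 expr_div_n -!exprM [(j * _)%N]mulnC [(i * _)%N]mulnC.
    by rewrite !exprM unity_node_expn !expr1n divff ?oner_eq0// subrr.
  rewrite !divff ?expf_neq0//.
  under eq_bigr do rewrite expr1n mulr1.
  rewrite sumr_const card_ord.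
  over.
rewrite /= sumr_const card_ord -mulrnA.
by rewrite fmorphV rmorphXn /= rmorph_nat -natrX mulnn divff// pnatr_eq0.
Qed.

(** The product of [geom_sum zeta] and [zeta - 1] is [zeta ^+ n - 1], of modulus at most 2. *)
Lemma fejer_weight_dist k z :
  fejer_weight k z * normc (S1_val z - om ^+ k) ^+ 2 <= 4 / n%:R ^+ 2.
Proof.
have n0 : 0 < n%:R ^+ 2 :> R by rewrite exprn_gt0// ltr0n.
rewrite /fejer_weight mulrAC ler_pM2r ?invr_gt0// -exprMn -normcZ.
set zeta := S1_val z / om ^+ k.
have o0 : om ^+ k != 0 by rewrite expf_neq0// S1_val_neq0.
have -> : S1_val z - om ^+ k = om ^+ k * (zeta - 1).
  by rewrite /zeta; field.
have -> : geom_sum zeta * (om ^+ k * (zeta - 1)) = om ^+ k * (zeta ^+ n - 1).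
  by rewrite subrX1 /geom_sum; ring.
rewrite normcZ -unity_nodeE normc_S1 mul1r.
have h : normc (zeta ^+ n - 1) <= 2.
  rewrite (le_trans (le_normcD _ _))// normcN Normc.normc1.
  have -> : normc (zeta ^+ n) = 1.
    elim: n => [|m IH]; first by rewrite expr0 Normc.normc1.
    by rewrite exprS normcZ IH mulr1 normc_node_div.
  by [].
have := normc_ge0 (zeta ^+ n - 1); move: h; set t := normc _ => h t0.
by rewrite (_ : 4 = 2 ^+ 2)// ?ler_pXn2r ?nnegrE//; ring.
Qed.

(* The weights are nonnegative of sum 1 and their second moment is O(1/n), so the
   weighted mean of the values of f at the nodes converges uniformly to f; the
   factor z^N turns it into a polynomial in z. *)
Definition fejer_interpolant (f : S1 R -> R[i]) : {poly R[i]} :=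
  \sum_(k < n) (f (unity_node k) * (om ^+ k) ^+ N / n%:R ^+ 2) *:
    (\sum_(j < n) (om ^- k) ^+ j *: 'X^j) ^+ 2.

Lemma fejer_interpolantE f z : (fejer_interpolant f).[S1_val z] =
  S1_val z ^+ N * \sum_(k < n) f (unity_node k) * (fejer_weight k z)%:C.
Proof.
rewrite /fejer_interpolant horner_sum mulr_sumr; apply: eq_bigr => k _.
rewrite hornerZ horner_exp horner_sum.
have o0 : om ^+ k != 0 by rewrite expf_neq0// S1_val_neq0.
have -> : \sum_(j < n) ((om ^- k) ^+ j *: 'X^j).[S1_val z] = geom_sum (S1_val z / om ^+ k).
  by apply: eq_bigr => j _; rewrite hornerZ hornerXn exprMn mulrC.
have := geom_sum_conj (normc_node_div k z).
rewrite /fejer_weight rmorphM /= -mulc_conjc fmorphV rmorphXn rmorph_nat.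
set G := geom_sum _ => Gc.
have -> : G ^+ 2 = (S1_val z / om ^+ k) ^+ N * (G * G^*%C).
  by rewrite expr2 {1}Gc; ring.
rewrite expr_div_n; move: (G^*%C) (n%:R ^- 2) => A c.
by field; rewrite expf_neq0.
Qed.

End trigonometric_approximation.

Lemma trigonometric_approximation (R : realType) (f : S1 R -> R[i]) (e : R) :
  csymbol f -> 0 < e -> exists (p : {poly R[i]}) (N : nat),
    forall z, normc (f z * S1_val z ^+ N - p.[S1_val z]) <= e.
Proof.
move=> cf e0; have [M M0 fM] := csymbol_sup cf.
have e2 : 0 < e / 2 by rewrite divr_gt0.
have [cf'] := cf; have [r r0 rf] := S1_uniform_continuity cf' e2.
(* Chosen so that [C * t^2] exceeds the trivial bound [2 * M] as soon as [t >= r]. The resulting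
   quadratic modulus of continuity is matched to the second moment of the weights, so the nodes need
   not be divided into near and far ones. *)
pose C := 2 * M / r ^+ 2.
have C0 : 0 < C by rewrite divr_gt0 ?exprn_gt0// mulr_gt0.
have fC z w : normc (f z - f w) <= e / 2 + C * normc (S1_val z - S1_val w) ^+ 2.
  set t := normc (_ - S1_val w); have t0 : 0 <= t by exact: normc_ge0.
  have [tr|rt] := ltP t r.
    by rewrite (le_trans (ltW (rf _ _ tr)))// lerDl mulr_ge0 ?sqr_ge0// ltW.
  have h1 : normc (f z - f w) <= 2 * M.
    rewrite (le_trans (le_normcD _ _))// normcN.
    by have := fM z; have := fM w; lra.
  have h2 : 2 * M <= C * t ^+ 2.
    rewrite /C mulrAC ler_pdivlMr ?exprn_gt0// ler_pM2l ?mulr_gt0//.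
    by rewrite ler_pXn2r ?nnegrE// ltW.
  by lra.
(* Summed over the [N + 1] nodes, the quadratic term contributes [4 * C / (N + 1)], which must not
   exceed [e / 2]. *)
have [N Nb] : exists N : nat, 8 * C / e < N%:R.
  by exists (Num.bound (8 * C / e)); rewrite archi_boundP// ltW// divr_gt0// mulr_gt0.
exists (fejer_interpolant N f), N => z.
rewrite fejer_interpolantE mulrC -mulrBr normcZ.
have -> : normc (S1_val z ^+ N) = 1 by exact: (normc_S1X z N).
rewrite mul1r -[f z]mulr1.
have -> : 1 = \sum_(k < N.+1) (fejer_weight N k z)%:C :> R[i].
  by rewrite -rmorph_sum /= fejer_weight_sum.
rewrite mulr_sumr -sumrB; apply: le_trans (sum_normc _) _.
have n0 : 0 < N.+1%:R :> R by rewrite ltr0n.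
apply: (@le_trans _ _ (\sum_(k < N.+1) (e / 2 * fejer_weight N k z + C * (4 / N.+1%:R ^+ 2)))).
  apply: ler_sum => k _; rewrite -mulrBl normcZ normc_real.
  have w0 := fejer_weight_ge0 N k z; rewrite (ger0_norm w0).
  have := ler_wpM2r w0 (fC z (unity_node R N k)).
  have := ler_wpM2l (ltW C0) (fejer_weight_dist N k z).
  rewrite (@unity_nodeE R N k) => h1; rewrite (mulrDl (e / 2)) => h2.
  by rewrite (le_trans h2)// lerD2l -mulrA [X in C * X]mulrC.
rewrite big_split /= -mulr_sumr fejer_weight_sum mulr1 sumr_const card_ord.
rewrite -(mulr_natr (C * _)).
have -> : C * (4 / N.+1%:R ^+ 2) * N.+1%:R = 4 * C / N.+1%:R.
  by field; rewrite gt_eqF.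
rewrite [leRHS](splitr e) lerD2l ler_pdivrMr//.
move: Nb; rewrite ltr_pdivrMr// -natr1 => Nb.
by have := ltW e0; nra.
Qed.

(** * Wiener-Hopf factorization *)

Section wiener_hopf.
Variable R : realType.
Local Notation H2 := (@hardy2 R).
Implicit Types (f g h k u psi : S1 R -> R[i]) (n : int).

Lemma outer_cst (c : R[i]) : c != 0 -> outer_symbol (fun _ : S1 R => c).
Proof.
move=> c0; have a (c' : R[i]) : analytic_symbol (fun _ : S1 R => c').
  by split=> x; rewrite cL2_mul_cst hardy2E; exact: cL2_orthZ.
by split=> //; exact: csymbol_cst.
Qed.

Lemma analytic_symbolM h k : csymbol h -> csymbol k ->
  analytic_symbol h -> analytic_symbol k -> analytic_symbol (fun z => h z * k z).
Proof.
by move=> ch ck [ah] [ak]; split=> x hx; rewrite -S1_mulM//; exact/ah/ak.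
Qed.

Lemma outer_symbolM h k : outer_symbol h -> outer_symbol k ->
  outer_symbol (fun z => h z * k z).
Proof.
move=> [ch h0 ah ahV] [ck k0 ak akV].
have chV := csymbolV ch h0; have ckV := csymbolV ck k0.
split.
- exact: csymbolM.
- by move=> z; rewrite mulf_neq0.
- exact: analytic_symbolM.
- have -> : (fun z => (h z * k z)^-1) = (fun z => (h z)^-1 * (k z)^-1).
    by apply/funext => z; rewrite invfM.
  exact: analytic_symbolM.
Qed.

Lemma outer_symbolV h : outer_symbol h -> outer_symbol (fun z => (h z)^-1).
Proof.
move=> [ch h0 ah ahV]; split => //.
- exact: csymbolV.
- by move=> z; rewrite invr_neq0.
- by have -> : (fun z => (h z)^-1^-1) = h by apply/funext => z; rewrite invrK.
Qed.

Lemma csymbol_S1_val : csymbol (fun z : S1 R => S1_val z).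
Proof. by split; exact: continuous_S1_val. Qed.

Lemma outer_linear (c : R[i]) : normc c < 1 ->
  outer_symbol (fun z : S1 R => 1 - c * S1_val z).
Proof.
move=> c1.
have ch : csymbol (fun z : S1 R => 1 - c * S1_val z).
  have -> : (fun z : S1 R => 1 - c * S1_val z) = (fun z => 1 + - c * S1_val z).
    by apply/funext => z; rewrite mulNr.
  exact: (csymbolD (csymbol_cst _) (csymbolM (csymbol_cst _) csymbol_S1_val)).
have h0 (z : S1 R) : 1 - c * S1_val z != 0.
  rewrite subr_eq0; apply/eqP => /(congr1 (@Normc.normc R)).
  by rewrite normcZ normc_S1 mulr1 Normc.normc1 => h; rewrite -h ltxx in c1.
have chV := csymbolV ch h0.
have mE (x : L2 R) : cL2_mul (fun z => 1 - c * S1_val z) x =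
    x - c *: cL2_mul (fun z => S1_val z ^ 1) x.
  rewrite -scaleNr -(cL2_mul_cst (- c)) S1_mulM; [|exact: csymbol_cst|exact: csymbol_S1X].
  rewrite -{2}(mul1_op x) -cL2_mulDs.
  - by apply: eq_cL2_mul => z; rewrite expr1z mulNr.
  - exact: bounded_symbol_cst.
  - apply: csymbol_bounded; apply: csymbolM; [exact: csymbol_cst|exact: csymbol_S1X].
split=> //; split=> x /hardy2P hx; apply/hardy2P => n n0.
  by rewrite mE cL2_dotBl cL2_dotZl dot_mul_mode !hx ?mulr0 ?subr0//; lia.
set y := cL2_mul _ x.
have xE : x = y - c *: cL2_mul (fun z => S1_val z ^ 1) y.
  rewrite -mE /y S1_mulM// -[LHS]mul1_op; apply: eq_cL2_mul => z.
  by rewrite mulfV.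
(* The negative Fourier coefficients of y satisfy y_n = c y_(n-1): being bounded
   and |c| < 1, they vanish. *)
have step m : m < 0 -> cL2_dot y (mode R m) = c * cL2_dot y (mode R (m - 1)).
  move=> m0; have := hx m m0; rewrite {1}xE cL2_dotBl cL2_dotZl dot_mul_mode.
  by move/eqP; rewrite subr_eq0 => /eqP.
have iter j : cL2_dot y (mode R n) = c ^+ j * cL2_dot y (mode R (n - j%:Z)).
  elim: j => [|j IH]; first by rewrite subr0 mul1r.
  rewrite IH step; last by lia.
  by rewrite mulrA -exprSr; congr (_ * cL2_dot _ (mode R _)); lia.
have bound j : normc (cL2_dot y (mode R n)) <= normc c ^+ j * hnorm y.
  rewrite (iter j) normcZ.
  have -> : normc (c ^+ j) = normc c ^+ j.
    by elim: j => [|j IH]; rewrite ?expr0 ?Normc.normc1// !exprS normcZ IH.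
  rewrite ler_wpM2l ?exprn_ge0 ?normc_ge0// (le_trans (cauchy_schwarz _ _))//.
  by rewrite hnorm_mode mulr1.
apply: Normc.eq0_normc; apply/eqP; rewrite eq_le normc_ge0 andbT.
have C : normc c ^+ j * hnorm y @[j --> \oo] --> 0 * hnorm y.
  apply: cvgM; last exact: cvg_cst.
  by apply: cvg_expr; rewrite ger0_norm// normc_ge0.
rewrite mul0r in C; rewrite -(cvg_lim _ C)//.
by apply: limr_ge; [apply/cvg_ex; eexists; exact: C|exact: nearW].
Qed.

(** * Continuous logarithms along the circle *)

Definition has_log_increment psi n := exists L : R -> R[i],
  [/\ continuous L, forall t, psi (expi t) = cexp (L t) &
      L (2 * pi) - L 0 = 2 * pi%:C * 'i%C * n%:~R].

Lemma has_log_incrementM f g m n : has_log_increment f m ->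
  has_log_increment g n -> has_log_increment (fun z => f z * g z) (m + n).
Proof.
move=> [L [cL fL dL]] [L' [cL' gL dL']]; exists (fun t => L t + L' t); split.
- exact: (continuousD_c cL cL').
- by move=> t; rewrite fL gL cexpD.
- by rewrite opprD addrACA dL dL' -mulrDr intrD.
Qed.

Lemma has_log_increment_cst (c : R[i]) : c != 0 -> has_log_increment (fun=> c) 0.
Proof.
move=> c0; have nc : 0 < normc c by rewrite normc_gt0.
have u1 : `|c / (normc c)%:C| = 1.
  by rewrite normf_div !normC_normc normc_real ger0_norm ?normc_ge0// divff//
    fmorph_eq0 gt_eqF.
pose z : S1 R := exist _ (c / (normc c)%:C) (mem_set u1).
have [t _ tz] := expi_surj z.
exists (fun=> ln (normc c) +i* t); split.
- exact: continuous_cst_c.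
- move=> _; rewrite /cexp /= lnK ?posrE//.
  have : S1_val (expi t) = c / (normc c)%:C by rewrite tz.
  move=> /(congr1 (fun w => w * (normc c)%:C)).
  rewrite divfK ?fmorph_eq0 ?gt_eqF// => {1}<-.
  by rewrite /S1_val /=; simpc; rewrite mulrC [_ * normc c]mulrC.
- by rewrite subrr mulr0.
Qed.

Lemma has_log_increment_S1X n : has_log_increment (fun z => S1_val z ^ n) n.
Proof.
exists (fun t => 0 +i* (n%:~R * t)); split.
- apply: cvg_complex; first exact: cst_continuous.
  by move=> t; apply: cvgM; [exact: cvg_cst|exact: cvg_id].
- by move=> t; rewrite expiX /cexp /= expR0 !mul1r.
- apply/eqP; rewrite eq_complex; apply/andP; split; apply/eqP.
    by rewrite -(rmorph_int (real_complex R)) /=; simpc; rewrite /= ?mulr0 ?mul0r.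
  by rewrite -(rmorph_int (real_complex R)) /=; simpc; rewrite /=; ring.
Qed.

(** The values stay in the right half-plane, so the principal branch is continuous along the whole
    circle and returns to its initial value. *)
Lemma has_log_increment_near1 u (q : R) : csymbol u -> q < 1 ->
  (forall z, normc (u z - 1) <= q) -> has_log_increment u 0.
Proof.
move=> [cu] q1 uq.
have u0 z : 0 < Re (u z).
  have := le_lt_trans (le_trans (Re_le_normc _) (uq z)) q1.
  by rewrite raddfB ltr_norml => /andP[]; rewrite /=; lra.
exists (fun t => clog (u (expi t))); split.
- move=> t; apply: (cvg_clog _ (u0 (expi t))).
  by apply: continuous_comp; [exact: continuous_expi|exact: cu].
- by move=> t; rewrite clogK.
- have -> : expi (2 * pi) = expi 0 :> S1 R.
    by apply: val_inj; rewrite /= mulr_natl cos2pi sin2pi cos0 sin0.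
  by rewrite subrr mulr0.
Qed.

(** One integer is both the exponent of [z] and the increment of the logarithm. Both add up under
    products, so the agreement of factorization and index need only be checked on the elementary
    factors. *)
Definition wh_symbol psi n := has_log_increment psi n /\
  exists h k, [/\ outer_symbol h, outer_symbol (fun z => (k z)^*%C) &
    forall z, psi z = S1_val z ^ n * h z * k z].

Lemma wh_symbolM f g m n : wh_symbol f m -> wh_symbol g n ->
  wh_symbol (fun z => f z * g z) (m + n).
Proof.
move=> [lf [h [k [oh ok fE]]]] [lg [h' [k' [oh' ok' gE]]]].
split; first exact: has_log_incrementM.
exists (fun z => h z * h' z), (fun z => k z * k' z); split.
- exact: outer_symbolM.
- have -> : (fun z => (k z * k' z)^*%C) = (fun z => (k z)^*%C * (k' z)^*%C).
    by apply/funext => z; rewrite rmorphM.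
  exact: outer_symbolM.
- by move=> z; rewrite fE gE expfzDr ?S1_val_neq0//; ring.
Qed.

Lemma outer_conj_cst (c : R[i]) : c != 0 ->
  outer_symbol (fun _ : S1 R => c^*%C).
Proof. by move=> c0; apply: outer_cst; rewrite conjc_eq0. Qed.

Lemma wh_symbol_S1X n : wh_symbol (fun z => S1_val z ^ n) n.
Proof.
split; first exact: has_log_increment_S1X.
exists (fun=> 1), (fun=> 1); split.
- exact: outer_cst (oner_neq0 _).
- exact: outer_conj_cst (oner_neq0 _).
- by move=> z; rewrite !mulr1.
Qed.

Lemma wh_symbol_cst (c : R[i]) : c != 0 -> wh_symbol (fun=> c) 0.
Proof.
move=> c0; split; first exact: has_log_increment_cst.
exists (fun=> c), (fun=> 1); split.
- exact: outer_cst.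
- exact: outer_conj_cst (oner_neq0 _).
- by move=> z; rewrite expr0z mul1r mulr1.
Qed.

Lemma wh_symbol_outer h (q : R) : outer_symbol h -> q < 1 ->
  (forall z, normc (h z - 1) <= q) -> wh_symbol h 0.
Proof.
move=> oh q1 hq; have [ch _ _ _] := oh.
split; first exact: has_log_increment_near1 ch q1 hq.
exists h, (fun=> 1); split => //; first exact: outer_conj_cst (oner_neq0 _).
by move=> z; rewrite expr0z mul1r mulr1.
Qed.

Lemma wh_symbol_conj_outer k (q : R) : outer_symbol (fun z => (k z)^*%C) ->
  q < 1 -> (forall z, normc (k z - 1) <= q) -> wh_symbol k 0.
Proof.
move=> ok q1 kq; have [ck _ _ _] := outer_conj ok.
split; first exact: has_log_increment_near1 ck q1 kq.
exists (fun=> 1), k; split => //; first exact: outer_cst (oner_neq0 _).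
by move=> z; rewrite expr0z !mul1r.
Qed.

(** A root inside the disc gives [z (1 - r / z)], with exponent 1 and a coanalytic factor; a root
    outside gives [- r (1 - z / r)], with exponent 0 and an analytic one. The bracket stays at
    distance less than 1 from 1, so it has increment 0. *)
Lemma wh_symbol_linear (r : R[i]) : normc r != 1 ->
  exists n, wh_symbol (fun z => S1_val z - r) n.
Proof.
move=> r1; have [r_lt1|r_gt1|r_eq1] := ltgtP (normc r) 1; last by rewrite r_eq1 eqxx in r1.
- exists (1 + 0); have -> : (fun z : S1 R => S1_val z - r) =
      (fun z => S1_val z ^ 1 * (1 - r * S1_val z ^ (-1))).
    apply/funext => z; rewrite expr1z mulrBr mulr1 mulrCA.
    by rewrite exprN1 mulfV ?S1_val_neq0// mulr1.
  apply: wh_symbolM; first exact: wh_symbol_S1X.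
  apply: (@wh_symbol_conj_outer _ (normc r)) => //.
    have -> : (fun z : S1 R => (1 - r * S1_val z ^ (-1))^*%C) =
        (fun z => 1 - r^*%C * S1_val z).
      by apply/funext => z; rewrite rmorphB rmorphM rmorph1 /= S1_conjX opprK expr1z.
    by apply: outer_linear; rewrite normc_conjc.
  by move=> z; rewrite addrC addKr normcN normcZ normc_S1X mulr1.
- have r0 : r != 0 by apply/eqP => h; move: r_gt1; rewrite h Normc.normc0 ltr10.
  have rV : normc r^-1 < 1 by rewrite Normc.normcV invf_lt1// (lt_trans ltr01).
  exists (0 + 0); have -> : (fun z : S1 R => S1_val z - r) =
      (fun z => - r * (1 - r^-1 * S1_val z)).
    by apply/funext => z; rewrite mulrBr mulr1 mulNr mulrA mulfV// mul1r opprK addrC.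
  apply: wh_symbolM; first by apply: wh_symbol_cst; rewrite oppr_eq0.
  apply: (wh_symbol_outer (outer_linear rV) rV) => z.
  by rewrite addrC addKr normcN normcZ normc_S1 mulr1.
Qed.

Lemma wh_symbol_poly (p : {poly R[i]}) : (forall z : S1 R, p.[S1_val z] != 0) ->
  exists n, wh_symbol (fun z => p.[S1_val z]) n.
Proof.
move=> p0; have [s ps] := closed_field_poly_normal p.
have lc0 : lead_coef p != 0.
  by apply/eqP => h; have := p0 (expi 0); rewrite ps h scale0r horner0 eqxx.
have -> : (fun z : S1 R => p.[S1_val z]) =
    (fun z => lead_coef p * \prod_(r <- s) (S1_val z - r)).
  apply/funext => z; rewrite {1}ps hornerZ horner_prod; congr (_ * _).
  by apply: eq_bigr => r _; rewrite hornerXsubC.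
have s1 r : r \in s -> normc r != 1.
  move=> rs; apply/eqP => r1.
  have r1' : `|r| = 1 by rewrite normC_normc r1.
  (* A root of modulus 1 would be a point of the circle at which [p] vanishes. *)
  have := p0 (exist _ r (mem_set r1')); rewrite ps hornerZ horner_prod.
  rewrite (big_rem r)//= hornerXsubC /S1_val /= subrr mul0r mulr0.
  by rewrite eqxx.
have [n wn] : exists n, wh_symbol (fun z => \prod_(r <- s) (S1_val z - r)) n.
  elim: s s1 {ps} => [|r s IH] s1.
    exists 0; under eq_fun do rewrite big_nil.
    exact: wh_symbol_cst (oner_neq0 _).
  have [n wn] : exists n, wh_symbol (fun z => \prod_(r <- s) (S1_val z - r)) n.
    by apply: IH => r' rs; apply: s1; rewrite inE rs orbT.
  have [m wm] := wh_symbol_linear (s1 r (mem_head _ _)).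
  exists (m + n); under eq_fun do rewrite big_cons.
  exact: wh_symbolM.
by exists (0 + n); apply: wh_symbolM => //; exact: wh_symbol_cst.
Qed.

(** * Factorization of nonvanishing symbols and the index *)

Theorem wiener_hopf_factorization f (q : R) : csymbol f -> (forall z, f z != 0) ->
  0 < q -> q <= 1 -> exists n u psi,
    [/\ csymbol u, forall z, normc (u z - 1) <= q, wh_symbol psi n &
        forall z, f z = u z * psi z].
Proof.
move=> cf f0 q0 q1.
have [M M0 fM] := csymbol_sup (csymbolV cf f0).
(* Since [|f| >= 1 / M] and [q <= 1], this error leaves [|p| >= 1 / (2 M)]; dividing by [p] then
   gives exactly [|u - 1| <= q]. *)
have e0 : 0 < q / (2 * M) by rewrite divr_gt0// mulr_gt0.
have [p [N pN]] := trigonometric_approximation cf e0.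
have zN (z : S1 R) : normc (S1_val z ^+ N) = 1 by exact: (normc_S1X z N).
have fN z : M^-1 <= normc (f z * S1_val z ^+ N).
  rewrite normcZ zN mulr1 -[leRHS]invrK lef_pV2 ?posrE//.
    by have := fM z; rewrite Normc.normcV.
  by rewrite invr_gt0 normc_gt0.
have MV : q / (2 * M) = q / 2 * M^-1 by field; rewrite gt_eqF.
have pM z : M^-1 / 2 <= normc p.[S1_val z].
  have := le_normcD (f z * S1_val z ^+ N - p.[S1_val z]) p.[S1_val z].
  rewrite subrK; have := pN z; have := fN z; rewrite MV.
  have : q / 2 * M^-1 <= 1 / 2 * M^-1 by rewrite ler_pM2r ?invr_gt0// ler_pM2r.
  lra.
have M20 : 0 < M^-1 / 2 by rewrite divr_gt0// invr_gt0.
have p0 z : p.[S1_val z] != 0.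
  apply/eqP => h; have := pM z; rewrite h Normc.normc0 => h'.
  by have := lt_le_trans M20 h'; rewrite ltxx.
have [n wn] := wh_symbol_poly p0.
exists (n - N%:Z), (fun z => f z * S1_val z ^+ N / p.[S1_val z]),
  (fun z => p.[S1_val z] * S1_val z ^ (- N%:Z)); split.
- have cp : csymbol (fun z : S1 R => p.[S1_val z]).
    (* Continuity of [p] on the circle is read off its factorization. *)
    have [_ [h [k [[ch _ _ _] /outer_conj[ck _ _ _] /funext ->]]]] := wn.
    apply: csymbolM; last exact: ck.
    by apply: csymbolM => //; exact: csymbol_S1X.
  apply: csymbolM; last exact: csymbolV.
  exact: (csymbolM cf (@csymbol_S1X R N)).
- move=> z; have -> : f z * S1_val z ^+ N / p.[S1_val z] - 1 =
      (f z * S1_val z ^+ N - p.[S1_val z]) / p.[S1_val z] by field; rewrite p0.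
  rewrite normcZ Normc.normcV ler_pdivrMr; last exact: lt_le_trans (pM z).
  rewrite (le_trans (pN z))// MV (le_trans _ (ler_wpM2l (ltW q0) (pM z)))//.
  by rewrite le_eqVlt; apply/orP; left; apply/eqP; ring.
- by apply: wh_symbolM => //; exact: wh_symbol_S1X.
- move=> z; rewrite -exprnN mulrA divfK// -mulrA mulfV ?mulr1//.
  by rewrite expf_neq0// S1_val_neq0.
Qed.

Lemma wiener_hopf_winding (a : R[i]) f u psi n (q : R) : csymbol f ->
  csymbol u -> q < 1 -> (forall z, normc (u z - 1) <= q) -> wh_symbol psi n ->
  (forall z, f z - a = u z * psi z) -> winding_index a f = n%:~R.
Proof.
move=> [cf] cu q1 uq [lpsi _] fE.
have [L [cL LE dL]] := has_log_incrementM (has_log_increment_near1 cu q1 uq) lpsi.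
rewrite (winding_index_log cf cL); last by move=> t; rewrite -LE -fE addrC subrK.
rewrite dL add0r mulKf//.
have pi0 : pi%:C != 0 :> R[i] by rewrite fmorph_eq0 gt_eqF// pi_gt0.
rewrite !mulf_neq0 ?pnatr_eq0//.
by apply/eqP => -[] /eqP; rewrite oner_eq0.
Qed.

Theorem singular_invertible_iff (a : R[i]) f g : csymbol f -> csymbol g ->
  (forall z, f z - a != 0) -> (forall z, g z - a != 0) ->
  invertible_op (singular_op (fun z => f z - a) (fun z => g z - a)) <->
  winding_index a f = winding_index a g.
Proof.
move=> cf cg f0 g0.
have cfa := csymbolD cf (csymbol_cst (- a)); have cga := csymbolD cg (csymbol_cst (- a)).
(* With both perturbations within [1 / 4] of 1, [|v| >= 3 / 4] and [|u / v - 1| <= (1 / 4 + 1 / 4) /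
   (3 / 4) = 2 / 3 < 1]. *)
have q0 : 0 < 1 / 4 :> R by lra.
have q1 : 1 / 4 <= 1 :> R by lra.
have q1' : 1 / 4 < 1 :> R by lra.
have [m [u [psi [cu uq wpsi fE]]]] := wiener_hopf_factorization cfa f0 q0 q1.
have [n [v [chi [cv vq wchi gE]]]] := wiener_hopf_factorization cga g0 q0 q1.
rewrite (wiener_hopf_winding cf cu q1' uq wpsi fE).
rewrite (wiener_hopf_winding cg cv q1' vq wchi gE).
have [_ [h [k [oh ok psiE]]]] := wpsi; have [_ [h' [k' [oh' ok' chiE]]]] := wchi.
have v34 z : 3 / 4 <= normc (v z).
  have := le_normcD (1 - v z) (v z); rewrite subrK Normc.normc1 normcB.
  by have := vq z; lra.
have v0 z : v z != 0.
  by apply/eqP => e; have := v34 z; rewrite e Normc.normc0; lra.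
have cuv := csymbolM cu (csymbolV cv v0).
have uvq z : normc (u z / v z - 1) <= 2 / 3.
  have -> : u z / v z - 1 = (u z - v z) / v z by field; rewrite v0.
  have vz := v34 z.
  rewrite normcZ Normc.normcV ler_pdivrMr; last by lra.
  have := le_normcD (u z - 1) (1 - v z); rewrite addrA subrK (normcB 1).
  by have := uq z; have := vq z; lra.
have r1 : 2 / 3 < 1 :> R by lra.
have ohh : outer_symbol (fun z => h z * (h' z)^-1).
  exact: (outer_symbolM oh (outer_symbolV oh')).
have okk : outer_symbol (fun z => (k z * (k' z)^-1)^*%C).
  have -> : (fun z => (k z * (k' z)^-1)^*%C) = (fun z => (k z)^*%C * ((k' z)^*%C)^-1).
    by apply/funext => z; rewrite rmorphM fmorphV.
  exact: (outer_symbolM ok (outer_symbolV ok')).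
have E z : f z - a = (g z - a) *
    (u z / v z * S1_val z ^ (m - n) * (h z * (h' z)^-1) * (k z * (k' z)^-1)).
  rewrite fE gE psiE chiE expfzDr ?S1_val_neq0// -invr_expz.
  have [_ h0 _ _] := oh'; have [_ k0 _ _] := outer_conj ok'.
  have z0 : S1_val z ^ n != 0 by rewrite expfz_neq0// S1_val_neq0.
  move: (S1_val z ^ n) z0 => w w0; move: (S1_val z ^ m) => w'.
  by field; rewrite v0 h0 k0 w0.
rewrite (factored_invertible cga g0 cuv r1 uvq ohh okk E).
split=> [/eqP|/eqP]; rewrite ?subr_eq0 ?eqr_int => /eqP; first by move=> ->.
by move=> ->; rewrite subrr.
Qed.

End wiener_hopf.

(** * The spectrum *)

Theorem theorem8p4 (R : realType) (alpha beta : S1 R -> R[i])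
    (alpha_cont : continuous alpha) (beta_cont : continuous beta) :
  spectrum (singular_op alpha beta) =
    range alpha `|` range beta `|`
    [set a : R[i] | ~ (range alpha `|` range beta) a /\
                    winding_index a alpha <> winding_index a beta].
Proof.
have ca : csymbol alpha by split.
have cb : csymbol beta by split.
apply/seteqP.
(* Because [P + Q = I], subtracting the scalar [a] amounts to subtracting it from both symbols. *)
have spec a : spectrum (singular_op alpha beta) a <->
    ~ invertible_op (singular_op (fun z => alpha z - a) (fun z => beta z - a)).
  have caa := csymbolD ca (csymbol_cst (- a)).
  have cba := csymbolD cb (csymbol_cst (- a)).
  have E x := singular_opB_scale a x ca cb.
  split=> H; apply: contra_not H.
    move=> [_ [B [bB BK KB]]]; exists B; split=> //; split=> x.
      by rewrite E BK.
    by rewrite E KB.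
  move=> [B [bB [BK KB]]]; split; first exact: singular_bounded_operator.
  by exists B; split=> // x; rewrite -E ?BK ?KB.
split=> a.
- move=> /spec nI; have [|nr] := pselect ((range alpha `|` range beta) a); first by left.
  right; split=> // w; apply: nI; apply/singular_invertible_iff => // z.
  + by rewrite subr_eq0; apply/eqP => h; apply: nr; left; exists z.
  + by rewrite subr_eq0; apply/eqP => h; apply: nr; right; exists z.
- have caa := csymbolD ca (csymbol_cst (- a)).
  have cba := csymbolD cb (csymbol_cst (- a)).
  case=> [[[z _ za]|[z _ za]]|[nr w]]; apply/spec => I.
  + by have [] := invertible_nonvanishing z caa cba I; rewrite za subrr eqxx.
  + by have [_] := invertible_nonvanishing z caa cba I; rewrite za subrr eqxx.
  + apply: w; apply/singular_invertible_iff => // z.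
    * by rewrite subr_eq0; apply/eqP => h; apply: nr; left; exists z.
    * by rewrite subr_eq0; apply/eqP => h; apply: nr; right; exists z.
Qed.
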